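(* In the setting of the context (cross-section $S$, $\omega=(0,\ell)$, $\gamma\in[0,\infty]$, quadratic form $Q$ with tensor $\mathbb L$, prestrain $B\in L^2(\omega\times S\times\mathcal Y;\mathbb R^{3\times3})$), define for $x_1\in\omega$: (i) the strain correctors $\chi^{(i)}(x_1)$, $i=1,\dots,4$, as the unique solution in $\boldsymbol H^\gamma_{\rm rel}$ of $\big(E^{(i)}+\chi^{(i)}(x_1),\chi\big)_{x_1}=0$ for all $\chi\in\boldsymbol H^\gamma_{\rm rel}$; (ii) the averaging matrix $\mathbb M(x_1)\in\mathrm{Sym}(4)$ by $\mathbb M(x_1)_{ij}:=\big(E^{(i)}+\chi^{(i)}(x_1),E^{(j)}+\chi^{(j)}(x_1)\big)_{x_1}$; (iii) the vector $b(x_1)\in\mathbb R^4$ by $b(x_1)_i:=\big(B(x_1,\cdot),E^{(i)}+\chi^{(i)}(x_1)\big)_{x_1}$. Then: (a) $\mathbb M(x_1)$ is symmetric positive definite and $\frac1C\le\mathbb M(x_1)\le C$ in the sense of quadratic forms, for a constant $C=C(\alpha,\beta,\gamma,S)$. (b) The map $x_1\mapsto\mathbb M(x_1)$ is piecewise continuous. (c) For all $(K,a)\in\mathrm{Skew}(3)\times\mathbb R$, $Q_{\rm hom}(x_1,K,a)=k\cdot\mathbb M(x_1)k$ where $k:=\big(a,K\cdot K^{(2)},K\cdot K^{(3)},K\cdot K^{(4)}\big)$. (d) With $k(x_1):=\mathbb M(x_1)^{-1}b(x_1)$ one has, for a.e. $x_1\in\omega$, $$K_{\rm eff}(x_1)=\sum_{i=2}^4k_i(x_1)K^{(i)},\qquad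 a_{\rm eff}(x_1)=k_1(x_1).$$
   Context: Notation. $e_1,e_2,e_3$ is the standard basis of $\mathbb R^3$; $\bar x=(x_2,x_3)\in S$; $\bar{\boldsymbol x}:=x_2e_2+x_3e_3\in\mathbb R^3$; $(a\otimes b)c=(b\cdot c)a$; $\mathrm{Sym}(d)$, $\mathrm{Skew}(d)$ are the symmetric and skew-symmetric $d\times d$ matrices; $F\cdot G$ is the Frobenius product; $Y=[0,1)$, $\mathcal Y=\mathbb R/\mathbb Z$; $\bar\nabla=(\partial_2,\partial_3)$; $(v\,|\,N)$ is the $3\times3$ matrix with first column $v$ and last two columns $N\in\mathbb R^{3\times2}$. $S\subset\mathbb R^2$ is a bounded connected open Lipschitz set with $\int_Sx_2=\int_Sx_3=\int_Sx_2x_3=0$; $\omega=(0,\ell)$; $\gamma\in[0,\infty]$; $0<\alpha\le\beta$. Quadratic form. $Q(x_1,\bar x,y,\cdot)$, $x_1\in\omega$, $\bar x\in S$, $y\in\mathbb R$, are quadratic forms on $\mathbb R^{3\times3}$, measurable in $(x_1,\bar x,y)$ (Borel in $x_1$, Lebesgue in $(\bar x,y)$), $1$-periodic in $y$, such that for every $x_1\in\omega$ and a.e. $(\bar x,y)$: $\alpha|\mathrm{sym}\,G|^2\le Q(x_1,\bar x,y,G)\le\beta|\mathrm{sym}\,G|^2$ for all $G$. The tensor $\mathbb L$ is given by $\langle\mathbb LF,G\rangle=\frac12(Q(F+G)-Q(F)-Q(G))$, and $x_1\mapsto\mathbb L(x_1,\cdot)\in L^\infty(S\times\mathbb R;\mathrm{Lin}(\mathbb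 R^{3\times3},\mathbb R^{3\times3}))$ is piecewise continuous. For $F,G\in L^2(S\times\mathcal Y;\mathbb R^{3\times3})$ let $(F,G)_{x_1}=\iint_{S\times Y}\langle\mathbb L(x_1,\bar x,y)F,G\rangle\,dy\,d\bar x$; it is a scalar product on $\boldsymbol H=L^2(S\times\mathcal Y;\mathrm{Sym}(3))$ with norm $\|\cdot\|_{x_1}$. Strain spaces. For $(K,a)\in\mathrm{Skew}(3)\times\mathbb R$ let $\mathbf E(K,a)=\mathrm{sym}[(K\bar{\boldsymbol x}+ae_1)\otimes e_1]$, a map $S\to\mathrm{Sym}(3)$. $\boldsymbol H^\gamma_{\rm rel}\subset\boldsymbol H$ is: for $\gamma=0$: all $\mathrm{sym}[((\partial_y\Psi)\bar{\boldsymbol x}+\partial_y\hat\phi\,|\,\bar\nabla\bar\phi)]$ with $\Psi\in H^1(\mathcal Y;\mathrm{Skew}(3))$, $\hat\phi\in H^1(\mathcal Y;\mathbb R^3)$, $\bar\phi\in L^2(\mathcal Y;H^1(S;\mathbb R^3))$; for $\gamma=\infty$: all $\mathrm{sym}[(\partial_y\hat\phi\,|\,\bar\nabla\bar\phi)]$ with $\hat\phi\in L^2(S;H^1(\mathcal Y;\mathbb R^3))$, $\bar\phi\in H^1(S;\mathbb R^3)$; for $\gamma\in(0,\infty)$: all $\mathrm{sym}[(\partial_y\phi\,|\,\frac1\gamma\bar\nabla\phi)]$ with $\phi\in H^1(S\times\mathcal Y;\mathbb R^3)$. It is a closed subspace. Let $\boldsymbol H^\gamma=\{\mathbf E(K,a)+\chi:(K,a)\in\mathrm{Skew}(3)\times\mathbb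 R,\ \chi\in\boldsymbol H^\gamma_{\rm rel}\}$ and let $P^{\gamma,x_1}_{\rm rel}$ be the $(\cdot,\cdot)_{x_1}$-orthogonal projection of $\boldsymbol H$ onto the orthogonal complement of $\boldsymbol H^\gamma_{\rm rel}$ in $\boldsymbol H^\gamma$. Basis. $K^{(2)}=\frac1{\sqrt2}(e_2\otimes e_1-e_1\otimes e_2)$, $K^{(3)}=\frac1{\sqrt2}(e_3\otimes e_1-e_1\otimes e_3)$, $K^{(4)}=\frac1{\sqrt2}(e_3\otimes e_2-e_2\otimes e_3)$, an orthonormal basis of $\mathrm{Skew}(3)$; $E^{(1)}=\mathbf E(0,1)$ and $E^{(i)}=\mathbf E(K^{(i)},0)$ for $i=2,3,4$. Effective quantities. $Q_{\rm hom}(x_1,K,a)=\inf_{\chi\in\boldsymbol H^\gamma_{\rm rel}}\iint_{S\times Y}Q(x_1,\bar x,y,\mathbf E(K,a)+\chi(\bar x,y))\,dy\,d\bar x$. The field $(K_{\rm eff},a_{\rm eff})\in L^2(\omega;\mathrm{Skew}(3)\times\mathbb R)$ is the unique one with $P^{\gamma,x_1}_{\rm rel}\mathbf E(K_{\rm eff}(x_1),a_{\rm eff}(x_1))=P^{\gamma,x_1}_{\rm rel}\mathrm{sym}\,B(x_1,\cdot)$ for a.e. $x_1\in\omega$ (for each $x_1$, $(K,a)\mapsto P^{\gamma,x_1}_{\rm rel}\mathbf E(K,a)$ is a linear isomorphism onto the orthogonal complement of $\boldsymbol H^\gamma_{\rm rel}$ in $\boldsymbol H^\gamma$). *)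

(* Defs.v *)
From mathcomp Require Import all_boot all_order all_algebra.
From mathcomp Require Import all_classical all_reals all_analysis.
Set Implicit Arguments.
Unset Strict Implicit.
Unset Printing Implicit Defensive.
Import Order.TTheory GRing.Theory Num.Theory.
Import numFieldNormedType.Exports.
Local Open Scope classical_set_scope.
Local Open Scope ring_scope.

(* A point of the cross-section is (x_2, x_3) : R * R, a point of S x R or of
   S x Y is z = ((x_2, x_3), y) : R * R * R.  Functions on the torus R / Z are
   represented by their restriction to Y = [0, 1[ (for L^2 classes) or by
   1-periodic functions (for test functions). *)

Section Lebesgue.
Context {R : realType}.
Local Notation mR := (measurableTypeR R).
Local Notation mu := (@lebesgue_measure R).

Definition leb1 : {measure set mR -> \bar R} := mu.
Definition leb2 : {measure set (mR * mR) -> \bar R} := (mu \x mu)%E.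
Definition leb3 : {measure set (mR * mR * mR) -> \bar R} :=
  ((mu \x mu) \x mu)%E.
(* the last coordinate is x_1, the first three are z *)
Definition leb4 : {measure set (mR * mR * mR * mR) -> \bar R} :=
  (((mu \x mu) \x mu) \x mu)%E.

(* [leb3] lives on the Borel sets; [lpoint] is R^3 with the sigma-algebra of
   Lebesgue measurable sets and [cleb3] the complete Lebesgue measure on it.
   They are needed because the quadratic form is only Lebesgue measurable. *)
Definition lpoint := caratheodory_type (leb3^*)%mu.
Definition cleb3 : {measure set lpoint -> \bar R} :=
  @completed_measure_extension _ _ _ leb3.

(* Elements of L^2 are classes modulo equality almost everywhere, and every
   class has a Borel representative: only those are considered. *)
Definition L2 d (T : measurableType d) (mu : {measure set T -> \bar R})
    (D : set T) (f : T -> R) : Prop :=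
  measurable_fun D f /\ mu.-integrable D (fun x => ((f x) ^+ 2)%:E).

(* g = del f weakly on D, where the derivation del is tested against [test] *)
Definition weak_derivative d (T : measurableType d)
    (mu : {measure set T -> \bar R}) (D : set T) (test : set (T -> R))
    (del : (T -> R) -> (T -> R)) (f g : T -> R) : Prop :=
  forall eta, test eta ->
    \int[mu]_(x in D) (f x * del eta x) = - \int[mu]_(x in D) (g x * eta x).

Fixpoint Ck (V : normedModType R) (k : nat) (f : V -> R) : Prop :=
  continuous f /\
  if k is k'.+1 then
    forall v : V, (forall x, derivable f x v) /\ Ck k' ('D_v f)
  else True.

Definition smooth (V : normedModType R) (f : V -> R) : Prop :=
  forall k, Ck k f.

End Lebesgue.

Section Domain.
Context {R : realType}.

(* near each boundary point, in some rotated orthonormal coordinates, the set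
   is the strict epigraph of a Lipschitz function *)
Definition lipschitz_boundary (S : set (R * R)) : Prop :=
  forall p : R * R, (closure S `\` S) p ->
  exists (c s r k : R) (f : R -> R),
    [/\ c ^+ 2 + s ^+ 2 = 1, 0 < r, k.-lipschitz f &
        forall x : R * R, ball p r x ->
          (S x <-> f (c * x.1 + s * x.2) < c * x.2 - s * x.1)].

Definition cross_section (S : set (R * R)) : Prop :=
  [/\ open S, connected S, S !=set0, bounded_set S & lipschitz_boundary S] /\
  [/\ \int[leb2]_(x in S) x.1 = 0, \int[leb2]_(x in S) x.2 = 0 &
      \int[leb2]_(x in S) (x.1 * x.2) = 0].

Definition Y : set R := `[0, 1[.

Definition cell (S : set (R * R)) : set (R * R * R) :=
  [set z | S z.1 /\ Y z.2].

End Domain.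

Section Matrices.
Context {R : realType}.
Local Notation M3 := 'M[R]_3.

Definition frob n (F G : 'M[R]_n) : R := \tr (F^T *m G).
Definition fnorm n (F : 'M[R]_n) : R := Num.sqrt (frob F F).
Definition symp (F : M3) : M3 := 2^-1 *: (F + F^T).
Definition skew_mx (K : M3) : Prop := K^T = - K.

Definition e1 : 'cV[R]_3 := delta_mx 0 0.
Definition e2 : 'cV[R]_3 := delta_mx 1 0.
Definition e3 : 'cV[R]_3 := delta_mx 2 0.
Definition tensor (a b : 'cV[R]_3) : M3 := a *m b^T.
Definition xvec (x : R * R) : 'cV[R]_3 := x.1 *: e2 + x.2 *: e3.

Definition K2 : M3 := (Num.sqrt 2)^-1 *: (tensor e2 e1 - tensor e1 e2).
Definition K3 : M3 := (Num.sqrt 2)^-1 *: (tensor e3 e1 - tensor e1 e3).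
Definition K4 : M3 := (Num.sqrt 2)^-1 *: (tensor e3 e2 - tensor e2 e3).

Definition colN (v : 'cV[R]_3) (N : 'M[R]_(3, 2)) : M3 := row_mx v N.

Definition polar (q : M3 -> R) (F G : M3) : R :=
  2^-1 * (q (F + G) - q F - q G).

Definition quadratic_form (q : M3 -> R) : Prop :=
  (forall (t : R) G, q (t *: G) = t ^+ 2 * q G) /\
  forall F, linear (polar q F : M3 -> R^o).

End Matrices.

Section Spaces.
Context {R : realType} (S : set (R * R)).
Local Notation M3 := 'M[R]_3.
Local Notation field := (R * R * R -> M3).

Definition test_section : set (R * R -> R) :=
  [set eta : R * R -> R | smooth eta /\
     exists K : set (R * R), [/\ compact K, K `<=` S & forall x, ~ K x -> eta x = 0]].

Definition test_circle : set (R -> R) :=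
  [set eta : R -> R | smooth (eta : R^o -> R) /\ periodic eta 1].

Definition test_cell : set (R * R * R -> R) :=
  [set eta : R * R * R -> R |
   [/\ smooth eta, forall x : R * R, periodic (fun y : R => eta (x, y)) 1 &
     exists K : set (R * R), [/\ compact K, K `<=` S &
                   forall x y, ~ K x -> eta (x, y) = 0]]].

Definition dir2 (j : 'I_2) : R * R := if j == 0 then (1, 0) else (0, 1).
Definition dir3 (j : 'I_2) : R * R * R := (dir2 j, 0).
Definition diry : R * R * R := (0, 0, 1).

(* phi in H^1(R/Z), with weak derivative dphi; similarly below *)
Definition H1_circle (phi dphi : R -> R) : Prop :=
  [/\ L2 leb1 Y phi, L2 leb1 Y dphi &
      weak_derivative leb1 Y test_circle (fun eta => 'D_(1 : R^o) eta)
        phi dphi].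

(* phi in H^1(S; R^3) with gradient N *)
Definition H1_section (phi : R * R -> 'cV[R]_3) (N : R * R -> 'M[R]_(3, 2))
  : Prop :=
  forall i, L2 leb2 S (fun x => phi x i 0) /\
  forall j, L2 leb2 S (fun x => N x i j) /\
    weak_derivative leb2 S test_section (fun eta => 'D_(dir2 j) eta)
      (fun x => phi x i 0) (fun x => N x i j).

(* phi in L^2(R/Z; H^1(S; R^3)), i.e. phi and its weak gradient in the
   cross-section directions are in L^2(S x R/Z) *)
Definition L2H1_section (phi : R * R * R -> 'cV[R]_3)
    (N : R * R * R -> 'M[R]_(3, 2)) : Prop :=
  forall i, L2 leb3 (cell S) (fun z => phi z i 0) /\
  forall j, L2 leb3 (cell S) (fun z => N z i j) /\
    weak_derivative leb3 (cell S) test_cell (fun eta => 'D_(dir3 j) eta)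
      (fun z => phi z i 0) (fun z => N z i j).

(* phi in L^2(S; H^1(R/Z; R^3)), i.e. phi and its weak derivative in y are in
   L^2(S x R/Z) *)
Definition L2H1_circle (phi dphi : R * R * R -> 'cV[R]_3) : Prop :=
  forall i, [/\ L2 leb3 (cell S) (fun z => phi z i 0),
    L2 leb3 (cell S) (fun z => dphi z i 0) &
    weak_derivative leb3 (cell S) test_cell (fun eta => 'D_diry eta)
      (fun z => phi z i 0) (fun z => dphi z i 0)].

Definition H1_cell (phi dphi : R * R * R -> 'cV[R]_3)
    (N : R * R * R -> 'M[R]_(3, 2)) : Prop :=
  L2H1_circle phi dphi /\ L2H1_section phi N.

Definition L2field (F : field) : Prop :=
  forall i j, L2 leb3 (cell S) (fun z => F z i j).

Definition Hsym : set field :=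
  [set F | L2field F /\
           {ae leb3, forall z, cell S z -> (F z)^T = F z}].

Definition eqf (F G : field) : Prop := {ae leb3, forall z, cell S z -> F z = G z}.

Definition Estrain (K : M3) (a : R) : field :=
  fun z => symp (tensor (K *m xvec z.1 + a *: e1) e1).

Definition Hrel_zero : set field :=
  [set F | Hsym F /\
   exists (Psi dPsi : R -> M3) (phih dphih : R -> 'cV[R]_3)
          (phib : R * R * R -> 'cV[R]_3) (N : R * R * R -> 'M[R]_(3, 2)),
   [/\ forall y, skew_mx (Psi y),
       forall i j, H1_circle (fun y => Psi y i j) (fun y => dPsi y i j),
       forall i, H1_circle (fun y => phih y i 0) (fun y => dphih y i 0),
       L2H1_section phib N &
       eqf F (fun z => symp (colN (dPsi z.2 *m xvec z.1 + dphih z.2) (N z)))]].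

Definition Hrel_infty : set field :=
  [set F | Hsym F /\
   exists (phih dphih : R * R * R -> 'cV[R]_3)
          (phib : R * R -> 'cV[R]_3) (N : R * R -> 'M[R]_(3, 2)),
   [/\ L2H1_circle phih dphih, H1_section phib N &
       eqf F (fun z => symp (colN (dphih z) (N z.1)))]].

Definition Hrel_fin (g : R) : set field :=
  [set F | Hsym F /\
   exists (phi dphi : R * R * R -> 'cV[R]_3) (N : R * R * R -> 'M[R]_(3, 2)),
   H1_cell phi dphi N /\
   eqf F (fun z => symp (colN (dphi z) (g^-1 *: N z)))].

(* only used for 0 <= gamma *)
Definition Hrel (gamma : \bar R) : set field :=
  match gamma with
  | EFin g => if g == 0 then Hrel_zero else Hrel_fin g
  | EPInf => Hrel_infty
  | ENInf => set0
  end.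

Definition Hgamma (gamma : \bar R) : set field :=
  [set F | exists K a chi,
     [/\ skew_mx K, Hrel gamma chi & F = (fun z => Estrain K a z + chi z)]].

(* X is (sequentially) closed in Hsym for the L^2 norm *)
Definition closed_in_H (X : set field) : Prop :=
  forall (F_ : nat -> field) (F : field), (forall n, X (F_ n)) -> Hsym F ->
    (fun n => \int[leb3]_(z in cell S) (fnorm (F_ n z - F z)) ^+ 2) @ \oo --> 0
    -> X F.

End Spaces.

Section Material.
Context {R : realType} (S : set (R * R)).
Local Notation M3 := 'M[R]_3.
Local Notation field := (R * R * R -> M3).

(* u is piecewise continuous on ]0, l[: it agrees, on each open interval of a
   finite subdivision, with a map continuous on the closed interval.  The
   relation [close eps a b] says that a and b are at distance <= eps. *)
Definition piecewise_continuous (V : Type) (close : R -> V -> V -> Prop)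
    (l : R) (u : R -> V) : Prop :=
  exists s : seq R,
    [/\ sorted <%R (0 :: s), last 0 s = l &
     forall k, (k < size s)%N -> let a := (0 :: s)`_k in let b := s`_k in
     exists w : R -> V,
       {in `]a, b[, w =1 u} /\
       forall x : R, x \in `[a, b] -> forall eps : R, 0 < eps ->
       exists2 delta : R, 0 < delta &
         forall x' : R, x' \in `[a, b] -> `|x' - x| < delta ->
                    close eps (w x) (w x')].

(* L^oo(S x R; Lin(R^{3x3}, R^{3x3})) distance; a field of linear maps L is
   given by the forms (F, G) |-> <L F, G> *)
Definition close_tensor (eps : R) (L L' : R * R * R -> M3 -> M3 -> R) : Prop :=
  {ae leb3, forall z, S z.1 ->
     forall F G, `|L z F G - L' z F G| <= eps * fnorm F * fnorm G}.

Definition close_mx n (eps : R) (A A' : 'M[R]_n) : Prop :=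
  fnorm (A - A') <= eps.

Definition admissible (l alpha beta : R) (Q : R -> R * R * R -> M3 -> R)
  : Prop :=
  [/\ forall (x1 : R) z, 0 < x1 < l -> S z.1 -> quadratic_form (Q x1 z),
      forall G, measurable_fun
        ([set p | S p.1.1 /\ 0 < p.2 < l] : set (lpoint * measurableTypeR R))
        (fun p => Q p.2 p.1 G),
      forall (x1 : R) x G, 0 < x1 < l -> S x -> periodic (fun y => Q x1 (x, y) G) 1,
      forall x1 : R, 0 < x1 < l -> {ae leb3, forall z, S z.1 -> forall G,
        alpha * fnorm (symp G) ^+ 2 <= Q x1 z G <= beta * fnorm (symp G) ^+ 2} &
      piecewise_continuous close_tensor l (fun x1 z => polar (Q x1 z))].

(* for one fixed x_1 : q = Q(x_1, .) *)
Variable q : R * R * R -> M3 -> R.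

Definition ip (F G : field) : R :=
  \int[cleb3]_(z in (cell S : set lpoint)) polar (q z) (F z) (G z).

Variable gamma : \bar R.

(* P is the ip-orthogonal projection of F onto the orthogonal complement of
   Hrel in Hgamma *)
Definition orthoc : set field :=
  [set F | Hgamma S gamma F /\ forall chi, Hrel S gamma chi -> ip F chi = 0].

Definition is_Prel (F P : field) : Prop :=
  orthoc P /\ forall G, orthoc G -> ip (fun z => F z - P z) G = 0.

Definition Qhom (K : M3) (a : R) : R :=
  inf [set \int[cleb3]_(z in (cell S : set lpoint))
             q z (Estrain K a z + chi z) | chi in Hrel S gamma].

(* E^(1), ..., E^(4) are indexed by 'I_4 from 0 *)
Definition Kb (i : 'I_4) : M3 := [:: 0; K2; K3; K4]`_i.
Definition Eb (i : 'I_4) : field :=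
  if i == 0 then Estrain 0 1 else Estrain (Kb i) 0.

Definition is_corrector (i : 'I_4) (chi : field) : Prop :=
  Hrel S gamma chi /\
  forall psi, Hrel S gamma psi -> ip (fun z => Eb i z + chi z) psi = 0.

Definition avg (chi : 'I_4 -> field) : 'M[R]_4 :=
  \matrix_(i, j) ip (fun z => Eb i z + chi i z) (fun z => Eb j z + chi j z).

Definition bvec (B : field) (chi : 'I_4 -> field) : 'cV[R]_4 :=
  \col_i ip B (fun z => Eb i z + chi i z).

Definition coords (K : M3) (a : R) : 'cV[R]_4 :=
  \col_(i < 4) (if i == 0 then a else frob K (Kb i)).

End Material.

Definition qf {R : realType} (M : 'M[R]_4) (k : 'cV[R]_4) : R :=
  (k^T *m (M *m k)) 0 0.

(* Main.v *)
(* Existence and uniqueness of the correctors is orthogonal projection of the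
   strains E^(i) along the closed space of relaxation fields.  Pythagoras' theorem
   then gives k . M k = min over chi of |E(K, a) + chi|^2, which is (c), and the
   upper bound in (a) by taking chi = 0.  The lower bound is the estimate
   |(K, a)|^2 <= C |E(K, a) + chi|^2: test the entry (1,1) of the strain with a bump
   function eta(x_2, x_3) and with its two derivatives, and the entries (1,2), (1,3)
   with (d_3 eta, - d_2 eta).  The contribution of chi vanishes in all of them, for
   every gamma, because y-derivatives have mean zero and gradients are curl free;
   what remains determines (K, a).
   For (b), orthogonality yields M(x)_ij - M(x')_ij as a difference of the two
   scalar products of the same two bounded fields, so M inherits the modulus of
   continuity of the tensor.  For (d), pair the equality of the two projections
   with E^(i) + chi^(i), which lies in the orthogonal complement. *)
From HB Require Import structures.
Require Import Defs.
From mathcomp Require Import all_boot all_order all_algebra.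
From mathcomp Require Import all_classical all_reals all_analysis.
From mathcomp Require Import measurable_realfun ring lra.
Set Implicit Arguments.
Unset Strict Implicit.
Unset Printing Implicit Defensive.
Import Order.TTheory GRing.Theory Num.Theory.
Import numFieldNormedType.Exports.
Local Open Scope classical_set_scope.
Local Open Scope ring_scope.

(** * Integrable and square-integrable functions *)

(** The form is only Lebesgue measurable in the cell variable, so its integrals are taken against
    the completed measure [cleb3], whereas fields and their norms live on the Borel sets with
    [leb3]. Bounds cross from one to the other through nonnegative integrands. Fields are plain
    functions, not classes: the scalar product is bilinear only on [L2field] and definite only up to
    null sets, and the projection argument is set up for such forms. Near-minimisers can be chosen
    with increments of order 4^-n, so completeness is needed only along sequences with this rate.
    The test function behind the lower bound is a product of two one-variable bumps: its moments
    factor by Fubini and its mixed derivatives commute by inspection. It depends on [S] alone, which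
    makes the constant uniform in [gamma]. At an end point of a piece of the subdivision the limit
    tensor need not be the tensor of a material, so no correctors are available there. Continuity of
    the averaging matrix is therefore obtained from a Cauchy criterion at interior points, followed
    by an extension to the closed interval. *)

Section IntegrableReal.
Context d (T : measurableType d) (R : realType).
Variables (mu : {measure set T -> \bar R}) (D : set T).
Hypothesis mD : measurable D.
Implicit Types f g : T -> R.

Lemma eq_integrable_real f g : (forall x, D x -> f x = g x) ->
  mu.-integrable D (EFin \o f) -> mu.-integrable D (EFin \o g).
Proof. by move=> fg; apply: eq_integrable => // x /set_mem /fg /= ->. Qed.

Lemma integrable_zero : mu.-integrable D (EFin \o (fun=> 0 : R)).
Proof. exact: integrable0. Qed.

Lemma integrable_addr f g : mu.-integrable D (EFin \o f) ->
  mu.-integrable D (EFin \o g) -> mu.-integrable D (EFin \o (fun x => f x + g x)).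
Proof. by move=> hf hg; exact: (integrableD mD hf hg). Qed.

Lemma integrable_scaler k f : mu.-integrable D (EFin \o f) ->
  mu.-integrable D (EFin \o (fun x => k * f x)).
Proof. by move=> hf; exact: (integrableZl mD k hf). Qed.

Lemma integrable_sumr (I : Type) (s : seq I) (h : I -> T -> R) :
  (forall i, mu.-integrable D (EFin \o h i)) ->
  mu.-integrable D (EFin \o (fun x => \sum_(i <- s) h i x)).
Proof.
move=> hh; elim: s => [|i s IH].
  by apply: (eq_integrable_real _ integrable_zero) => x _; rewrite big_nil.
apply: (eq_integrable_real _ (integrable_addr (hh i) IH)) => x _.
by rewrite big_cons.
Qed.

Lemma Rintegral_sum (I : Type) (s : seq I) (h : I -> T -> R) :
  (forall i, mu.-integrable D (EFin \o h i)) ->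
  \int[mu]_(x in D) (\sum_(i <- s) h i x) =
  \sum_(i <- s) \int[mu]_(x in D) h i x.
Proof.
move=> hh; elim: s => [|i s IH].
  rewrite big_nil (@eq_Rintegral _ _ _ _ _ (cst 0)) ?Rintegral_cst ?mul0r// => x _.
  by rewrite big_nil.
rewrite big_cons -IH -RintegralD //; last exact: integrable_sumr.
by apply: eq_Rintegral => x _; rewrite big_cons.
Qed.

Lemma EFin_Rintegral f : mu.-integrable D (EFin \o f) ->
  (\int[mu]_(x in D) f x)%:E = (\int[mu]_(x in D) (f x)%:E)%E.
Proof. by move=> jf; rewrite fineK //; exact: integrable_fin_num jf. Qed.

Lemma integrable_dominated f g : measurable_fun D f ->
  mu.-integrable D (EFin \o g) -> (forall x, D x -> `|f x| <= g x) ->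
  mu.-integrable D (EFin \o f).
Proof.
move=> mf ig fg; apply: (le_integrable mD _ _ ig); first exact/measurable_EFinP.
by move=> x Dx /=; rewrite lee_fin (le_trans (fg x Dx))// ler_norm.
Qed.

Lemma integrable_ae_dominated f g : measurable_fun D f ->
  mu.-integrable D (EFin \o g) -> {ae mu, forall x, D x -> `|f x| <= g x} ->
  mu.-integrable D (EFin \o f).
Proof.
move=> mf /integrableP[mg ig] fg; apply/integrableP; split.
  exact/measurable_EFinP.
apply: le_lt_trans ig; apply: ae_ge0_le_integral => //=.
- by apply/measurable_EFinP; apply: measurableT_comp.
- by apply/measurable_EFinP; apply: measurableT_comp => //; exact/measurable_EFinP.
- apply: filterS fg => x /[apply] fg.
  by rewrite lee_fin (le_trans fg) // ler_norm.
Qed.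

Lemma le_ae_Rintegral f g : mu.-integrable D (EFin \o f) ->
  mu.-integrable D (EFin \o g) -> {ae mu, forall x, D x -> f x <= g x} ->
  \int[mu]_(x in D) f x <= \int[mu]_(x in D) g x.
Proof.
move=> jf jg fg; rewrite -subr_ge0 -RintegralB //.
have jgf : mu.-integrable D (EFin \o (fun x => g x - f x)).
  exact: (integrableB mD jg jf).
(* [g - f] is nonnegative only almost everywhere; its absolute value is nonnegative everywhere and
   has the same integral. *)
have -> : \int[mu]_(x in D) (g x - f x) = \int[mu]_(x in D) `|g x - f x|.
  congr fine; apply: ae_eq_integral => //=.
  - by case/integrableP : jgf.
  - apply/measurable_EFinP; apply: measurableT_comp => //.
    by case/integrableP : jgf => /measurable_EFinP.
  - apply: filterS fg => x fg Dx; rewrite ger0_norm // subr_ge0; exact: fg.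
by apply: Rintegral_ge0.
Qed.

Lemma Rintegral_lin a b f g : mu.-integrable D (EFin \o f) ->
  mu.-integrable D (EFin \o g) ->
  \int[mu]_(x in D) (a * f x + b * g x) =
  a * \int[mu]_(x in D) f x + b * \int[mu]_(x in D) g x.
Proof.
move=> jf jg; rewrite RintegralD //; try exact: integrable_scaler.
by rewrite !RintegralZl.
Qed.

Lemma eq_ae_Rintegral f g : mu.-integrable D (EFin \o f) ->
  measurable_fun D g -> {ae mu, forall x, D x -> f x = g x} ->
  \int[mu]_(x in D) f x = \int[mu]_(x in D) g x.
Proof.
move=> /integrableP[mf _] mg fg; congr fine; apply: ae_eq_integral => //.
  exact/measurable_EFinP.
by apply: filterS fg => x fg Dx; rewrite fg.
Qed.

Lemma ae_eq0_Rintegral f : mu.-integrable D (EFin \o f) ->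
  (forall x, D x -> 0 <= f x) -> \int[mu]_(x in D) f x = 0 ->
  {ae mu, forall x, D x -> f x = 0}.
Proof.
move=> jf f0 If.
have /(ae_eq_integral_abs mu mD) : measurable_fun D (EFin \o f).
  by case/integrableP : jf.
case=> [+ _]; have -> : (\int[mu]_(x in D) `|(EFin \o f) x| = 0)%E.
  rewrite -[LHS]fineK; last exact/integrable_fin_num/integrable_abse.
  rewrite -[0%E]/(0%:E) -If; congr EFin; congr fine.
  by apply: eq_integral => x /set_mem Dx /=; rewrite ger0_norm // f0.
by move=> /(_ erefl); apply: filterS => x + Dx => /(_ Dx) [].
Qed.

End IntegrableReal.

Section L2_space.
Context d (T : measurableType d) (R : realType).
Variables (mu : {measure set T -> \bar R}) (D : set T).
Hypothesis mD : measurable D.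
Implicit Types f g : T -> R.

Lemma L2_mul_integrable f g : L2 mu D f -> L2 mu D g ->
  mu.-integrable D (EFin \o (fun x => f x * g x)).
Proof.
move=> [mf jf] [mg jg].
apply: (integrable_dominated mD (g := fun x => f x ^+ 2 + g x ^+ 2)).
- exact: measurable_funM.
- exact: integrable_addr.
- move=> x _; rewrite normrM -(real_normK (num_real (f x))).
  rewrite -(real_normK (num_real (g x))).
  by move: `|f x| `|g x| (normr_ge0 (f x)) (normr_ge0 (g x)) => a b a0 b0; nra.
Qed.

Lemma L2_lin a b f g : L2 mu D f -> L2 mu D g ->
  L2 mu D (fun x => a * f x + b * g x).
Proof.
move=> hf hg; case: (hf) (hg) => [mf jf] [mg jg]; split.
  by apply: measurable_funD; apply: measurable_funM.
apply: (eq_integrable_real mD _ (integrable_addr mD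
  (integrable_addr mD (integrable_scaler mD (a ^+ 2) jf)
     (integrable_scaler mD (b ^+ 2) jg))
  (integrable_scaler mD (2 * a * b) (L2_mul_integrable hf hg)))) => x _.
by ring.
Qed.

Lemma L2D f g : L2 mu D f -> L2 mu D g -> L2 mu D (fun x => f x + g x).
Proof.
by move=> hf hg; have := L2_lin 1 1 hf hg; under eq_fun do rewrite !mul1r.
Qed.

Lemma L2B f g : L2 mu D f -> L2 mu D g -> L2 mu D (fun x => f x - g x).
Proof.
by move=> hf hg; have := L2_lin 1 (-1) hf hg; under eq_fun do rewrite mul1r mulN1r.
Qed.

Lemma L2Z a f : L2 mu D f -> L2 mu D (fun x => a * f x).
Proof.
by move=> hf; have := L2_lin a 0 hf hf; under eq_fun do rewrite mul0r addr0.
Qed.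

Lemma L2_0 : L2 mu D (cst 0).
Proof.
split; first exact: measurable_cst.
apply: (eq_integrable_real mD (f := fun=> 0)); last exact: integrable_zero.
by move=> x _; rewrite expr0n.
Qed.

Lemma L2_eq f g : (forall x, D x -> f x = g x) -> L2 mu D f -> L2 mu D g.
Proof.
move=> fg [mf jf]; split.
  by apply: eq_measurable_fun mf => x /set_mem /fg.
by apply: (eq_integrable_real mD _ jf) => x /fg ->.
Qed.

Lemma L2_mul_bounded f g (c : R) : L2 mu D f -> measurable_fun D g ->
  (forall x, D x -> `|g x| <= c) -> L2 mu D (fun x => f x * g x).
Proof.
move=> [mf jf] mg gc; split; first exact: measurable_funM.
apply: (integrable_dominated mD (g := fun x => c ^+ 2 * (f x) ^+ 2)).
- by apply: measurable_funX; exact: measurable_funM.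
- exact: integrable_scaler.
- move=> x Dx; rewrite normrX normrM exprMn real_normK ?num_real // mulrC.
  rewrite ler_wpM2r ?sqr_ge0 //.
  by rewrite ler_sqr ?nnegrE ?(le_trans (normr_ge0 _) (gc x Dx)) // gc.
Qed.

Hypothesis muD : (mu D < +oo)%E.

Lemma L2_bounded f (c : R) : measurable_fun D f ->
  (forall x, D x -> `|f x| <= c) -> L2 mu D f.
Proof.
move=> mf fc; split => //.
apply: measurable_bounded_integrable => //; first exact: measurable_funX.
exists (c ^+ 2); split; first by rewrite num_real.
move=> y cy x Dx; apply/ltW/le_lt_trans/cy.
rewrite normrX ler_sqr ?nnegrE ?(le_trans (normr_ge0 _) (fc x Dx)) //.
exact: fc.
Qed.

Lemma L2_cst c : L2 mu D (cst c).
Proof. by apply: (@L2_bounded _ `|c|) => //; exact: measurable_cst. Qed.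

Lemma L2_integrable f : L2 mu D f -> mu.-integrable D (EFin \o f).
Proof.
move=> hf; have := L2_mul_integrable hf (L2_cst 1).
by apply: eq_integrable_real => // x _ /=; rewrite mulr1.
Qed.

End L2_space.

Section L2_completeness.
Context d (T : measurableType d) (R : realType).
Variables (mu : {measure set T -> \bar R}) (D : set T).
Hypothesis mD : measurable D.
Hypothesis muD : (mu D < +oo)%E.

(* The increments are summable in L^1 since D has finite measure, so their sum
   is finite almost everywhere; Fatou's lemma bounds the distance to the
   pointwise limit. *)
Lemma L2_complete (f : nat -> T -> R) : (forall n, L2 mu D (f n)) ->
  (forall n m, (n <= m)%N ->
     \int[mu]_(x in D) (f m x - f n x) ^+ 2 <= (4^-1) ^+ n) ->
  exists2 g, L2 mu D g &
    forall n, \int[mu]_(x in D) (f n x - g x) ^+ 2 <= (4^-1) ^+ n.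
Proof.
move=> hf hc.
pose g n x : R := `|f n.+1 x - f n x|.
have g0 n x : 0 <= g n x by exact: normr_ge0.
have L2d n m : L2 mu D (fun x => f m x - f n x) by exact: L2B.
have mg n : measurable_fun D (g n).
  by apply: measurableT_comp => //; case: (L2d n n.+1).
have jg n : mu.-integrable D (EFin \o g n).
  by apply/integrable_norm/L2_integrable.
(* With k = 2^-n, the inequality t <= t^2 / (2 k) + k / 2 and the bound k^2 on the integral of [g n]
   squared give the bound k (1 + mu D) / 2 on the integral of [g n]. *)
pose c : R := (1 + fine (mu D)) / 2.
have c0 : 0 <= c by rewrite divr_ge0 // addr_ge0 // fine_ge0.
have Ig n : \int[mu]_(x in D) g n x <= c * (2^-1) ^+ n.
  pose k : R := 2^-1 ^+ n.
  have k0 : 0 < k by rewrite exprn_gt0.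
  have jd : mu.-integrable D (EFin \o (fun x => (f n.+1 x - f n x) ^+ 2)).
    by case: (L2d n n.+1).
  have j1 := integrable_scaler mD (2 * k)^-1 jd.
  have j2 : mu.-integrable D (EFin \o (fun=> k / 2)).
    exact/L2_integrable/L2_cst.
  apply: (@le_trans _ _ (\int[mu]_(x in D)
      ((2 * k)^-1 * (f n.+1 x - f n x) ^+ 2 + k / 2))).
    apply: le_Rintegral => //; first exact: integrable_addr.
    move=> x Dx; rewrite /g -(real_normK (num_real (_ - _))).
    move: `|_| (normr_ge0 (f n.+1 x - f n x)) => t t0.
    have k2 : 0 < 2 * k by rewrite mulr_gt0.
    rewrite -(ler_pM2l k2) mulrDr mulrA divff ?gt_eqF // mul1r.
    by have := sqr_ge0 (t - k); nra.
  rewrite RintegralD // Rintegral_cst // RintegralZl //.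
  have := hc n n.+1 (leqnSn n).
  have -> : (4^-1 : R) ^+ n = k * k.
    by rewrite -exprMn; congr (_ ^+ n); field.
  move: (\int[mu]_(x in D) _) => I II.
  rewrite -/k /c.
  have : (2 * k)^-1 * I <= (2 * k)^-1 * (k * k).
    by rewrite ler_pM2l // invr_gt0 mulr_gt0.
  have -> : (2 * k)^-1 * (k * k) = k / 2 by field; rewrite gt_eqF.
  by lra.
pose G x : \bar R := (\sum_(0 <= n <oo) (g n x)%:E)%E.
have mG : measurable_fun D G.
  apply: (ge0_emeasurable_sum (P := xpredT)) => [k x Dx _|k _].
    by rewrite lee_fin g0.
  exact/measurable_EFinP.
have G0 x : D x -> (0 <= G x)%E.
  by move=> Dx; apply: nneseries_ge0 => n _ _; rewrite lee_fin g0.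
have IG : (\int[mu]_(x in D) G x < +oo)%E.
  rewrite integral_nneseries //; last 2 first.
  - by move=> n; exact/measurable_EFinP.
  - by move=> n x _; rewrite lee_fin g0.
  apply: (@le_lt_trans _ _ (c * 2)%:E); last exact: ltry.
  apply: lime_le; first by apply: is_cvg_nneseries => n _ _; apply: integral_ge0 => x _; rewrite lee_fin g0.
  apply: nearW => n.
  have -> : (\sum_(0 <= i < n) \int[mu]_(x in D) (g i x)%:E)%E =
    (\sum_(0 <= i < n) \int[mu]_(x in D) g i x)%:E.
    by rewrite -sumEFin; apply: eq_bigr => i _; rewrite EFin_Rintegral.
  rewrite lee_fin.
  apply: (le_trans (ler_sum _ (fun i _ => Ig i))).
  rewrite -mulr_sumr ler_wpM2l //.
  have -> : \sum_(0 <= i < n) (2^-1 : R) ^+ i = 2 - 2 * 2^-1 ^+ n.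
    elim: n => [|n IH]; first by rewrite big_nil expr0; ring.
    by rewrite big_nat_recr //= IH exprS; field.
  by rewrite gerBl mulr_ge0 // exprn_ge0.
have jG : mu.-integrable D G.
  apply/integrableP; split => //.
  by under eq_integral => x /set_mem Dx do rewrite gee0_abs ?G0 //.
have aeG := integrable_ae mD jG.
(* Cutting off outside the set where the sum is finite makes the sequence converge at every point of
   [D], so that its limit is measurable, and alters it only on a null set. *)
pose A := D `&` [set x | G x \is a fin_num].
have mA : measurable A by exact: emeasurable_fin_num.
pose h n x := f n x * \1_A x.
have cvh x : D x -> cvgn (h ^~ x).
  move=> Dx; rewrite /h /indic; have [Ax|nAx] := boolP (x \in A); last first.
    by rewrite (_ : (fun n => _) = cst 0) ?funeqE// => [|n]; [exact: is_cvg_cst|rewrite mulr0].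
  under eq_fun do rewrite mulr1.
  have : cvgn [normed series (fun n => f n.+1 x - f n x)].
    apply: nondecreasing_is_cvgn.
      by apply: nondecreasing_series => n _ _; exact: g0.
    exists (fine (G x)) => _ [n _ <-].
    rewrite -lee_fin fineK; last by case/set_mem: Ax.
    rewrite /series /= -sumEFin.
    by apply: nneseries_lim_ge => i _ _; rewrite lee_fin g0.
  move=> /normed_cvg cs.
  have -> : f ^~ x = (fun n => series (fun n => f n.+1 x - f n x) n + f 0%N x).
    by apply/funext => n; rewrite /series /= telescope_sumr // subrK.
  by apply: is_cvgD => //; exact: is_cvg_cst.
pose l x := limn (h ^~ x).
have hl x : D x -> h ^~ x @ \oo --> l x by move=> /cvh.
have L2h n : L2 mu D (h n).
  apply: (@L2_mul_bounded _ _ _ _ _ mD _ _ 1) => //.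
  by move=> x _; rewrite /indic; case: (x \in A); rewrite ?normr1 ?normr0.
have mh n : measurable_fun D (h n) := (L2h n).1.
have ml : measurable_fun D l.
  apply: (measurable_fun_cvg (h := h)) => //.
have fh : {ae mu, forall x, D x -> forall n, f n x = h n x}.
  apply: filterS aeG => x GD Dx n; rewrite /h /indic mem_set ?mulr1 //.
  by split => //; exact: GD.
have hn n m : (n <= m)%N ->
    (\int[mu]_(x in D) ((h m x - h n x) ^+ 2)%:E <= ((4^-1) ^+ n)%:E)%E.
  move=> nm; have [_ jhh] : L2 mu D (fun x => h m x - h n x) by exact: L2B.
  rewrite -EFin_Rintegral // lee_fin; apply: le_trans (hc n m nm).
  rewrite le_eqVlt; apply/orP; left; apply/eqP; apply: eq_ae_Rintegral => //.
    by apply: measurable_funX; case: (L2d n m).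
  by apply: filterS fh => x hx Dx; rewrite -!hx.
have ln n : (\int[mu]_(x in D) ((h n x - l x) ^+ 2)%:E <= ((4^-1) ^+ n)%:E)%E.
  pose F m x := ((h (m + n)%N x - h n x) ^+ 2)%:E.
  have mF m : measurable_fun D (F m).
    exact/measurable_EFinP/measurable_funX/measurable_funB.
  have F0 m x : D x -> (0 <= F m x)%E by rewrite lee_fin sqr_ge0.
  have := fatou mu mD mF F0.
  have limE x : D x -> limn_einf (F ^~ x) = ((h n x - l x) ^+ 2)%:E.
    move=> Dx; apply: (cvg_limn_einf_sup _).1.
    apply: cvg_EFin; first exact: nearW.
    have hs : (fun m => h (m + n)%N x - h n x) @ \oo --> l x - h n x.
      apply: cvgB; last exact: cvg_cst.
      by have := hl x Dx; rewrite -(cvg_shiftn n (h ^~ x)).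
    by rewrite -sqrrN opprB; exact: (cvgM hs hs).
  rewrite (eq_integral (fun x => ((h n x - l x) ^+ 2)%:E)); last first.
    by move=> x /set_mem Dx; rewrite limE.
  move=> /le_trans; apply; rewrite limn_einf_lim; apply: lime_le.
    exact: is_cvg_einfs.
  apply: nearW => m; apply: le_trans (hn n (m + n)%N (leq_addl _ _)).
  by apply: ereal_inf_lbound; exists m => //=.
have L2hl n : L2 mu D (fun x => h n x - l x).
  split; first exact: measurable_funB.
  apply/integrableP; split.
    exact/measurable_EFinP/measurable_funX/measurable_funB.
  apply: le_lt_trans (ltry (4^-1 ^+ n)); apply: le_trans (ln n).
  by under eq_integral do rewrite /= ger0_norm ?sqr_ge0 //.
exists l.
  by apply: (L2_eq mD _ (L2B mD (L2h 0%N) (L2hl 0%N))) => x _; rewrite opprB addrC subrK.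
move=> n; have [mhl jhl] := L2hl n.
apply: le_trans (_ : \int[mu]_(x in D) (h n x - l x) ^+ 2 <= _).
  rewrite le_eqVlt (@eq_ae_Rintegral _ _ _ _ _ mD (fun x => (h n x - l x) ^+ 2)
    (fun x => (f n x - l x) ^+ 2)) ?eqxx //.
    by apply: measurable_funX; apply: measurable_funB => //; case: (hf n).
  by apply: filterS fh => x hx Dx; rewrite -hx.
by rewrite -lee_fin EFin_Rintegral.
Qed.

End L2_completeness.

(** * Orthogonal projection *)

(** Lets a family of estimates at rate 4^-n replace a passage to the limit. *)
Lemma geometric_le0 (R : realType) (x K : R) :
  (forall n, x <= K * 4^-1 ^+ n) -> x <= 0.
Proof.
move=> h; have cv : (fun n => K * 4^-1 ^+ n) @ \oo --> (0 : R).
  by apply: cvg_geometric; rewrite ger0_norm // invf_lt1 // ltr1n.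
have <- : limn (fun n => K * 4^-1 ^+ n) = 0 :> R by apply: cvg_lim.
by apply: limr_ge; [exact: cvgP cv|exact: nearW].
Qed.

(** Common source of all the Cauchy-Schwarz inequalities below, and of the approximate orthogonality
    of a near-minimiser in [projection_exists]. *)
Lemma discriminant_le (R : realFieldType) (c b d : R) : 0 <= c ->
  (forall t, 0 <= c * t ^+ 2 + 2 * b * t + d) -> b ^+ 2 <= c * d.
Proof.
rewrite le_eqVlt => /predU1P[<-|c0] h.
- rewrite mul0r; have [->|b0] := eqVneq b 0; first by rewrite expr0n.
  (* At this point the affine function 2 b t + d takes the value -1. *)
  have := h (- (d + 1) / (2 * b)); rewrite mul0r add0r mulrCA divff ?mulr1.
    by lra.
  by rewrite mulf_neq0.
- have := h (- b / c); rewrite -(ler_pM2l c0) mulr0.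
  have -> : c * (c * (- b / c) ^+ 2 + 2 * b * (- b / c) + d) = c * d - b ^+ 2.
    by field; rewrite gt_eqF.
  by rewrite subr_ge0.
Qed.

Section Projection.
Context (R : realType) (V : lmodType R) (L H : set V) (b : V -> V -> R).
Hypothesis L_lin : forall a c u v, L u -> L v -> L (a *: u + c *: v).
Hypothesis H_lin : forall a c u v, H u -> H v -> H (a *: u + c *: v).
Hypothesis HL : H `<=` L.
Hypothesis b_sym : forall u v, b u v = b v u.
Hypothesis b_lin : forall a c u v w, L u -> L v -> L w ->
  b (a *: u + c *: v) w = a * b u w + c * b v w.
Hypothesis b_ge0 : forall u, L u -> 0 <= b u u.

Lemma form_square a c u v : L u -> L v ->
  b (a *: u + c *: v) (a *: u + c *: v) =
  a ^+ 2 * b u u + 2 * a * c * b u v + c ^+ 2 * b v v.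
Proof.
move=> Lu Lv; rewrite b_lin //; last exact: L_lin.
rewrite !(b_sym _ (_ + _)) !b_lin // (b_sym v u).
by ring.
Qed.

Lemma form_Cauchy_Schwarz u v : L u -> L v -> b u v ^+ 2 <= b u u * b v v.
Proof.
move=> Lu Lv; rewrite mulrC; apply: discriminant_le => [|t]; first exact: b_ge0.
have := b_ge0 (L_lin 1 t Lu Lv); rewrite form_square //.
by rewrite expr1n mul1r mulr1; congr (0 <= _); ring.
Qed.

Hypothesis H0 : H 0.

(** Hilbert's argument with minimising sequences, for a form that may be degenerate and is bilinear
    only on [L]. Completeness enters as a hypothesis on sequences with increments of order 4^-n, and
    the limit is asked only to be approached at that rate, with any constant [C]. *)
Lemma projection_exists (e : R) (v : V) : 0 < e -> L v ->
  (forall u : nat -> V, (forall n, H (u n)) ->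
     (forall n m, (n <= m)%N -> b (u m - u n) (u m - u n) <= e * 4^-1 ^+ n) ->
     exists w C, H w /\ forall n, b (u n - w) (u n - w) <= C * 4^-1 ^+ n) ->
  exists2 w, H w & forall psi, H psi -> b (v + w) psi = 0.
Proof.
move=> e0 Lv complete.
have LD u w : L u -> L w -> L (u + w).
  by move=> Lu Lw; have := L_lin 1 1 Lu Lw; rewrite !scale1r.
have LB u w : L u -> L w -> L (u - w).
  by move=> Lu Lw; have := L_lin 1 (-1) Lu Lw; rewrite scale1r scaleN1r.
pose E := [set b (v + chi) (v + chi) | chi in H].
have lbE : lbound E 0 by move=> _ [chi Hc <-]; apply: b_ge0; apply: LD => //; exact: HL.
have E0 : has_inf E.
  by split; [exists (b (v + 0) (v + 0)); exists 0 | exists 0].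
(* The parallelogram law bounds the increment between two near-minimisers by 2 [delta m] + 2
   [delta n], hence by 4 [delta n]; this is why [e] is divided by 4. *)
pose delta n : R := e / 4 * 4^-1 ^+ n.
have delta_gt0 n : 0 < delta n by rewrite /delta mulr_gt0 ?exprn_gt0 ?divr_gt0.
have /choice [chi hchi] : forall n, exists chi, H chi /\
    b (v + chi) (v + chi) < inf E + delta n.
  move=> n; have [_ [chi Hc <-] lt] := inf_adherent (delta_gt0 n) E0.
  by exists chi.
have inf_le chi' : H chi' -> inf E <= b (v + chi') (v + chi').
  by move=> Hc; apply: ge_inf; [exact: E0.2|exists chi'].
have Hchi n := (hchi n).1.
have Lchi n := HL (Hchi n).
have cauchy n m : (n <= m)%N ->
    b (chi m - chi n) (chi m - chi n) <= e * 4^-1 ^+ n.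
  move=> nm; have dnm : delta m <= delta n.
    rewrite /delta ler_pM2l ?divr_gt0 //; apply: ler_wiXn2l => //.
    by rewrite invf_le1 // ler1n.
  (* The midpoint of two near-minimisers is again a competitor, so its energy is at least the
     infimum. *)
  have := inf_le _ (H_lin 2^-1 2^-1 (Hchi n) (Hchi m)).
  have -> : v + (2^-1 *: chi n + 2^-1 *: chi m) =
    2^-1 *: (v + chi n) + 2^-1 *: (v + chi m).
    rewrite !scalerDr addrACA -scalerDl; congr (_ + _).
    by rewrite [X in X *: _](_ : _ = 1) ?scale1r //; field.
  have -> : chi m - chi n = 1 *: (v + chi m) + (-1) *: (v + chi n).
    by rewrite scale1r scaleN1r opprD addrACA subrr add0r.
  rewrite !form_square //; try exact: LD.
  rewrite (b_sym (v + chi m) (v + chi n)).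
  have -> : e * 4^-1 ^+ n = 4 * delta n by rewrite /delta; field.
  by move: (hchi n).2 (hchi m).2; lra.
have [w [C [Hw hw]]] := complete chi Hchi cauchy.
exists w => // psi Hpsi; have Lpsi := HL Hpsi; have Lw := HL Hw.
apply/eqP; rewrite -sqrf_eq0 eq_le sqr_ge0 andbT.
apply: (@geometric_le0 _ _ (2 * b psi psi * (e / 4 + C))) => n.
(* Moving from [chi n] in the direction [psi] lowers the energy by at most [delta n]; the
   discriminant turns this into approximate orthogonality. The error made by replacing [w] with
   [chi n] is then bounded by Cauchy-Schwarz. *)
have h1 : b (v + chi n) psi ^+ 2 <= b psi psi * delta n.
  apply: discriminant_le => [|t]; first exact: b_ge0.
  have := inf_le _ (H_lin 1 t (Hchi n) Hpsi).
  have -> : v + (1 *: chi n + t *: psi) = 1 *: (v + chi n) + t *: psi.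
    by rewrite !scale1r addrA.
  rewrite form_square //; last exact: LD.
  by move: (hchi n).2; rewrite expr1n; lra.
have h2 : b (chi n - w) psi ^+ 2 <= b psi psi * (C * 4^-1 ^+ n).
  apply: le_trans (form_Cauchy_Schwarz (LB _ _ (Lchi n) Lw) Lpsi) _.
  by rewrite mulrC ler_wpM2l // b_ge0.
have -> : b (v + w) psi = b (v + chi n) psi - b (chi n - w) psi.
  have -> : v + w = 1 *: (v + chi n) + (-1) *: (chi n - w).
    by rewrite scale1r scaleN1r opprB addrA addrAC addrK.
  by rewrite b_lin //; [ring|exact: LD|exact: LB].
have -> : 2 * b psi psi * (e / 4 + C) * 4^-1 ^+ n =
  2 * (b psi psi * delta n) + 2 * (b psi psi * (C * 4^-1 ^+ n)).
  by rewrite /delta; ring.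
move: (b (v + chi n) psi) (b (chi n - w) psi) h1 h2 => x y h1 h2.
by have := sqr_ge0 (x + y); nra.
Qed.

End Projection.

(** * Smooth bump functions *)

Section Smooth.
Context (R : realType).

(** A coinduction principle for [smooth]: a class of continuous functions closed under directional
    derivatives consists of smooth ones, by induction on the order. *)
Lemma smooth_stable (V : normedModType R) (P : set (V -> R)) :
  (forall f, P f -> continuous f /\
     forall v : V, (forall x, derivable f x v) /\ P ('D_v f)) ->
  forall f, P f -> smooth f.
Proof.
move=> stable f Pf k; elim: k f Pf => [|k IH] f Pf /=.
  by split => //; exact: (stable f Pf).1.
split; first exact: (stable f Pf).1.
by move=> v; have [? ?] := (stable f Pf).2 v; split => //; exact: IH.
Qed.

Lemma smooth_continuous (V : normedModType R) (f : V -> R) :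
  smooth f -> continuous f.
Proof. by move=> /(_ 0%N) []. Qed.

Lemma smooth_derivable (V : normedModType R) (f : V -> R) (x v : V) :
  smooth f -> derivable f x v.
Proof. by move=> /(_ 1%N) [_] /(_ v) [+ _]; exact. Qed.

Lemma smooth_derive (V : normedModType R) (f : V -> R) (v : V) :
  smooth f -> smooth ('D_v f).
Proof. by move=> sf k; have [_ /(_ v)[]] := sf k.+1. Qed.

Lemma smooth_cst (V : normedModType R) (c : R) : smooth (cst c : V -> R).
Proof.
apply: (@smooth_stable V [set f | exists c, f = cst c]); last by exists c.
move=> _ [a ->]; split; first exact: cst_continuous.
move=> v; split; first by move=> x; exact: derivable_cst.
by exists 0; apply/funext => x; rewrite derive_cst.
Qed.

Lemma derive_fst (U V : normedModType R) (f : U -> R) (z v : U * V) :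
  'D_v (f \o fst) z = 'D_(v.1) f z.1.
Proof. by []. Qed.

Lemma smooth_fst (U V : normedModType R) (f : U -> R) :
  smooth f -> smooth (f \o fst : U * V -> R).
Proof.
move=> sf; apply: (@smooth_stable _ [set g | exists2 f, smooth f & g = f \o fst]).
  move=> _ [g sg ->]; split.
    move=> z; apply: continuous_comp; first exact: cvg_fst.
    exact: smooth_continuous.
  move=> v; split; first by move=> z; change (derivable g z.1 v.1); exact: smooth_derivable.
  by exists ('D_(v.1) g) => //; exact: smooth_derive.
by exists f.
Qed.

(** The powers of 1/x are included because differentiating exp (-1/x) produces them: the span of
    this family is closed under derivatives. *)
Definition flat (k : nat) (x : R) : R :=
  if x <= 0 then 0 else x^-1 ^+ k * expR (- x^-1).

Lemma flat_le0 k x : x <= 0 -> flat k x = 0.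
Proof. by rewrite /flat => ->. Qed.

Lemma flat_gt0E k x : 0 < x -> flat k x = x^-1 ^+ k * expR (- x^-1).
Proof. by rewrite /flat leNgt => ->. Qed.

Lemma flat_gt0 k x : 0 < x -> 0 < flat k x.
Proof.
by move=> x0; rewrite flat_gt0E // mulr_gt0 ?expR_gt0 // exprn_gt0 // invr_gt0.
Qed.

Lemma flat_bound k : exists2 C, 0 <= C & forall x, `|flat k x| <= C * `|x|.
Proof.
exists (k.+1%:R ^+ k.+1); first exact: exprn_ge0.
move=> x; have [x0|x0] := leP x 0.
  by rewrite flat_le0 // normr0 mulr_ge0 // exprn_ge0.
rewrite (ger0_norm (ltW (flat_gt0 k x0))) (gtr0_norm x0) flat_gt0E //.
have y0 : 0 < x^-1 by rewrite invr_gt0.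
rewrite expRN -ler_pdivlMr ?invr_gt0 ?expR_gt0 // invrK.
(* Exponential growth beats the power: exp y is the (k+1)-th power of exp (y / (k+1)), and exp t >=
   1 + t >= t. *)
have h : (x^-1 / k.+1%:R) ^+ k.+1 <= expR (x^-1).
  have -> : expR x^-1 = expR (x^-1 / k.+1%:R) ^+ k.+1.
    by rewrite -expRM_natl mulrCA divff ?mulr1 // pnatr_eq0.
  rewrite lerXn2r ?nnegrE ?expR_ge0 ?divr_ge0 // ?ltW //.
  by apply: lt_le_trans (expR_ge1Dx _); rewrite ltrDr.
have -> : x^-1 ^+ k = k.+1%:R ^+ k.+1 * x * (x^-1 / k.+1%:R) ^+ k.+1.
  rewrite exprMn [x^-1 ^+ k.+1]exprS !exprVn.
  have kk : k.+1%:R ^+ k.+1 != 0 :> R by rewrite expf_neq0 // pnatr_eq0.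
  have xk : x ^+ k != 0 by rewrite expf_neq0 // gt_eqF.
  move: kk xk; move: (k.+1%:R ^+ k.+1) (x ^+ k) => u w u0 w0.
  by field; rewrite u0 w0 gt_eqF.
by rewrite ler_pM2l // mulr_gt0 // exprn_gt0.
Qed.

Lemma is_derive_flat k (x : R) :
  is_derive x 1 (flat k) (flat k.+2 x - k%:R * flat k.+1 x).
Proof.
have [x0|x0|->] := ltgtP x 0.
- apply: (@near_eq_is_derive _ _ _ (cst 0)).
    near=> y; rewrite flat_le0 //.
    by apply: ltW; near: y; exact: lt_nbhsl.
  by rewrite !flat_le0 ?mulr0 ?subr0 ?ltW //; exact: is_derive_cst.
- apply: (@near_eq_is_derive _ _ _
    ((fun y : R => y^-1) ^+ k * (expR \o (fun y : R => - y^-1)))).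
    near=> y; rewrite flat_gt0E ?exprfctE //.
    by near: y; exact: lt_nbhsr.
  have xn0 : x != 0 by rewrite gt_eqF.
  have d1 : is_derive x 1 (fun y : R => y^-1) (- x ^- 2 *: 1).
    exact: (is_deriveV (f := id)).
  have d1N : is_derive x 1 (fun y : R => - y^-1) (- (- x ^- 2 *: 1)).
    exact: is_deriveN.
  have d2 := @is_derive1_comp _ expR (fun y : R => - y^-1) x _ _
    (is_derive_expR (- x^-1)) d1N.
  have d3 := is_deriveM (is_deriveX k d1) d2.
  apply: is_derive_eq d3 _.
  rewrite !flat_gt0E //= /GRing.scale /=.
  rewrite exprfctE; case: k => [|k] /=; rewrite ?exprS ?expr0 ?mulr1n ?exprVn.
    by field; rewrite xn0.
  move: (x ^+ k) (expf_neq0 k xn0) => u u0.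
  by field; rewrite u0 xn0.
- rewrite !flat_le0 // mulr0 subr0.
  have [C C0 hC] := flat_bound k.+1.
  suff cv : h^-1 *: ((flat k \o shift (0 : R)) (h *: (1 : R)) - flat k 0) @[h --> (0 : R)^'] --> (0 : R).
    by split; [exact: cvgP cv|exact: cvg_lim cv].
  apply/cvgrPdist_lt => e e0; near=> h.
  rewrite /= addr0 [flat k 0]flat_le0 // subr0 sub0r normrN /GRing.scale /= mulr1.
  have h0 : h != 0 by near: h; exact: nbhs_dnbhs_neq.
  (* The difference quotient at 0 is again a member of the family, and [flat_bound] makes it tend to
     0. *)
  have -> : h^-1 * flat k h = flat k.+1 h.
    rewrite /flat; case: ifP => _; first by rewrite mulr0.
    by rewrite exprS mulrA.
  apply: le_lt_trans (hC h) _; apply: (@le_lt_trans _ _ ((C + 1) * `|h|)).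
    by rewrite ler_wpM2r // lerDl.
  rewrite mulrC -ltr_pdivlMr; last by rewrite ltr_wpDl.
  by near: h; apply: dnbhs0_lt; rewrite divr_gt0 // ltr_wpDl.
Unshelve. all: by end_near. Qed.

Lemma flat_derivable k (x v : R) : derivable (flat k) x v.
Proof.
apply: diff_derivable; apply/derivable1_diffP.
by case: (is_derive_flat k x).
Qed.

Lemma flat_continuous k : continuous (flat k).
Proof.
move=> x; apply/differentiable_continuous/derivable1_diffP.
by case: (is_derive_flat k x).
Qed.

Lemma derive_flat k (x v : R) :
  'D_v (flat k) x = v * (flat k.+2 x - k%:R * flat k.+1 x).
Proof.
have d : differentiable (flat k) x.
  by apply/derivable1_diffP; case: (is_derive_flat k x).
rewrite deriveE // -[v in LHS]mulr1 -/(v *: (1 : R)) linearZ /= -deriveE //.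
by rewrite (@derive_val _ _ _ _ _ _ _ (is_derive_flat k x)).
Qed.

(** Here [d] is the linear part of [l]. The identity is stated so that a difference quotient of
    [flat k \o l] along [v] is literally one of [flat k] along [d v], which avoids a chain rule on
    [V]. *)
Definition affine_form (V : normedModType R) (l : V -> R) : Prop :=
  continuous l /\
  exists d : V -> R, forall (x v : V) (h : R), l (h *: v + x) = h * d v + l x.

(* A class of differentiable functions containing its own directional
   derivatives, hence consisting of smooth functions. *)
Inductive flat_algebra (V : normedModType R) : (V -> R) -> Prop :=
| Flat_cst c : flat_algebra (cst c)
| Flat_comp k l : affine_form l -> flat_algebra (flat k \o l)
| Flat_add f g : flat_algebra f -> flat_algebra g -> flat_algebra (f + g)
| Flat_mul f g : flat_algebra f -> flat_algebra g -> flat_algebra (f * g).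

Lemma flat_algebra_smooth (V : normedModType R) (f : V -> R) :
  flat_algebra f -> smooth f.
Proof.
apply: smooth_stable => {}f; elim=> {f} [c|k l|f g|f g].
- split; first exact: cst_continuous.
  move=> v; split=> [x|]; first exact: derivable_cst.
  rewrite (_ : 'D_v _ = cst 0); first exact: Flat_cst.
  by apply/funext => x; rewrite derive_cst.
- move=> al; case: (al) => cl [d hd]; split.
    by move=> x; apply: continuous_comp; [exact: cl|exact: flat_continuous].
  move=> v.
  have quotient x : (fun h => h^-1 *: ((flat k \o l \o shift x) (h *: v) - (flat k \o l) x)) =
      (fun h : R => h^-1 *: ((flat k \o shift (l x)) (h *: d v) - flat k (l x))).
    by apply/funext => h /=; rewrite hd.
  split=> [x|].
    by rewrite /derivable quotient; exact: flat_derivable.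
  rewrite (_ : 'D_v _ =
    cst (d v) * (flat k.+2 \o l + cst (- k%:R) * (flat k.+1 \o l))).
    by do !(apply: Flat_add || apply: Flat_mul || apply: Flat_comp
      || apply: Flat_cst).
  apply/funext => x; rewrite /derive quotient -/(derive (flat k) (l x) (d v)).
  by rewrite derive_flat -mulNr.
- move=> Pf [cf df] Pg [cg dg]; split.
    by move=> x; apply: continuousD; [exact: cf|exact: cg].
  move=> v; split=> [x|]; first exact: derivableD ((df v).1 x) ((dg v).1 x).
  rewrite (_ : 'D_v _ = 'D_v f + 'D_v g).
    by apply: Flat_add; [exact: (df v).2|exact: (dg v).2].
  by apply/funext => x; rewrite deriveD //; [exact: (df v).1|exact: (dg v).1].
- move=> Pf [cf df] Pg [cg dg]; split.
    by move=> x; apply: continuousM; [exact: cf|exact: cg].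
  move=> v; split=> [x|]; first exact: derivableM ((df v).1 x) ((dg v).1 x).
  rewrite (_ : 'D_v _ = f * 'D_v g + g * 'D_v f).
    by apply: Flat_add; apply: Flat_mul => //; [exact: (dg v).2|exact: (df v).2].
  by apply/funext => x; rewrite deriveM //; [exact: (df v).1|exact: (dg v).1].
Qed.

Definition hat (c r t : R) : R := flat 0 (t - (c - r)) * flat 0 (c + r - t).

Lemma hat_gt0 c r t : c - r < t < c + r -> 0 < hat c r t.
Proof. by move=> /andP[h1 h2]; rewrite mulr_gt0 // flat_gt0 // subr_gt0. Qed.

Lemma hat_eq0 c r t : (t <= c - r) || (c + r <= t) -> hat c r t = 0.
Proof.
rewrite -subr_le0 -[X in _ || X]subr_le0 /hat.
by move=> /orP[]/flat_le0 ->; rewrite ?mul0r ?mulr0.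
Qed.

Lemma hat_ge0 c r t : 0 <= hat c r t.
Proof.
have [h|/negP] := boolP (c - r < t < c + r); first exact/ltW/hat_gt0.
by move=> h; rewrite hat_eq0 //; move: h => /negP; rewrite negb_and -!leNgt.
Qed.

Lemma affine_form_sub (V : normedModType R) (p : V -> R) (c : R) :
  continuous p -> (forall (x v : V) (h : R), p (h *: v + x) = h * p v + p x) ->
  affine_form (fun x => p x - c) /\ affine_form (fun x => c - p x).
Proof.
move=> cp lp; split; split.
- by move=> x; apply: continuousB; [exact: cp|exact: cst_continuous].
- by exists p => x v h; rewrite lp addrA.
- by move=> x; apply: continuousB; [exact: cst_continuous|exact: cp].
- by exists (- p) => x v h; rewrite lp mulrN; ring.
Qed.

Lemma hat_smooth c r : smooth (hat c r).
Proof.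
have [h1 _] := @affine_form_sub R idfun (c - r) (fun x => cvg_id) (fun x v h => erefl).
have [_ h2] := @affine_form_sub R idfun (c + r) (fun x => cvg_id) (fun x v h => erefl).
exact: flat_algebra_smooth (Flat_mul (Flat_comp 0 h1) (Flat_comp 0 h2)).
Qed.

Definition bump (p : R * R) (r : R) (x : R * R) : R :=
  hat p.1 r x.1 * hat p.2 r x.2.

Lemma bump_smooth p r : smooth (bump p r).
Proof.
have c1 : continuous (fst : R * R -> R) by move=> x; exact: cvg_fst.
have c2 : continuous (snd : R * R -> R) by move=> x; exact: cvg_snd.
have [h1 _] := affine_form_sub (p.1 - r) c1 (fun x v h => erefl).
have [_ h2] := affine_form_sub (p.1 + r) c1 (fun x v h => erefl).
have [h3 _] := affine_form_sub (p.2 - r) c2 (fun x v h => erefl).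
have [_ h4] := affine_form_sub (p.2 + r) c2 (fun x v h => erefl).
exact: flat_algebra_smooth (Flat_mul
  (Flat_mul (Flat_comp 0 h1) (Flat_comp 0 h2))
  (Flat_mul (Flat_comp 0 h3) (Flat_comp 0 h4))).
Qed.

Lemma derive_tensor1 (f g : R -> R) (x : R * R) : derivable f x.1 1 ->
  'D_((1, 0) : R * R) (fun x => f x.1 * g x.2) x = 'D_1 f x.1 * g x.2.
Proof.
move=> d; rewrite /derive; apply: cvg_lim => //.
rewrite [X in X @ _](_ : _ = (fun h =>
    (h^-1 *: ((f \o shift x.1) (h *: 1) - f x.1)) * g x.2)).
  by apply: cvgMl; exact: d.
by apply/funext => h; rewrite /= /GRing.scale /= mulr0 add0r; ring.
Qed.

Lemma derive_tensor2 (f g : R -> R) (x : R * R) : derivable g x.2 1 ->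
  'D_((0, 1) : R * R) (fun x => f x.1 * g x.2) x = f x.1 * 'D_1 g x.2.
Proof.
move=> d; rewrite /derive; apply: cvg_lim => //.
rewrite [X in X @ _](_ : _ = (fun h =>
    f x.1 * (h^-1 *: ((g \o shift x.2) (h *: 1) - g x.2)))).
  by apply: cvgMr; exact: d.
by apply/funext => h; rewrite /= /GRing.scale /= mulr0 add0r; ring.
Qed.

Lemma derive_bump1 p r x :
  'D_((1, 0) : R * R) (bump p r) x = 'D_1 (hat p.1 r) x.1 * hat p.2 r x.2.
Proof. exact/derive_tensor1/smooth_derivable/hat_smooth. Qed.

Lemma derive_bump2 p r x :
  'D_((0, 1) : R * R) (bump p r) x = hat p.1 r x.1 * 'D_1 (hat p.2 r) x.2.
Proof. exact/derive_tensor2/smooth_derivable/hat_smooth. Qed.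

Lemma derive_test_section (S : set (R * R)) (eta : R * R -> R) (v : R * R) :
  test_section S eta -> test_section S ('D_v eta).
Proof.
move=> [se [K [cK KS K0]]]; split; first exact: smooth_derive.
exists K; split => // x nKx.
have cl : closed K by apply: compact_closed => //; exact: norm_hausdorff.
(* The complement of the compact [K] is open, so [eta] vanishes on a whole neighbourhood of [x]; the
   support of the derivative stays in [K]. *)
have e0 : \forall y \near x, eta y = cst 0 y.
  have : nbhs x (~` K) by apply: open_nbhs_nbhs; split => //; exact: closed_openC.
  by apply: filterS => y /K0.
by rewrite (near_eq_derive _ e0) derive_cst.
Qed.

End Smooth.

(** * Measurability and finite measure of the cell *)

Section CountableBase.

(* Lets open subsets of R^2 and R^3 be measurable for the product sigma-algebra,
   which is not generated by the product topology by definition. *)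
Definition has_base (T : topologicalType) (M : set (set T)) : Prop :=
  exists B : nat -> set T, (forall n, M (B n)) /\
    forall x A, nbhs x A -> exists n, B n x /\ B n `<=` A.

Lemma has_base_prod (T1 T2 : topologicalType) (M1 : set (set T1))
    (M2 : set (set T2)) (M : set (set (T1 * T2))) :
  (forall A B, M1 A -> M2 B -> M (A `*` B)) ->
  has_base M1 -> has_base M2 -> has_base M.
Proof.
move=> hM [B1 [mB1 b1]] [B2 [mB2 b2]].
pose B (n : nat) := if unpickle n is Some (i, j) then B1 i `*` B2 j
  else B1 0%N `*` B2 0%N.
exists B; split.
  by move=> n; rewrite /B; case: unpickle => [[i j]|]; exact: hM.
move=> [x1 x2] A [[A1 A2] /= [nA1 nA2] sA].
have [i [Bi sBi]] := b1 _ _ nA1; have [j [Bj sBj]] := b2 _ _ nA2.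
exists (pickle (i, j)); rewrite /B pickleK; split => //.
by move=> [y1 y2] [/= /sBi Ay1 /sBj Ay2]; exact: sA.
Qed.

Lemma has_base_real (R : realType) :
  has_base (measurable : set (set R)).
Proof.
pose B (n : nat) : set R := if unpickle n is Some (q, k)
  then ball (ratr q : R) (k.+1%:R^-1) else setT.
exists B; split.
  move=> n; rewrite /B; case: (unpickle n) => [[q k]|] //.
  by apply: open_measurable; exact: ball_open.
move=> x A /nbhs_ballP[e /= e0 eA].
(* Half of [e], because a point of the rational ball is reached from [x] through its centre, with
   one radius spent on each leg. *)
have [k ke] : exists k : nat, k.+1%:R^-1 < e / 2.
  have := near_infty_natSinv_lt (PosNum (divr_gt0 e0 (ltr0n R 2))).
  by case=> k _ /(_ k (leqnn k)); exists k.
have k0 : 0 < (k.+1%:R^-1 : R) by rewrite invr_gt0.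
have [q] := @rat_in_itvoo R (x - k.+1%:R^-1) (x + k.+1%:R^-1)
  ltac:(by rewrite ltrD2l gtrN).
rewrite in_itv /= => /andP[q1 q2].
exists (pickle (q, k)); rewrite /B pickleK.
move: (k.+1%:R^-1 : R) ke k0 q1 q2 => u ke u0 q1 q2; split.
  by rewrite /ball /= ltr_norml; apply/andP; split; lra.
move=> y; rewrite /ball /= => qy; apply: eA; rewrite /ball /=.
have -> : x - y = (x - ratr q) + (ratr q - y) by ring.
apply: le_lt_trans (ler_normD _ _) _; rewrite [ltRHS](splitr e).
apply: ltrD; last exact: lt_trans qy ke.
by apply: lt_trans ke; rewrite ltr_norml; apply/andP; split; lra.
Qed.

(** An open set is the union of the members of the base that it contains, and this union is
    countable. *)
Lemma has_base_measurable d (T : measurableType d) (U : topologicalType)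
    (f : T -> U) : has_base [set A : set U | measurable (f @^-1` A)] ->
  forall A, open A -> measurable (f @^-1` A).
Proof.
move=> [B [mB bB]] A oA.
pose I := [set n | B n `<=` A].
have -> : A = \bigcup_(n in I) B n.
  apply/seteqP; split => x; last by move=> [n In Bx]; exact: In.
  move=> Ax; have [n [Bnx sB]] := bB x A (open_nbhs_nbhs (conj oA Ax)).
  by exists n.
rewrite preimage_bigcup; apply: bigcup_measurable => n _; exact: mB.
Qed.

End CountableBase.

Section EuclideanMeasurable.
Context (R : realType).
Local Notation mR := (measurableTypeR R).

Lemma open_measurable2 (A : set (R * R)) : open A ->
  measurable (A : set (mR * mR)).
Proof.
apply: (@has_base_measurable _ (mR * mR)%type (R * R)%type id).
apply: (@has_base_prod R R (@measurable _ mR) (@measurable _ mR)).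
- by move=> A1 A2 m1 m2; exact: measurableX.
- exact: has_base_real.
- exact: has_base_real.
Qed.

Lemma open_measurable3 (A : set (R * R * R)) : open A ->
  measurable (A : set (mR * mR * mR)).
Proof.
apply: (@has_base_measurable _ (mR * mR * mR)%type (R * R * R)%type id).
apply: (@has_base_prod (R * R)%type R (@measurable _ (mR * mR)%type)
  (@measurable _ mR)).
- by move=> A1 A2 m1 m2; exact: measurableX.
- apply: (@has_base_prod R R (@measurable _ mR) (@measurable _ mR)).
  + by move=> A1 A2 m1 m2; exact: measurableX.
  + exact: has_base_real.
  + exact: has_base_real.
- exact: has_base_real.
Qed.

Lemma continuous_measurable2 (f : R * R -> R) : continuous f ->
  measurable_fun setT (f : mR * mR -> R).
Proof.
move=> cf; apply: (measurability _ (RGenOpens.measurableE R)).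
move=> _ [_ [a [b ->] <-]]; rewrite setTI; apply: open_measurable2.
by apply: open_comp => [x _|]; [exact: cf|exact: interval_open].
Qed.

Lemma continuous_measurable3 (f : R * R * R -> R) : continuous f ->
  measurable_fun setT (f : mR * mR * mR -> R).
Proof.
move=> cf; apply: (measurability _ (RGenOpens.measurableE R)).
move=> _ [_ [a [b ->] <-]]; rewrite setTI; apply: open_measurable3.
by apply: open_comp => [x _|]; [exact: cf|exact: interval_open].
Qed.

End EuclideanMeasurable.

Section Cell.
Context (R : realType) (S : set (R * R)).
Hypothesis oS : open S.
Hypothesis bS : bounded_set S.
Local Notation mR := (measurableTypeR R).

Lemma measurable_section : measurable (S : set (mR * mR)).
Proof. exact: open_measurable2. Qed.

Lemma measurable_Y : measurable (Y : set mR).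
Proof. exact: measurable_itv. Qed.

Lemma measurable_cell : measurable (cell S : set (mR * mR * mR)).
Proof. exact: measurableX measurable_section measurable_Y. Qed.

Lemma section_in_box : exists2 M : R, 0 <= M &
  forall x, S x -> `|x.1| <= M /\ `|x.2| <= M.
Proof.
case: bS => M [_ hM]; exists (`|M| + 1); first by rewrite addr_ge0.
move=> x Sx.
have := hM (`|M| + 1) ltac:(by rewrite (le_lt_trans (ler_norm M)) // ltrDl) x Sx.
by rewrite /= ge_max => /andP[].
Qed.

Lemma leb2_section_fin : (leb2 (S : set (mR * mR)) < +oo)%E.
Proof.
have [M M0 hM] := section_in_box.
apply: (@le_lt_trans _ _ (leb2 (`[- M, M]%classic `*` `[- M, M]%classic : set (mR * mR)))).
  apply: le_measure; rewrite ?inE.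
  - exact: measurable_section.
  - by apply: measurableX; exact: measurable_itv.
  - by move=> x /hM[h1 h2]; split; rewrite /= in_itv /= -ler_norml.
rewrite /leb2 /= product_measure1E; [|exact: measurable_itv|exact: measurable_itv].
have h : (lebesgue_measure (`[(- M)%R, M%R]%classic : set R) < +oo)%E.
  by rewrite lebesgue_measure_itv /=; case: ifP => // _; rewrite -?EFinD ltry.
by apply: lte_mul_pinfty => //; rewrite ge0_fin_numE.
Qed.

Lemma leb1_Y : leb1 (Y : set mR) = 1%E.
Proof. by rewrite /leb1 /= lebesgue_measure_itv /= lte_fin ltr01 oppr0 adde0. Qed.

Lemma leb3_cell_fin : (leb3 (cell S : set (mR * mR * mR)) < +oo)%E.
Proof.
rewrite /leb3 /= (_ : cell S = S `*` Y) // product_measure1E.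
- by rewrite [X in (_ * X)%E]leb1_Y mule1; exact: leb2_section_fin.
- exact: measurable_section.
- exact: measurable_Y.
Qed.

(** The one compactness argument behind the bounds on the cell, on [S] and on [Y]; the last two
    compose a function of fewer variables with a projection, [Y] with [M] = 0. *)
Lemma continuous_bounded_box (f : R * R * R -> R) (M : R) : continuous f ->
  exists c : R, forall x : R * R * R,
    `|x.1.1| <= M /\ `|x.1.2| <= M -> 0 <= x.2 <= 1 -> `|f x| <= c.
Proof.
move=> cf.
have cB : compact ((`[- M, M]%classic `*` `[- M, M]%classic) `*` `[0, 1]%classic : set (R * R * R)).
  by apply: compact_setX; [apply: compact_setX|]; exact: segment_compact.
have cfB : compact (f @` ((`[- M, M]%classic `*` `[- M, M]%classic) `*` `[0, 1]%classic)).
  by apply: continuous_compact => //; exact: continuous_subspaceT.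
have [c [_ hc]] := compact_bounded cfB.
exists (`|c| + 1) => x [h1 h2] h3.
apply: (hc (`|c| + 1)); first by rewrite (le_lt_trans (ler_norm c)) // ltrDl.
by exists x => //=; rewrite !in_itv /= -!ler_norml.
Qed.

Lemma continuous_bounded_cell (f : R * R * R -> R) : continuous f ->
  exists c : R, forall z, cell S z -> `|f z| <= c.
Proof.
move=> cf; have [M M0 hM] := section_in_box.
have [c hc] := continuous_bounded_box M cf; exists c => z [Sz].
by rewrite /Y /= in_itv /= => /andP[y0 y1]; apply: hc; [exact: hM|rewrite y0 ltW].
Qed.

Lemma continuous_bounded_section (f : R * R -> R) : continuous f ->
  exists c : R, forall x, S x -> `|f x| <= c.
Proof.
move=> cf; have [c hc] := @continuous_bounded_cell (f \o fst)
  (fun z => continuous_comp (@cvg_fst _ _ _ _ _) (cf z.1)).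
by exists c => x Sx; apply: (hc (x, 0)); split => //=; rewrite /Y /= in_itv /= lexx ltr01.
Qed.

Lemma continuous_bounded_Y (f : R -> R) : continuous f ->
  exists c : R, forall y, Y y -> `|f y| <= c.
Proof.
move=> cf; have [c hc] := @continuous_bounded_box (f \o snd) 0
  (fun z => continuous_comp (@cvg_snd _ _ _ _ _) (cf z.2)).
exists c => y; rewrite /Y /= in_itv /= => /andP[y0 y1].
by apply: (hc (0, 0, y)) => /=; [rewrite normr0|rewrite y0 ltW].
Qed.

Lemma measurable_fun_continuous2 (f : R * R -> R) (D : set (mR * mR)) :
  continuous f -> measurable_fun D (f : mR * mR -> R).
Proof. by move=> cf; apply: measurable_funTS; exact: continuous_measurable2. Qed.

Lemma measurable_fun_continuous3 (f : R * R * R -> R) (D : set (mR * mR * mR)) :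
  continuous f -> measurable_fun D (f : mR * mR * mR -> R).
Proof. by move=> cf; apply: measurable_funTS; exact: continuous_measurable3. Qed.

Lemma L2_continuous_cell (f : R * R * R -> R) : continuous f ->
  L2 leb3 (cell S : set (mR * mR * mR)) f.
Proof.
move=> cf; have [c hc] := continuous_bounded_cell cf.
apply: (L2_bounded measurable_cell leb3_cell_fin (c := c)) => //.
exact: measurable_fun_continuous3.
Qed.

Lemma L2_continuous_section (f : R * R -> R) : continuous f ->
  L2 leb2 (S : set (mR * mR)) f.
Proof.
move=> cf; have [c hc] := continuous_bounded_section cf.
apply: (L2_bounded measurable_section leb2_section_fin (c := c)) => //.
exact: measurable_fun_continuous2.
Qed.

Lemma L2_continuous_Y (f : R -> R) : continuous f -> L2 leb1 (Y : set mR) f.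
Proof.
move=> cf; have [c hc] := continuous_bounded_Y cf.
apply: (L2_bounded measurable_Y _ (c := c)) => //.
- by rewrite leb1_Y ltry.
- by apply: measurable_funTS; exact: continuous_measurable_fun.
Qed.

End Cell.

(** * The relaxation space *)

Section WeakDerivativeLinear.
Context d (T : measurableType d) (R : realType).
Variables (mu : {measure set T -> \bar R}) (D : set T).
Hypothesis mD : measurable D.
Variables (test : set (T -> R)) (del : (T -> R) -> (T -> R)).
Hypothesis test_L2 : forall eta, test eta -> L2 mu D eta /\ L2 mu D (del eta).

(** Square integrability of the test functions and of their derivatives makes every product
    integrable, so that the integrals split. *)
Lemma weak_derivative_lin a b f1 g1 f2 g2 :
  L2 mu D f1 -> L2 mu D g1 -> L2 mu D f2 -> L2 mu D g2 ->
  weak_derivative mu D test del f1 g1 -> weak_derivative mu D test del f2 g2 ->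
  weak_derivative mu D test del (fun x => a * f1 x + b * f2 x)
    (fun x => a * g1 x + b * g2 x).
Proof.
move=> Lf1 Lg1 Lf2 Lg2 w1 w2 eta teta; have [Le Lde] := test_L2 teta.
have split u v h : L2 mu D u -> L2 mu D v -> L2 mu D h ->
  \int[mu]_(x in D) ((a * u x + b * v x) * h x) =
  a * \int[mu]_(x in D) (u x * h x) + b * \int[mu]_(x in D) (v x * h x).
  move=> Lu Lv Lh.
  have j1 := L2_mul_integrable mD Lu Lh; have j2 := L2_mul_integrable mD Lv Lh.
  rewrite -!RintegralZl // -RintegralD //; try exact: integrable_scaler.
  by apply: eq_Rintegral => x _; ring.
by rewrite !split // w1 // w2 //; ring.
Qed.

End WeakDerivativeLinear.

Section Extensionality.
Context d (T : measurableType d) (R : realType).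
Variables (mu : {measure set T -> \bar R}) (D : set T).

Lemma ae_imp (P Q : T -> Prop) : (forall x, P x -> Q x) ->
  {ae mu, forall x, P x} -> {ae mu, forall x, Q x}.
Proof. exact: filterS. Qed.

Lemma ae_imp2 (P1 P2 Q : T -> Prop) : (forall x, P1 x -> P2 x -> Q x) ->
  {ae mu, forall x, P1 x} -> {ae mu, forall x, P2 x} -> {ae mu, forall x, Q x}.
Proof. exact: filterS2. Qed.

Lemma ae_all (P : T -> Prop) : (forall x, P x) -> {ae mu, forall x, P x}.
Proof. exact: nearW. Qed.

Lemma L2_ext (f g : T -> R) : f =1 g -> L2 mu D f -> L2 mu D g.
Proof. by move=> /funext ->. Qed.

Lemma weak_derivative_ext test del (f g f' g' : T -> R) : f =1 f' -> g =1 g' ->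
  weak_derivative mu D test del f g -> weak_derivative mu D test del f' g'.
Proof. by move=> /funext -> /funext ->. Qed.

End Extensionality.

Section RelaxationSpace.
Context (R : realType) (S : set (R * R)).
Hypothesis oS : open S.
Hypothesis bS : bounded_set S.
Local Notation M3 := 'M[R]_3.
Local Notation field := (R * R * R -> M3).

Let mS := measurable_section oS.
Let mY := @measurable_Y R.
Let mC := measurable_cell oS.

Lemma sympD (a b : R) (F G : M3) :
  symp (a *: F + b *: G) = a *: symp F + b *: symp G.
Proof. by rewrite /symp; apply/matrixP => i j; rewrite !mxE; ring. Qed.

Lemma test_circle_L2 (eta : R -> R) : test_circle eta ->
  L2 leb1 (Y : set (measurableTypeR R)) eta /\
  L2 leb1 (Y : set (measurableTypeR R)) ('D_(1 : R^o) (eta : R^o -> R)).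
Proof.
move=> [se _]; split; apply: L2_continuous_Y; first exact: smooth_continuous se.
exact: (smooth_continuous (smooth_derive (1 : R^o) se)).
Qed.

Lemma test_section_L2 (v : R * R) (eta : R * R -> R) : test_section S eta ->
  L2 leb2 S eta /\ L2 leb2 S ('D_v eta).
Proof.
move=> [se _]; split; apply: L2_continuous_section => //.
  exact: smooth_continuous se.
exact: (smooth_continuous (smooth_derive v se)).
Qed.

Lemma test_cell_L2 (v : R * R * R) (eta : R * R * R -> R) : test_cell S eta ->
  L2 leb3 (cell S) eta /\ L2 leb3 (cell S) ('D_v eta).
Proof.
move=> [se _ _]; split; apply: L2_continuous_cell => //.
  exact: smooth_continuous se.
exact: (smooth_continuous (smooth_derive v se)).
Qed.

Lemma H1_circle_lin (a b : R) (f df g dg : R -> R) :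
  H1_circle f df -> H1_circle g dg ->
  H1_circle (fun y => a * f y + b * g y) (fun y => a * df y + b * dg y).
Proof.
move=> [f1 f2 f3] [g1 g2 g3]; split; try exact: L2_lin.
exact: (weak_derivative_lin mY test_circle_L2).
Qed.

Lemma H1_section_lin (a b : R) (f : R * R -> 'cV[R]_3) df g dg :
  H1_section S f df -> H1_section S g dg ->
  H1_section S (fun x => a *: f x + b *: g x) (fun x => a *: df x + b *: dg x).
Proof.
move=> hf hg i; have [f1 f2] := hf i; have [g1 g2] := hg i.
split; first by by apply: L2_ext (L2_lin mS a b f1 g1) => x; rewrite !mxE.
move=> j; have [f3 f4] := f2 j; have [g3 g4] := g2 j.
split; first by by apply: L2_ext (L2_lin mS a b f3 g3) => x; rewrite !mxE.
have := (weak_derivative_lin mS (test_section_L2 (dir2 j)) a b f1 f3 g1 g3 f4 g4).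
by apply: weak_derivative_ext => x; rewrite !mxE.
Qed.

Lemma L2H1_section_lin (a b : R) (f : R * R * R -> 'cV[R]_3) df g dg :
  L2H1_section S f df -> L2H1_section S g dg ->
  L2H1_section S (fun x => a *: f x + b *: g x) (fun x => a *: df x + b *: dg x).
Proof.
move=> hf hg i; have [f1 f2] := hf i; have [g1 g2] := hg i.
split; first by by apply: L2_ext (L2_lin mC a b f1 g1) => x; rewrite !mxE.
move=> j; have [f3 f4] := f2 j; have [g3 g4] := g2 j.
split; first by by apply: L2_ext (L2_lin mC a b f3 g3) => x; rewrite !mxE.
have := (weak_derivative_lin mC (test_cell_L2 (dir3 j)) a b f1 f3 g1 g3 f4 g4).
by apply: weak_derivative_ext => x; rewrite !mxE.
Qed.

Lemma L2H1_circle_lin (a b : R) (f df g dg : R * R * R -> 'cV[R]_3) :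
  L2H1_circle S f df -> L2H1_circle S g dg ->
  L2H1_circle S (fun x => a *: f x + b *: g x) (fun x => a *: df x + b *: dg x).
Proof.
move=> hf hg i; have [f1 f2 f3] := hf i; have [g1 g2 g3] := hg i.
split.
- by apply: L2_ext (L2_lin mC a b f1 g1) => x; rewrite !mxE.
- by apply: L2_ext (L2_lin mC a b f2 g2) => x; rewrite !mxE.
- have := weak_derivative_lin mC (test_cell_L2 diry) a b f1 f2 g1 g2 f3 g3.
  by apply: weak_derivative_ext => x; rewrite !mxE.
Qed.

Lemma L2field_lin (a b : R) (F G : field) :
  L2field S F -> L2field S G -> L2field S (a *: F + b *: G).
Proof.
move=> hF hG i j.
rewrite (_ : (fun z => _) = (fun z => a * F z i j + b * G z i j)).
  exact: L2_lin.
by apply/funext => z; rewrite !mxE.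
Qed.

Lemma Hsym_lin (a b : R) (F G : field) :
  Hsym S F -> Hsym S G -> Hsym S (a *: F + b *: G).
Proof.
move=> [LF sF] [LG sG]; split; first exact: L2field_lin.
apply: ae_imp2 sF sG => z sF sG Cz.
by rewrite -[(_ + _) z]/(a *: F z + b *: G z) linearD !linearZ /= sF // sG.
Qed.

Lemma eqf_lin (a b : R) (F F' G G' : field) : eqf S F F' -> eqf S G G' ->
  eqf S (a *: F + b *: G) (a *: F' + b *: G').
Proof.
move=> eF eG; apply: ae_imp2 eF eG => z eF eG Cz.
by rewrite -[LHS]/(a *: F z + b *: G z) eF // eG.
Qed.

Lemma eqf_trans (F G H : field) : eqf S F G -> eqf S G H -> eqf S F H.
Proof. by move=> e1 e2; apply: ae_imp2 e1 e2 => z e1 e2 Cz; rewrite e1 // e2. Qed.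

Lemma colND (a b : R) (u v : 'cV[R]_3) (M N : 'M[R]_(3, 2)) :
  colN (a *: u + b *: v) (a *: M + b *: N) = a *: colN u M + b *: colN v N.
Proof.
apply/matrixP => i j; rewrite /colN !mxE.
by case: fintype.split => k; rewrite !mxE.
Qed.

Lemma Hrel_lin (gamma : \bar R) (a b : R) (F G : field) :
  Hrel S gamma F -> Hrel S gamma G -> Hrel S gamma (a *: F + b *: G).
Proof.
case: gamma => [g||] //=; [case: ifP => _|].
- move=> [HF [P1 [dP1 [p1 [dp1 [q1 [N1 [h1 h2 h3 h4 h5]]]]]]]].
  move=> [HG [P2 [dP2 [p2 [dp2 [q2 [N2 [k1 k2 k3 k4 k5]]]]]]]].
  split; first exact: Hsym_lin.
  exists (a *: P1 + b *: P2), (a *: dP1 + b *: dP2), (a *: p1 + b *: p2),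
    (a *: dp1 + b *: dp2), (a *: q1 + b *: q2), (a *: N1 + b *: N2); split.
  + move=> y; rewrite /skew_mx -[(_ + _) y]/(a *: P1 y + b *: P2 y).
    by rewrite linearD !linearZ /= h1 k1 !scalerN opprD.
  + move=> i j; have := H1_circle_lin a b (h2 i j) (k2 i j).
    by congr H1_circle; apply/funext => y; rewrite !mxE.
  + move=> i; have := H1_circle_lin a b (h3 i) (k3 i).
    by congr H1_circle; apply/funext => y; rewrite !mxE.
  + exact: L2H1_section_lin.
  + apply: eqf_trans (eqf_lin a b h5 k5) _; apply: ae_all => z _.
    rewrite -[LHS]/(a *: symp _ + b *: symp _) -sympD -colND.
    congr (symp (colN _ _)).
    rewrite -[in RHS]/(a *: dP1 z.2 + b *: dP2 z.2) -[in RHS]/(a *: dp1 z.2 + b *: dp2 z.2).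
    by rewrite mulmxDl -!scalemxAl !scalerDr addrACA.
- move=> [HF [p1 [dp1 [N1 [[h1 h2] h3]]]]] [HG [p2 [dp2 [N2 [[k1 k2] k3]]]]].
  split; first exact: Hsym_lin.
  exists (a *: p1 + b *: p2), (a *: dp1 + b *: dp2), (a *: N1 + b *: N2).
  split; first by split; [exact: L2H1_circle_lin|exact: L2H1_section_lin].
  apply: eqf_trans (eqf_lin a b h3 k3) _; apply: ae_all => z _.
  rewrite -[LHS]/(a *: symp _ + b *: symp _) -sympD -colND.
  congr (symp (colN _ _)).
  rewrite -[in RHS]/(a *: N1 z + b *: N2 z).
  by rewrite scalerDr !scalerA ![_ * g^-1]mulrC.
- move=> [HF [p1 [dp1 [q1 [N1 [h1 h2 h3]]]]]] [HG [p2 [dp2 [q2 [N2 [k1 k2 k3]]]]]].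
  split; first exact: Hsym_lin.
  exists (a *: p1 + b *: p2), (a *: dp1 + b *: dp2), (a *: q1 + b *: q2),
    (a *: N1 + b *: N2).
  split; [exact: L2H1_circle_lin|exact: H1_section_lin|].
  apply: eqf_trans (eqf_lin a b h3 k3) _; apply: ae_all => z _.
  by rewrite -[LHS]/(a *: symp _ + b *: symp _) -sympD -colND.
Qed.

Lemma weak_derivative_zero d (T : measurableType d)
    (mu : {measure set T -> \bar R}) D test del :
  measurable D -> weak_derivative mu D test del (fun=> 0) (fun=> 0).
Proof.
move=> mD eta _; rewrite -[RHS]mulN1r.
under eq_Rintegral do rewrite mul0r.
under [in RHS]eq_Rintegral do rewrite mul0r.
by rewrite Rintegral_cst // mul0r mulr0.
Qed.

(** The sign of [gamma] excludes [-oo], for which [Hrel] is empty. *)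
Lemma Hrel_0 (gamma : \bar R) : (0 <= gamma)%E -> Hrel S gamma 0.
Proof.
have HS : Hsym S 0.
  split; last by apply: ae_all => z _; rewrite -[(0 : field) z]/(0 : M3) trmx0.
  move=> i j; rewrite (_ : (fun z => _) = fun=> 0); first exact: L2_0.
  by apply/funext => z; rewrite mxE.
have circ0 : H1_circle (fun=> 0) (fun=> 0 : R).
  by split; [exact: L2_0|exact: L2_0|exact: weak_derivative_zero].
have z0 (m n : nat) (i : 'I_m) (j : 'I_n) (T : Type) : (fun=> 0) =1 (fun _ : T => (0 : 'M[R]_(m, n)) i j).
  by move=> x; rewrite mxE.
have Lc0 : L2H1_circle S (fun=> 0) (fun=> 0).
  move=> i; split; try exact: L2_ext (z0 _ _ _ _ _) (L2_0 _ mC).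
  by apply: (weak_derivative_ext (z0 _ _ _ _ _) (z0 _ _ _ _ _)); exact: weak_derivative_zero.
have Ls0 : L2H1_section S (fun=> 0) (fun=> 0).
  move=> i; split; first exact: L2_ext (z0 _ _ _ _ _) (L2_0 _ mC).
  move=> j; split; first exact: L2_ext (z0 _ _ _ _ _) (L2_0 _ mC).
  by apply: (weak_derivative_ext (z0 _ _ _ _ _) (z0 _ _ _ _ _)); exact: weak_derivative_zero.
have s0 : H1_section S (fun=> 0) (fun=> 0).
  move=> i; split; first exact: L2_ext (z0 _ _ _ _ _) (L2_0 _ mS).
  move=> j; split; first exact: L2_ext (z0 _ _ _ _ _) (L2_0 _ mS).
  by apply: (weak_derivative_ext (z0 _ _ _ _ _) (z0 _ _ _ _ _)); exact: weak_derivative_zero.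
have c0 : symp (colN 0 0) = 0 :> M3.
  by rewrite /symp /colN row_mx0 trmx0 addr0 scaler0.
case: gamma => [g||] //= _; [case: ifP => _|].
- split => //; exists (fun=> 0), (fun=> 0), (fun=> 0), (fun=> 0), (fun=> 0), (fun=> 0).
  split => //.
  + by move=> y; rewrite /skew_mx trmx0 oppr0.
  + by move=> i j; rewrite -(funext (z0 3%N 3%N i j R)).
  + by move=> i; rewrite -(funext (z0 3%N 1%N i 0 R)).
  + by apply: ae_all => z _; rewrite mul0mx addr0 c0.
- split => //; exists (fun=> 0), (fun=> 0), (fun=> 0); split => //.
  by apply: ae_all => z _; rewrite scaler0 c0.
- split => //; exists (fun=> 0), (fun=> 0), (fun=> 0), (fun=> 0); split => //.
  by apply: ae_all => z _; rewrite c0.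
Qed.

Lemma Hrel_Hsym (gamma : \bar R) : Hrel S gamma `<=` Hsym S.
Proof. by case: gamma => [g||] //= F; [case: ifP => _ []|case]. Qed.

Lemma Hsym_L2 : Hsym S `<=` L2field S.
Proof. by move=> F []. Qed.

End RelaxationSpace.

(** * Integrals of bump functions *)

Section ProductSigmaFinite.
Context d1 d2 (T1 : measurableType d1) (T2 : measurableType d2) (R : realType).
Variables (m1 : {sigma_finite_measure set T1 -> \bar R})
  (m2 : {sigma_finite_measure set T2 -> \bar R}).

Let m12 : {measure set (T1 * T2) -> \bar R} := (m1 \x m2)%E.

Lemma product_sigma_finite : sigma_finite setT m12.
Proof.
have /sigma_finiteP[F [TF ndF Foo]] := sigma_finiteT m1.
have /sigma_finiteP[G [TG ndG Goo]] := sigma_finiteT m2.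
exists (fun n => F n `*` G n).
  rewrite -setXTT TF TG predeqE => -[x y]; split.
    move=> [/= [n _ Fnx] [k _ Gky]]; exists (maxn n k) => //; split.
    - by move: x Fnx; exact/subsetPset/ndF/leq_maxl.
    - by move: y Gky; exact/subsetPset/ndG/leq_maxr.
  by move=> [n _ []/= ? ?]; split; exists n.
move=> k; have [? ?] := Foo k; have [? ?] := Goo k.
split; first exact: measurableX.
by rewrite /m12 /= product_measure1E // lte_mul_pinfty // ge0_fin_numE.
Qed.

(* The sigma-finite structure of [m1 \x m2] cannot be inferred: the library
   only declares it for subprobabilities. *)
Definition product_sf : {sigma_finite_measure set (T1 * T2)%type -> \bar R} :=
  HB.pack (Measure.sort m12)
    (Measure_isSigmaFinite.Build _ _ _ (Measure.sort m12) product_sigma_finite).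

End ProductSigmaFinite.

Section ProductIntegral.
Context d1 d2 (T1 : measurableType d1) (T2 : measurableType d2) (R : realType).
Variables (m1 : {sigma_finite_measure set T1 -> \bar R})
  (m2 : {sigma_finite_measure set T2 -> \bar R}).
Variables (D1 : set T1) (D2 : set T2).
Hypotheses (mD1 : measurable D1) (mD2 : measurable D2).

Let prod_setT (F : T1 -> R) (G : T2 -> R) :
  m1.-integrable setT (EFin \o F) -> m2.-integrable setT (EFin \o G) ->
  (m1 \x m2)%E.-integrable setT (EFin \o (fun z => F z.1 * G z.2)) /\
  (\int[m1 \x m2]_z (F z.1 * G z.2)%:E)%E =
    (\int[m1]_x F x * \int[m2]_y G y)%:E.
Proof.
move=> jF jG.
have mF : measurable_fun setT F by case/integrableP : jF => /measurable_EFinP.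
have mG : measurable_fun setT G by case/integrableP : jG => /measurable_EFinP.
have mFG : measurable_fun setT (fun z : T1 * T2 => F z.1 * G z.2).
  by apply: measurable_funM; apply: measurableT_comp.
(* Tonelli on absolute values comes first; it is what entitles the signed product to Fubini. *)
have jFG : (m1 \x m2)%E.-integrable setT (EFin \o (fun z => F z.1 * G z.2)).
  apply/integrable12ltyP; first exact/measurable_EFinP.
  under eq_integral => x _.
    under eq_integral => y _ do rewrite /= normrM EFinM.
    rewrite ge0_integralZl //; last by apply/measurable_EFinP; exact: measurableT_comp.
    over.
  have jG' := integrable_fin_num measurableT (integrable_abse jG).
  rewrite -(fineK jG').
  rewrite ge0_integralZr //; last first.
  - by rewrite lee_fin fine_ge0 //; apply: integral_ge0 => x _ /=.
  - by apply/measurable_EFinP; exact: measurableT_comp.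
  have jF' := integrable_fin_num measurableT (integrable_abse jF).
  by rewrite -(fineK jF') -EFinM ltry.
split => //; rewrite -(integral12_prod_meas1 jFG) /fubini_F.
under eq_integral => x _.
  under eq_integral => y _ do rewrite /= EFinM.
  rewrite integralZl // -EFin_Rintegral //.
  over.
by rewrite integralZr // -EFin_Rintegral.
Qed.

Lemma Rintegral_prod (f : T1 -> R) (g : T2 -> R) :
  m1.-integrable D1 (EFin \o f) -> m2.-integrable D2 (EFin \o g) ->
  (m1 \x m2)%E.-integrable (D1 `*` D2) (EFin \o (fun z => f z.1 * g z.2)) /\
  \int[(m1 \x m2)%E]_(z in D1 `*` D2) (f z.1 * g z.2) =
    \int[m1]_(x in D1) f x * \int[m2]_(y in D2) g y.
Proof.
move=> /(integrable_mkcond _ mD1) jf /(integrable_mkcond _ mD2) jg.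
rewrite !restrict_EFin in jf jg.
have [j E] := prod_setT jf jg.
(* Extension by zero commutes with the product, which reduces the rectangle to the whole space. *)
have res : (fun z => (f \_ D1) z.1 * (g \_ D2) z.2) =
    (fun z : T1 * T2 => f z.1 * g z.2) \_ (D1 `*` D2).
  apply/funext => -[x y]; rewrite !patchE /=.
  have -> : ((x, y) \in D1 `*` D2) = (x \in D1) && (y \in D2).
    by apply/idP/andP; rewrite !inE.
  by case: (x \in D1); case: (y \in D2); rewrite /= ?mulr0 ?mul0r.
split.
  by apply/integrable_mkcond; [exact: measurableX|rewrite restrict_EFin -res].
rewrite [LHS]Rintegral_mkcond -res /Rintegral E /=.
by rewrite -!Rintegral_mkcond.
Qed.

End ProductIntegral.

Section BumpIntegrals.
Context (R : realType).
Local Notation mR := (measurableTypeR R).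
Local Notation mu := (@lebesgue_measure R).

Lemma Rintegral_derivative (F f : R -> R) (a b : R) : a < b ->
  (forall x : R, is_derive x 1 F (f x)) -> continuous f ->
  \int[leb1]_(x in (`[a, b]%classic : set mR)) f x = F b - F a.
Proof.
move=> ab dF cf.
have cF : continuous F.
  move=> x; apply/differentiable_continuous/derivable1_diffP.
  by case: (dF x).
rewrite /Rintegral /leb1 (@continuous_FTC2 _ f F) //.
- exact: continuous_subspaceT.
- split; first by move=> x _; case: (dF x).
  + by apply: cvg_at_right_filter; exact: cF.
  + by apply: cvg_at_left_filter; exact: cF.
- by move=> x _; rewrite derive1E (@derive_val _ _ _ _ _ _ _ (dF x)).
Qed.

Lemma continuous_integrable_segment (f : R -> R) (a b : R) : continuous f ->
  leb1.-integrable (`[a, b]%classic : set mR) (EFin \o f).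
Proof.
move=> cf; apply: continuous_compact_integrable; first exact: segment_compact.
exact: continuous_subspaceT.
Qed.

Lemma hat_continuous (c r : R) : continuous (hat c r).
Proof. exact/smooth_continuous/hat_smooth. Qed.

Lemma dhat_continuous (c r : R) : continuous ('D_1 (hat c r)).
Proof. exact/smooth_continuous/smooth_derive/hat_smooth. Qed.

Lemma is_derive_hat (c r x : R) : is_derive x 1 (hat c r) ('D_1 (hat c r) x).
Proof. exact/derivableP/smooth_derivable/hat_smooth. Qed.

Lemma hat_out (c r t : R) : ~ (`[c - r, c + r]%classic t) -> hat c r t = 0.
Proof.
move=> nt; apply: hat_eq0; apply/negPn/negP; rewrite negb_or -!ltNge.
by move=> /andP[h1 h2]; apply: nt; rewrite /= in_itv /= !ltW.
Qed.

Lemma dhat_out (c r t : R) : ~ (`[c - r, c + r]%classic t) ->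
  'D_1 (hat c r) t = 0.
Proof.
move=> nt.
have e0 : \forall y \near t, hat c r y = cst 0 y.
  have : nbhs t (~` `[c - r, c + r]%classic).
    by apply: open_nbhs_nbhs; split => //; apply: closed_openC; exact: itv_closed.
  by apply: filterS => y /hat_out.
by rewrite (near_eq_derive _ e0) derive_cst.
Qed.

Definition hat_mass (c r : R) : R :=
  \int[leb1]_(x in (`[c - r, c + r]%classic : set mR)) hat c r x.

Lemma Rintegral_dhat (c r : R) : 0 < r ->
  \int[leb1]_(x in (`[c - r, c + r]%classic : set mR)) 'D_1 (hat c r) x = 0.
Proof.
move=> r0; have cr : c - r < c + r by lra.
rewrite (Rintegral_derivative cr (is_derive_hat c r) (@dhat_continuous c r)).
by rewrite !hat_eq0 ?subr0 // lexx ?orbT.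
Qed.

(** Integration by parts, carried out as the fundamental theorem for t times [hat c r t], which
    vanishes at both end points. *)
Lemma Rintegral_id_dhat (c r : R) : 0 < r ->
  \int[leb1]_(x in (`[c - r, c + r]%classic : set mR)) (x * 'D_1 (hat c r) x)
  = - hat_mass c r.
Proof.
move=> r0.
have cxd : continuous (fun x : R => x * 'D_1 (hat c r) x).
  by move=> x; apply: cvgM; [exact: cvg_id|exact: dhat_continuous].
have cr : c - r < c + r by lra.
have dxh (x : R) : is_derive x 1 (fun t : R => t * hat c r t)
    (x * 'D_1 (hat c r) x + hat c r x).
  have := is_deriveM (is_derive_id x 1) (is_derive_hat c r x).
  by rewrite /GRing.scale /= mulr1.
have cs : continuous (fun x : R => x * 'D_1 (hat c r) x + hat c r x).
  by move=> x; apply: cvgD; [exact: cxd|exact: hat_continuous].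
have := Rintegral_derivative cr dxh cs.
rewrite !hat_eq0 ?lexx ?orbT // !mulr0 subr0 RintegralD //.
- by move=> h; apply/eqP; rewrite -addr_eq0 h.
- exact: continuous_integrable_segment.
- exact/continuous_integrable_segment/hat_continuous.
Qed.

(** Were the mass zero, the hat would vanish almost everywhere on the segment, yet it is positive on
    an open interval of length 2 r. *)
Lemma hat_mass_gt0 (c r : R) : 0 < r -> 0 < hat_mass c r.
Proof.
move=> r0; rewrite lt_neqAle /hat_mass Rintegral_ge0 ?andbT; last first.
  by move=> x _; exact: hat_ge0.
apply/eqP => /esym h.
have jh := continuous_integrable_segment (c - r) (c + r) (@hat_continuous c r).
have [|A [mA A0 sA]] := ae_eq0_Rintegral _ jh (fun x _ => hat_ge0 c r x) h.
  exact: measurable_itv.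
have : (mu `](c - r)%R, (c + r)%R[%classic <= mu A)%E.
  apply: le_measure; rewrite ?inE //.
  move=> x xI; apply: sA => /= hx; move: xI; rewrite /= in_itv /= => /andP[x1 x2].
  have := @hat_gt0 _ c r x; rewrite x1 x2 => /(_ isT).
  by rewrite hx ?ltxx // in_itv /= !ltW.
rewrite [leRHS]A0 lebesgue_measure_itv /= lte_fin.
have -> : c - r < c + r by lra.
by rewrite -EFinD lee_fin; lra.
Qed.

End BumpIntegrals.

Section BumpSection.
Context (R : realType) (S : set (R * R)).
Local Notation mR := (measurableTypeR R).
Local Notation mu := (@lebesgue_measure R).
Variables (p : R * R) (r : R).
Hypothesis r0 : 0 < r.
Let box : set (R * R) := `[p.1 - r, p.1 + r]%classic `*` `[p.2 - r, p.2 + r]%classic.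
Hypothesis boxS : box `<=` S.

Lemma bump_test : test_section S (bump p r).
Proof.
split; first exact: bump_smooth.
exists box; split => //; first by apply: compact_setX; exact: segment_compact.
move=> x nx; rewrite /bump; have [h|/hat_out ->] := pselect (`[p.1 - r, p.1 + r]%classic x.1).
  have [h'|/hat_out ->] := pselect (`[p.2 - r, p.2 + r]%classic x.2).
    by exfalso; apply: nx.
  by rewrite mulr0.
by rewrite mul0r.
Qed.

(** The integrand vanishes outside the box, which lies in [S], so the shape of [S] does not matter
    and Fubini applies on the box. *)
Lemma Rintegral_box (f g : R -> R) : continuous f -> continuous g ->
  (forall t, ~ `[p.1 - r, p.1 + r]%classic t -> f t = 0) ->
  (forall t, ~ `[p.2 - r, p.2 + r]%classic t -> g t = 0) ->
  \int[leb2]_(x in (S : set (mR * mR))) (f x.1 * g x.2) =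
  \int[leb1]_(t in (`[p.1 - r, p.1 + r]%classic : set mR)) f t *
  \int[leb1]_(t in (`[p.2 - r, p.2 + r]%classic : set mR)) g t.
Proof.
move=> cf cg f0 g0.
have [_] := @Rintegral_prod _ _ mR mR R mu mu _ _ (measurable_itv _) (measurable_itv _)
  _ _ (continuous_integrable_segment (p.1 - r) (p.1 + r) cf)
  (continuous_integrable_segment (p.2 - r) (p.2 + r) cg).
apply: etrans.
rewrite -[X in _ = Rintegral _ X _]/(box : set (mR * mR)) -[X in _ = Rintegral X _ _]/leb2.
rewrite -[in RHS](setIidr boxS) Rintegral_mkcondr.
apply: eq_Rintegral => x _; rewrite patchE; case: ifPn => // /negP; rewrite inE => nx.
have [h|/f0 ->] := pselect (`[p.1 - r, p.1 + r]%classic x.1); last by rewrite mul0r.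
have [h'|/g0 ->] := pselect (`[p.2 - r, p.2 + r]%classic x.2); last by rewrite mulr0.
by exfalso; apply: nx.
Qed.

Definition bump_mass : R := hat_mass p.1 r * hat_mass p.2 r.

Lemma bump_mass_gt0 : 0 < bump_mass.
Proof. by rewrite mulr_gt0 // hat_mass_gt0. Qed.

Lemma Rintegral_bump :
  \int[leb2]_(x in (S : set (mR * mR))) bump p r x = bump_mass.
Proof.
by apply: Rintegral_box; try exact: hat_continuous; move=> t; exact: hat_out.
Qed.

Let xout c (f : R -> R) : (forall t, ~ `[c - r, c + r]%classic t -> f t = 0) ->
  forall t, ~ `[c - r, c + r]%classic t -> t * f t = 0.
Proof. by move=> h t /h ->; rewrite mulr0. Qed.

Let xcont (f : R -> R) : continuous f -> continuous (fun t : R => t * f t).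
Proof. by move=> cf t; apply: cvgM; [exact: cvg_id|exact: cf]. Qed.

(** Among the moments against 1, x_2 and x_3, only that of the differentiated variable survives.
    Pairing an affine function with a derivative of the bump therefore isolates one of its
    coefficients. *)
Lemma Rintegral_dbump1 :
  [/\ \int[leb2]_(x in (S : set (mR * mR))) 'D_((1, 0) : R * R) (bump p r) x = 0,
   \int[leb2]_(x in (S : set (mR * mR))) (x.1 * 'D_((1, 0) : R * R) (bump p r) x)
     = - bump_mass &
   \int[leb2]_(x in (S : set (mR * mR))) (x.2 * 'D_((1, 0) : R * R) (bump p r) x)
     = 0].
Proof.
have h1 := @hat_out _ p.2 r; have h2 := @dhat_out _ p.1 r.
have c1 := @hat_continuous _ p.2 r; have c2 := @dhat_continuous _ p.1 r.
split.
- under eq_Rintegral do rewrite derive_bump1.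
  by rewrite (Rintegral_box c2 c1 h2 h1) Rintegral_dhat // mul0r.
- under eq_Rintegral do rewrite derive_bump1 mulrA.
  rewrite (Rintegral_box (xcont c2) c1 (xout h2) h1).
  by rewrite Rintegral_id_dhat // mulNr.
- under eq_Rintegral do rewrite derive_bump1 mulrCA.
  by rewrite (Rintegral_box c2 (xcont c1) h2 (xout h1)) Rintegral_dhat // mul0r.
Qed.

Lemma Rintegral_dbump2 :
  [/\ \int[leb2]_(x in (S : set (mR * mR))) 'D_((0, 1) : R * R) (bump p r) x = 0,
   \int[leb2]_(x in (S : set (mR * mR))) (x.1 * 'D_((0, 1) : R * R) (bump p r) x)
     = 0 &
   \int[leb2]_(x in (S : set (mR * mR))) (x.2 * 'D_((0, 1) : R * R) (bump p r) x)
     = - bump_mass].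
Proof.
have h1 := @hat_out _ p.1 r; have h2 := @dhat_out _ p.2 r.
have c1 := @hat_continuous _ p.1 r; have c2 := @dhat_continuous _ p.2 r.
split.
- under eq_Rintegral do rewrite derive_bump2.
  by rewrite (Rintegral_box c1 c2 h1 h2) Rintegral_dhat // mulr0.
- under eq_Rintegral do rewrite derive_bump2 mulrA.
  by rewrite (Rintegral_box (xcont c1) c2 (xout h1) h2) Rintegral_dhat // mulr0.
- under eq_Rintegral do rewrite derive_bump2 mulrCA.
  rewrite (Rintegral_box c1 (xcont c2) h1 (xout h2)).
  by rewrite Rintegral_id_dhat // mulrN.
Qed.

(** In either order the product structure yields the derivative of one factor times the derivative
    of the other. *)
Lemma bump_mixed_derivative (x : R * R) :
  'D_((1, 0) : R * R) ('D_((0, 1) : R * R) (bump p r)) x =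
  'D_((0, 1) : R * R) ('D_((1, 0) : R * R) (bump p r)) x.
Proof.
have d1 : 'D_((0, 1) : R * R) (bump p r) =
    fun x : R * R => hat p.1 r x.1 * 'D_1 (hat p.2 r) x.2.
  by apply/funext => y; exact: derive_bump2.
have d2 : 'D_((1, 0) : R * R) (bump p r) =
    fun x : R * R => 'D_1 (hat p.1 r) x.1 * hat p.2 r x.2.
  by apply/funext => y; exact: derive_bump1.
apply: etrans (congr1 (fun h => 'D_((1, 0) : R * R) h x) d1) _.
apply: etrans (esym (congr1 (fun h => 'D_((0, 1) : R * R) h x) d2)).
apply: etrans (derive_tensor1 ('D_1 (hat p.2 r))
  (smooth_derivable (hat_smooth p.1 r))) _.
exact/esym/(derive_tensor2 ('D_1 (hat p.1 r))
  (smooth_derivable (hat_smooth p.2 r))).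
Qed.

End BumpSection.

(** * Coercivity modulo relaxation fields *)

Section Annihilators.
Context (R : realType) (S : set (R * R)).
Hypothesis oS : open S.
Hypothesis bS : bounded_set S.
Local Notation mR := (measurableTypeR R).
Local Notation mu := (@lebesgue_measure R).
Local Notation M3 := 'M[R]_3.
Local Notation field := (R * R * R -> M3).

Let mS := measurable_section oS.
Let mY := @measurable_Y R.
Let mC := measurable_cell oS.
Let fC := leb3_cell_fin oS bS.

Lemma Rintegral_cell_prod (f : R * R -> R) (g : R -> R) :
  L2 leb2 (S : set (mR * mR)) f -> L2 leb1 (Y : set mR) g ->
  leb3.-integrable (cell S : set (mR * mR * mR)) (EFin \o (fun z => f z.1 * g z.2)) /\
  \int[leb3]_(z in (cell S : set (mR * mR * mR))) (f z.1 * g z.2) =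
    \int[leb2]_(x in (S : set (mR * mR))) f x * \int[leb1]_(y in (Y : set mR)) g y.
Proof.
move=> Lf Lg.
have fS := leb2_section_fin oS bS.
have fY : (leb1 (Y : set mR) < +oo)%E by rewrite leb1_Y ltry.
have [j E] := (@Rintegral_prod _ _ (mR * mR)%type mR R (product_sf mu mu) mu _ _ mS mY _ _
  (L2_integrable mS fS Lf) (L2_integrable mY fY Lg)).
split; [exact j|exact E].
Qed.

Lemma Rintegral_Y1 : \int[leb1]_(y in (Y : set mR)) (1 : R) = 1.
Proof. by rewrite Rintegral_cst // leb1_Y mulr1. Qed.

Lemma Rintegral_cell_fst (f : R * R -> R) : L2 leb2 (S : set (mR * mR)) f ->
  \int[leb3]_(z in (cell S : set (mR * mR * mR))) f z.1 =
    \int[leb2]_(x in (S : set (mR * mR))) f x.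
Proof.
move=> Lf; have [_] := Rintegral_cell_prod Lf (L2_continuous_Y (@cst_continuous _ _ (1 : R))).
rewrite Rintegral_Y1 mulr1 => <-.
by apply: eq_Rintegral => z _; rewrite mulr1.
Qed.

Lemma test_section_cell (eta : R * R -> R) : test_section S eta ->
  test_cell S (eta \o fst).
Proof.
move=> [se [K [cK KS K0]]]; split.
- exact: smooth_fst.
- by move=> x y.
- by exists K; split => // x y /K0.
Qed.

Lemma test_section_continuous (eta : R * R -> R) : test_section S eta ->
  continuous eta.
Proof. by move=> [/smooth_continuous]. Qed.

Lemma derive0_dir (V W : normedModType R) (f : V -> W) x : 'D_0 f x = 0.
Proof.
rewrite /derive (_ : (fun h => _) = fun=> 0); first exact: lim_cst.
by apply/funext => h; rewrite /= scaler0 add0r subrr scaler0.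
Qed.

Lemma L2_cell_fst (f : R * R -> R) : continuous f ->
  L2 leb3 (cell S) (fun z => f z.1).
Proof.
move=> cf; apply: (L2_continuous_cell oS bS) => z.
by apply: continuous_comp; [exact: cvg_fst|exact: cf].
Qed.

(** A test function that depends on the section alone has derivative zero along y, so the weak
    formulation makes the y-derivative orthogonal to it. *)
Lemma L2H1_circle_orth (phi dphi : R * R * R -> 'cV[R]_3) (eta : R * R -> R) i :
  L2H1_circle S phi dphi -> test_section S eta ->
  leb3.-integrable (cell S) (EFin \o (fun z => dphi z i 0 * eta z.1)) /\
  \int[leb3]_(z in cell S) (dphi z i 0 * eta z.1) = 0.
Proof.
move=> /(_ i)[L1 L2d w] te; have tc := test_section_cell te; split.
  exact: (L2_mul_integrable mC L2d (L2_cell_fst (test_section_continuous te))).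
have := w _ tc; move=> /eqP; rewrite -eqr_oppLR => /eqP <-.
rewrite (@eq_Rintegral _ _ _ _ _ (fun=> 0)).
  by rewrite Rintegral_cst // mul0r oppr0.
move=> z _; rewrite derive_fst.
by rewrite (_ : diry.1 = 0) // derive0_dir mulr0.
Qed.

(* What coercivity needs of the relaxation fields, and what the three cases of
   [gamma] share; of the last two columns only the first row matters. *)
Definition relaxed_columns (v : R * R * R -> 'cV[R]_3)
    (N : R * R * R -> 'M[R]_(3, 2)) : Prop :=
  (forall i (eta : R * R -> R), test_section S eta ->
     leb3.-integrable (cell S) (EFin \o (fun z => v z i 0 * eta z.1)) /\
     \int[leb3]_(z in cell S) (v z i 0 * eta z.1) = 0) /\
  exists phi : R * R * R -> R,
  forall j (eta : R * R -> R), test_section S eta ->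
     leb3.-integrable (cell S) (EFin \o (fun z => N z 0 j * eta z.1)) /\
     \int[leb3]_(z in cell S) (N z 0 j * eta z.1) =
     - \int[leb3]_(z in cell S) (phi z * 'D_(dir2 j) eta z.1).

Lemma L2H1_section_grad (phi : R * R * R -> 'cV[R]_3) N (eta : R * R -> R) i j :
  L2H1_section S phi N -> test_section S eta ->
  leb3.-integrable (cell S) (EFin \o (fun z => N z i j * eta z.1)) /\
  \int[leb3]_(z in cell S) (N z i j * eta z.1) =
  - \int[leb3]_(z in cell S) (phi z i 0 * 'D_(dir2 j) eta z.1).
Proof.
move=> /(_ i)[L1 /(_ j)[LN w]] te; split.
  exact: (L2_mul_integrable mC LN (L2_cell_fst (test_section_continuous te))).
have := w _ (test_section_cell te) => /eqP; rewrite -eqr_oppLR => /eqP <-.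
by congr (- _); apply: eq_Rintegral => z _; rewrite derive_fst.
Qed.

Lemma L2_mul_continuous_section (f g : R * R -> R) :
  L2 leb2 (S : set (mR * mR)) f -> continuous g ->
  L2 leb2 (S : set (mR * mR)) (fun x => f x * g x).
Proof.
move=> Lf cg; have [c hc] := continuous_bounded_section bS cg.
by apply: (L2_mul_bounded mS Lf _ hc); exact: measurable_fun_continuous2.
Qed.

(** The counterpart of [L2H1_section_grad] for fields constant in y: as [Y] has length 1, integrals
    over the cell are integrals over [S]. *)
Lemma H1_section_grad (phi : R * R -> 'cV[R]_3) N (eta : R * R -> R) i j :
  H1_section S phi N -> test_section S eta ->
  leb3.-integrable (cell S) (EFin \o (fun z => N z.1 i j * eta z.1)) /\
  \int[leb3]_(z in cell S) (N z.1 i j * eta z.1) =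
  - \int[leb3]_(z in cell S) (phi z.1 i 0 * 'D_(dir2 j) eta z.1).
Proof.
move=> /(_ i)[L1 /(_ j)[LN w]] te.
have cde := smooth_continuous (smooth_derive (dir2 j) te.1).
have L1e := L2_mul_continuous_section LN (test_section_continuous te).
have L2e := L2_mul_continuous_section L1 cde.
have [j1 _] := Rintegral_cell_prod L1e (L2_continuous_Y (@cst_continuous _ _ (1 : R))).
split; first by apply: (eq_integrable_real mC _ j1) => z _; rewrite mulr1.
rewrite (Rintegral_cell_fst L1e) (Rintegral_cell_fst L2e).
by have := w _ te => /eqP; rewrite -eqr_oppLR => /eqP <-.
Qed.

(** The constant 1 is a periodic test function with zero derivative. *)
Lemma circle_mean0 (f df : R -> R) : H1_circle f df ->
  \int[leb1]_(y in (Y : set mR)) df y = 0.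
Proof.
move=> [Lf Ldf w].
have tc : test_circle (cst 1 : R -> R).
  by split; [exact: (@smooth_cst _ R^o 1)|move=> x].
have := w _ tc; move=> /eqP; rewrite -eqr_oppLR => /eqP.
rewrite (@eq_Rintegral _ _ _ _ _ (fun=> 0)); last first.
  by move=> y _; rewrite derive_cst mulr0.
rewrite Rintegral_cst // mul0r oppr0 => ->.
by apply: eq_Rintegral => y _; rewrite mulr1.
Qed.

Lemma xvecE (x : R * R) i : xvec x i 0 =
  if i == 1 then x.1 else if i == 2 then x.2 else 0.
Proof.
by rewrite /xvec !mxE eqxx !andbT; case: i => [[|[|[|[]]]]] //= h;
  rewrite ?mulr0 ?mulr1 ?addr0 ?add0r.
Qed.

Lemma Hrel_columns (gamma : \bar R) (chi : field) : Hrel S gamma chi ->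
  exists v N, relaxed_columns v N /\ eqf S chi (fun z => symp (colN (v z) (N z))).
Proof.
case: gamma => [g||] //=; [case: ifP => _|].
- move=> [_ [P [dP [p [dp [q [N [h1 h2 h3 h4 h5]]]]]]]].
  exists (fun z => dP z.2 *m xvec z.1 + dp z.2), N; split => //; split; last first.
    by exists (fun z => q z 0 0) => j eta te; exact: L2H1_section_grad.
  move=> i eta te.
  have ce := test_section_continuous te.
  have c1 : continuous (fun x : R * R => x.1 * eta x).
    by move=> x; apply: cvgM; [exact: cvg_fst|exact: ce].
  have c2 : continuous (fun x : R * R => x.2 * eta x).
    by move=> x; apply: cvgM; [exact: cvg_snd|exact: ce].
  have [_ L1 _] := h2 i 1; have [_ L2' _] := h2 i 2; have [_ L3 _] := h3 i.
  have [j1 E1] := Rintegral_cell_prod (L2_continuous_section oS bS c1) L1.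
  have [j2 E2] := Rintegral_cell_prod (L2_continuous_section oS bS c2) L2'.
  have [j3 E3] := Rintegral_cell_prod (L2_continuous_section oS bS ce) L3.
  (* Each term is a function of the section times a derivative in y, so Fubini and [circle_mean0]
     make its integral vanish. The coordinate of [xvec] along [e1] is zero, hence three terms
     only. *)
  have E z : (dP z.2 *m xvec z.1 + dp z.2) i 0 * eta z.1 =
      z.1.1 * eta z.1 * dP z.2 i 1 + (z.1.2 * eta z.1 * dP z.2 i 2 +
      eta z.1 * dp z.2 i 0).
    rewrite !mxE !big_ord_recl big_ord0 !xvecE /=.
    rewrite (_ : lift ord0 ord0 = 1 :> 'I_3); last exact/val_inj.
    rewrite (_ : lift ord0 (lift ord0 ord0) = 2 :> 'I_3); last exact/val_inj.
    by rewrite /=; ring.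
  split.
    apply: (eq_integrable_real mC (fun z _ => esym (E z))).
    by do 2 apply: integrable_addr => //.
  under eq_Rintegral do rewrite E.
  rewrite !RintegralD //; last exact: integrable_addr.
  rewrite E1 E2 E3 (circle_mean0 (h2 i 1)) (circle_mean0 (h2 i 2)).
  by rewrite (circle_mean0 (h3 i)) !mulr0 !addr0.
- move=> [_ [p [dp [N [[h1 h2] h3]]]]].
  exists dp, (fun z => g^-1 *: N z); split => //; split.
    by move=> i eta te; exact: L2H1_circle_orth h1 te.
  (* The factor 1/gamma in front of the gradient is absorbed in the potential. *)
  exists (fun z => g^-1 * p z 0 0) => j eta te.
  have [j1 E1] := L2H1_section_grad 0 j h2 te.
  have [L1 _] := h2 0.
  have [_ Lde] := test_section_L2 oS bS (dir2 j) te.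
  have cde := smooth_continuous (smooth_derive (dir2 j) te.1).
  have j2 := L2_mul_integrable mC L1 (L2_cell_fst cde).
  split.
    apply: (eq_integrable_real mC _ (integrable_scaler mC g^-1 j1)) => z _.
    by rewrite mxE mulrA.
  transitivity (g^-1 * \int[leb3]_(z in cell S) (N z 0 j * eta z.1)).
    by rewrite -RintegralZl //; apply: eq_Rintegral => z _; rewrite mxE mulrA.
  rewrite E1 mulrN -RintegralZl //; congr (- _).
  by apply: eq_Rintegral => z _; rewrite mulrA.
- move=> [_ [p [dp [q [N [h1 h2 h3]]]]]].
  exists dp, (fun z => N z.1); split => //; split.
    by move=> i eta te; exact: L2H1_circle_orth h1 te.
  by exists (fun z => q z.1 0 0) => j eta te; exact: H1_section_grad.
Qed.

End Annihilators.

(** * Entries of strains and coordinates of skew matrices *)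

Section MatrixEntries.
Context (R : realType).
Local Notation M3 := 'M[R]_3.

Lemma frobE n (F G : 'M[R]_n) : frob F G = \sum_i \sum_j F i j * G i j.
Proof.
rewrite /frob /mxtrace exchange_big /=; apply: eq_bigr => i _.
by rewrite mxE; apply: eq_bigr => j _; rewrite mxE.
Qed.

Lemma frob_ge0 n (F : 'M[R]_n) : 0 <= frob F F.
Proof.
by rewrite frobE; do 2 (apply: sumr_ge0 => ? _); rewrite -expr2 sqr_ge0.
Qed.

Lemma fnorm_sqr n (F : 'M[R]_n) : fnorm F ^+ 2 = \sum_i \sum_j F i j ^+ 2.
Proof.
rewrite /fnorm sqr_sqrtr ?frob_ge0 // frobE.
by do 2 (apply: eq_bigr => ? _); rewrite expr2.
Qed.

Lemma fnorm_ge0 n (F : 'M[R]_n) : 0 <= fnorm F.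
Proof. exact: sqrtr_ge0. Qed.

Lemma entry_le_fnorm n (F : 'M[R]_n) i j : F i j ^+ 2 <= fnorm F ^+ 2.
Proof.
rewrite fnorm_sqr (bigD1 i) //= (bigD1 j) //= -addrA lerDl.
by rewrite addr_ge0 // ?sumr_ge0 // => k _; rewrite ?sqr_ge0 // sumr_ge0 // => l _;
  rewrite sqr_ge0.
Qed.

Lemma sympE (F : M3) i j : symp F i j = 2^-1 * (F i j + F j i).
Proof. by rewrite !mxE. Qed.

Lemma row_mx3 (u : 'cV[R]_3) (N : 'M[R]_(3, 2)) i (k : 'I_3) :
  colN u N i k = if k == 0 then u i 0 else N i (inord k.-1).
Proof.
rewrite /colN mxE; case: splitP => j; rewrite ?ord1 => kj.
  by rewrite (_ : k == 0) //; apply/eqP/val_inj.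
rewrite (_ : (k == 0) = false); last by apply/negbTE/eqP => k0; rewrite k0 in kj.
by congr (N i _); apply/val_inj; rewrite kj add1n /= inordK.
Qed.

Lemma symp_colN (u : 'cV[R]_3) (N : 'M[R]_(3, 2)) :
  [/\ symp (colN u N) 0 0 = u 0 0,
      symp (colN u N) 0 1 = 2^-1 * (N 0 0 + u 1 0) &
      symp (colN u N) 0 2 = 2^-1 * (N 0 1 + u 2 0)].
Proof.
have i0 : inord 0 = 0 :> 'I_2 by apply/val_inj; rewrite /= inordK.
have i1 : inord 1 = 1 :> 'I_2 by apply/val_inj; rewrite /= inordK.
rewrite !sympE !row_mx3 /= i0 i1; split => //.
by field.
Qed.

Lemma skew_entry (K : M3) i j : skew_mx K -> K j i = - K i j.
Proof. by move=> /matrixP /(_ i j); rewrite !mxE. Qed.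

(** Bending ([K 0 1], [K 0 2]) and stretching ([a]) occupy the diagonal entry, torsion ([K 1 2]) the
    two others, so the two groups can be tested separately. *)
Lemma Estrain_entries (K : M3) (a : R) (z : R * R * R) : skew_mx K ->
  [/\ Estrain K a z 0 0 = K 0 1 * z.1.1 + K 0 2 * z.1.2 + a,
      Estrain K a z 0 1 = 2^-1 * (K 1 2 * z.1.2) &
      Estrain K a z 0 2 = - (2^-1 * (K 1 2 * z.1.1))].
Proof.
move=> sK.
have K0 i j := skew_entry i j sK.
have Kd i : K i i = 0.
  by have := K0 i i; move: (K i i) => k; lra.
have T (u : 'cV[R]_3) i j : tensor u e1 i j = if j == 0 then u i 0 else 0.
  rewrite !mxE big_ord1 !mxE eqxx andbT.
  by case: eqP; rewrite ?mulr1 ?mulr0.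
have U i : (K *m xvec z.1 + a *: e1) i 0 =
    K i 1 * z.1.1 + K i 2 * z.1.2 + if i == 0 then a else 0.
  rewrite !mxE !big_ord_recl big_ord0 !xvecE /= eqxx andbT.
  rewrite (_ : lift ord0 ord0 = 1 :> 'I_3); last exact/val_inj.
  rewrite (_ : lift ord0 (lift ord0 ord0) = 2 :> 'I_3); last exact/val_inj.
  by case: eqP => _ /=; ring.
rewrite /Estrain !sympE !T /= !U /= !Kd.
rewrite (K0 1 2).
by split; field.
Qed.

Lemma tensor_delta n (p q : 'I_n) (K : 'M[R]_n) :
  frob K (delta_mx p 0 *m (delta_mx q 0 : 'cV[R]_n)^T) = K p q.
Proof.
rewrite trmx_delta mul_delta_mx frobE (bigD1 p) //= (bigD1 q) //=.
rewrite !mxE !eqxx mulr1 !big1 ?addr0 //.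
  by move=> i ip; rewrite big1 // => j _; rewrite mxE (negbTE ip) mulr0.
by move=> j jq; rewrite mxE (negbTE jq) andbF mulr0.
Qed.

Lemma frobZB n (c : R) (F G H : 'M[R]_n) :
  frob F (c *: (G - H)) = c * (frob F G - frob F H).
Proof. by rewrite /frob -scalemxAr linearZ /= mulmxBr linearB. Qed.

Lemma sqrt2_neq0 : Num.sqrt 2 != 0 :> R.
Proof. by rewrite gt_eqF // sqrtr_gt0. Qed.

(** The basis matrices carry their positive entry below the diagonal, whence the minus sign; the two
    opposite entries of [K] add up to the factor 2 / sqrt 2. *)
Lemma coordsE (K : M3) (a : R) : skew_mx K ->
  [/\ coords K a 0 0 = a, coords K a 1 0 = - Num.sqrt 2 * K 0 1,
      coords K a 2 0 = - Num.sqrt 2 * K 0 2 &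
      coords K a 3 0 = - Num.sqrt 2 * K 1 2].
Proof.
move=> sK; rewrite /coords !mxE /= /Kb /= /K2 /K3 /K4 /tensor /e1 /e2 /e3.
rewrite !frobZB !tensor_delta.
rewrite (skew_entry 0 1 sK) (skew_entry 0 2 sK) (skew_entry 1 2 sK).
have h := sqrt2_neq0; have h2 : Num.sqrt 2 ^+ 2 = 2 :> R by rewrite sqr_sqrtr.
have aux (x : R) : (Num.sqrt 2)^-1 * (- x - x) = - Num.sqrt 2 * x.
  apply: (mulfI h); rewrite mulrA divff // mul1r mulrA mulrN -expr2 h2.
  by ring.
by split.
Qed.

(** By orthonormality of the basis this is a^2 plus the squared Frobenius norm of [K], in which each
    entry above the diagonal counts twice. *)
Lemma coords_sqr (K : M3) (a : R) : skew_mx K ->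
  ((coords K a)^T *m coords K a) 0 0 =
  a ^+ 2 + 2 * (K 0 1 ^+ 2 + K 0 2 ^+ 2 + K 1 2 ^+ 2).
Proof.
move=> sK; have [h0 h1 h2 h3] := coordsE a sK.
rewrite mxE !big_ord_recl big_ord0.
rewrite (_ : lift ord0 ord0 = 1 :> 'I_4); last exact/val_inj.
rewrite (_ : lift ord0 (lift ord0 ord0) = 2 :> 'I_4); last exact/val_inj.
rewrite (_ : lift ord0 (lift ord0 (lift ord0 ord0)) = 3 :> 'I_4); last exact/val_inj.
rewrite ![_^T 0 _]mxE [coords K a ord0 0]h0 h1 h2 h3.
have hs : Num.sqrt 2 ^+ 2 = 2 :> R by rewrite sqr_sqrtr.
have -> (x y z : R) : a * a + ((- Num.sqrt 2 * x) * (- Num.sqrt 2 * x) +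
    ((- Num.sqrt 2 * y) * (- Num.sqrt 2 * y) +
    ((- Num.sqrt 2 * z) * (- Num.sqrt 2 * z) + 0))) =
    a ^+ 2 + Num.sqrt 2 ^+ 2 * (x ^+ 2 + y ^+ 2 + z ^+ 2) by ring.
by rewrite hs.
Qed.

End MatrixEntries.

Section CauchySchwarz.
Context d (T : measurableType d) (R : realType).
Variables (mu : {measure set T -> \bar R}) (D : set T).
Hypothesis mD : measurable D.

Lemma L2_Cauchy_Schwarz (f g : T -> R) : L2 mu D f -> L2 mu D g ->
  (\int[mu]_(x in D) (f x * g x)) ^+ 2 <=
  \int[mu]_(x in D) f x ^+ 2 * \int[mu]_(x in D) g x ^+ 2.
Proof.
move=> Lf Lg; apply: discriminant_le.
  by apply: Rintegral_ge0 => x _; exact: sqr_ge0.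
move=> t; have jf := Lf.2; have jg := Lg.2; have jfg := L2_mul_integrable mD Lf Lg.
have -> : \int[mu]_(x in D) f x ^+ 2 * t ^+ 2 + 2 * \int[mu]_(x in D) (f x * g x) * t
    + \int[mu]_(x in D) g x ^+ 2 = \int[mu]_(x in D) (t * f x + g x) ^+ 2.
  rewrite [RHS](eq_Rintegral _ (g := fun x => (t ^+ 2 * f x ^+ 2 + (2 * t) * (f x * g x)) + g x ^+ 2)).
    rewrite !RintegralD ?RintegralZl //; first by ring.
    - exact: integrable_scaler.
    - exact: integrable_scaler.
    - by apply: integrable_addr => //; exact: integrable_scaler.
  by move=> x _; ring.
by apply: Rintegral_ge0 => x _; exact: sqr_ge0.
Qed.

End CauchySchwarz.

(** * The coercivity estimate *)

Section Coercivity.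
Context (R : realType) (S : set (R * R)).
Hypothesis oS : open S.
Hypothesis bS : bounded_set S.
Hypothesis S0 : S !=set0.
Local Notation M3 := 'M[R]_3.
Local Notation field := (R * R * R -> M3).

Let mC := measurable_cell oS.

(** Serves square integrability, for which all nine entries are needed but not their
    coefficients. *)
Lemma Estrain_affine (K : M3) (a : R) i j : exists b c d : R,
  forall z, Estrain K a z i j = b * z.1.1 + c * z.1.2 + d.
Proof.
have T (u : 'cV[R]_3) k l : tensor u e1 k l = (l == 0)%:R * u k 0.
  rewrite !mxE big_ord1 !mxE eqxx andbT.
  by case: eqP; rewrite ?mulr1 ?mulr0 ?mul1r ?mul0r.
have U z k : (K *m xvec z + a *: e1) k 0 =
    K k 1 * z.1 + K k 2 * z.2 + (k == 0)%:R * a.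
  rewrite !mxE !big_ord_recl big_ord0 !xvecE /= eqxx andbT.
  rewrite (_ : lift ord0 ord0 = 1 :> 'I_3); last exact/val_inj.
  rewrite (_ : lift ord0 (lift ord0 ord0) = 2 :> 'I_3); last exact/val_inj.
  by case: eqP => _ /=; ring.
exists (2^-1 * ((j == 0)%:R * K i 1 + (i == 0)%:R * K j 1)),
  (2^-1 * ((j == 0)%:R * K i 2 + (i == 0)%:R * K j 2)),
  (2^-1 * ((j == 0)%:R * ((i == 0)%:R * a) + (i == 0)%:R * ((j == 0)%:R * a))).
by move=> z; rewrite /Estrain sympE !T !U; ring.
Qed.

Lemma fst_fst_continuous : continuous (fun z : R * R * R => z.1.1).
Proof.
by move=> z; apply: (@continuous_comp _ _ _ fst fst z); [exact: cvg_fst|exact: cvg_fst].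
Qed.

Lemma fst_snd_continuous : continuous (fun z : R * R * R => z.1.2).
Proof.
by move=> z; apply: (@continuous_comp _ _ _ fst snd z); [exact: cvg_fst|exact: cvg_snd].
Qed.

Lemma L2_Estrain (K : M3) (a : R) : L2field S (Estrain K a).
Proof.
move=> i j; have [b [c [d E]]] := Estrain_affine K a i j.
have cE : continuous (fun z : R * R * R => b * z.1.1 + c * z.1.2 + d).
  move=> z; apply: cvgD; last exact: cvg_cst.
  apply: cvgD; apply: cvgM; try exact: cvg_cst.
  - exact: fst_fst_continuous.
  - exact: fst_snd_continuous.
by have := L2_continuous_cell oS bS cE; apply: L2_ext => z; rewrite E.
Qed.

Lemma relaxed_orth (v : R * R * R -> 'cV[R]_3) N (chi : field) (eta : R * R -> R) :
  L2field S chi -> relaxed_columns S v N ->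
  eqf S chi (fun z => symp (colN (v z) (N z))) -> test_section S eta ->
  \int[leb3]_(z in cell S) (chi z 0 0 * eta z.1) = 0.
Proof.
move=> Lchi [hv _] echi te; have [jv <-] := hv 0 eta te.
have ce := L2_cell_fst oS bS (test_section_continuous te).
apply/esym/eq_ae_Rintegral => //.
  by apply: measurable_funM; [case: (Lchi 0 0)|case: ce].
apply: ae_imp echi => z echi Cz; rewrite echi //.
by case: (symp_colN (v z) (N z)) => ->.
Qed.

(* Against the rotated gradient of a bump, the gradient part of [chi] integrates
   to zero because mixed derivatives commute, while a torsion strain does not. *)
Lemma relaxed_orth_torsion (v : R * R * R -> 'cV[R]_3) N (chi : field)
    (eta0 eta1 : R * R -> R) :
  L2field S chi -> relaxed_columns S v N ->
  eqf S chi (fun z => symp (colN (v z) (N z))) ->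
  test_section S eta0 -> test_section S eta1 ->
  'D_(dir2 0) eta1 =1 'D_(dir2 1) eta0 ->
  \int[leb3]_(z in cell S) (chi z 0 1 * eta1 z.1 - chi z 0 2 * eta0 z.1) = 0.
Proof.
move=> Lchi [hv [phi hN]] echi t0 t1 mixed.
have [jv1 Ev1] := hv 1 _ t1; have [jv2 Ev2] := hv 2 _ t0.
have [jN0 EN0] := hN 0 _ t1; have [jN1 EN1] := hN 1 _ t0.
have c0 := L2_cell_fst oS bS (test_section_continuous t0).
have c1 := L2_cell_fst oS bS (test_section_continuous t1).
have j0 := integrable_addr mC jN0 jv1; have j1 := integrable_addr mC jN1 jv2.
pose g z := 2^-1 * (N z 0 0 * eta1 z.1 + v z 1 0 * eta1 z.1) +
  (- 2^-1) * (N z 0 1 * eta0 z.1 + v z 2 0 * eta0 z.1).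
have k0 := integrable_scaler mC 2^-1 j0.
have k1 := integrable_scaler mC (- 2^-1) j1.
have jg : leb3.-integrable (cell S) (EFin \o g) := integrable_addr mC k0 k1.
transitivity (\int[leb3]_(z in cell S) g z).
  apply/esym/eq_ae_Rintegral => //.
    apply: measurable_funB; apply: measurable_funM.
    - by case: (Lchi 0 1).
    - by case: c1.
    - by case: (Lchi 0 2).
    - by case: c0.
  apply: ae_imp echi => z echi Cz; rewrite echi // /g.
  by case: (symp_colN (v z) (N z)) => _ -> ->; ring.
apply: etrans (Rintegral_lin mC 2^-1 (- 2^-1) j0 j1) _.
have I0 := etrans (RintegralD mC jN0 jv1) (etrans (congr2 +%R EN0 Ev1) (addr0 _)).
have I1 := etrans (RintegralD mC jN1 jv2) (etrans (congr2 +%R EN1 Ev2) (addr0 _)).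
apply: etrans (congr2 (fun x y : R => 2^-1 * x + - 2^-1 * y) I0 I1) _.
have -> : \int[leb3]_(z in cell S) (phi z * 'D_(dir2 0) eta1 z.1) =
    \int[leb3]_(z in cell S) (phi z * 'D_(dir2 1) eta0 z.1).
  by apply: eq_Rintegral => z _; rewrite mixed.
by ring.
Qed.

Lemma section_box : exists p r, 0 < r /\
  `[p.1 - r, p.1 + r]%classic `*` `[p.2 - r, p.2 + r]%classic `<=` S.
Proof.
have [p Sp] := S0.
have : nbhs p S by exact: open_nbhs_nbhs.
move=> /nbhs_ballP[e /= e0 eS]; exists p, (e / 2); split; first by rewrite divr_gt0.
move=> x [/= ]; rewrite !in_itv /= => /andP[h1 h2] /andP[h3 h4]; apply: eS.
by split; rewrite /ball /= ltr_norml; apply/andP; split; lra.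
Qed.

Lemma Rintegral_Estrain00 (K : M3) (a : R) (eta : R * R -> R) : skew_mx K ->
  continuous eta ->
  \int[leb3]_(z in cell S) (Estrain K a z 0 0 * eta z.1) =
  K 0 1 * \int[leb2]_(x in S) (x.1 * eta x) +
  K 0 2 * \int[leb2]_(x in S) (x.2 * eta x) + a * \int[leb2]_(x in S) eta x.
Proof.
move=> sK ce.
have mS := measurable_section oS; have fS := leb2_section_fin oS bS.
have L0 := L2_continuous_section oS bS ce.
have Lx : L2 leb2 S (fun x : R * R => x.1 * eta x).
  by apply: (L2_continuous_section oS bS) => x; apply: cvgM; [exact: cvg_fst|exact: ce].
have Ly : L2 leb2 S (fun x : R * R => x.2 * eta x).
  by apply: (L2_continuous_section oS bS) => x; apply: cvgM; [exact: cvg_snd|exact: ce].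
have jx := L2_integrable mS fS Lx; have jy := L2_integrable mS fS Ly.
have j0 := L2_integrable mS fS L0.
have LL : L2 leb2 S (fun x => (K 0 1 * (x.1 * eta x) + K 0 2 * (x.2 * eta x)) + a * eta x).
  by apply: (L2D mS); [exact: L2_lin|exact: L2Z].
have k1 := integrable_scaler mS (K 0 1) jx.
have k2 := integrable_scaler mS (K 0 2) jy.
have e1 := Rintegral_lin mS (K 0 1) (K 0 2) jx jy.
have e2 := RintegralD mS (integrable_addr mS k1 k2) (integrable_scaler mS a j0).
have e3 := RintegralZl a mS j0.
apply: etrans (etrans e2 (congr2 +%R e1 e3)).
apply: etrans (Rintegral_cell_fst oS bS LL); apply: eq_Rintegral => z _.
by case: (Estrain_entries a z sK) => -> _ _; ring.
Qed.

Lemma Rintegral_Estrain_torsion (K : M3) (a : R) (eta0 eta1 : R * R -> R) :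
  skew_mx K -> continuous eta0 -> continuous eta1 ->
  \int[leb3]_(z in cell S) (Estrain K a z 0 1 * eta1 z.1 - Estrain K a z 0 2 * eta0 z.1) =
  2^-1 * K 1 2 * (\int[leb2]_(x in S) (x.2 * eta1 x) +
    \int[leb2]_(x in S) (x.1 * eta0 x)).
Proof.
move=> sK c0 c1.
have mS := measurable_section oS; have fS := leb2_section_fin oS bS.
have Lx : L2 leb2 S (fun x : R * R => x.1 * eta0 x).
  by apply: (L2_continuous_section oS bS) => x; apply: cvgM; [exact: cvg_fst|exact: c0].
have Ly : L2 leb2 S (fun x : R * R => x.2 * eta1 x).
  by apply: (L2_continuous_section oS bS) => x; apply: cvgM; [exact: cvg_snd|exact: c1].
have jx := L2_integrable mS fS Lx; have jy := L2_integrable mS fS Ly.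
have LL : L2 leb2 S (fun x => 2^-1 * K 1 2 * (x.2 * eta1 x + x.1 * eta0 x)).
  by apply: (L2Z mS); exact: L2D.
rewrite -(RintegralD mS jy jx) -(RintegralZl _ mS (integrable_addr mS jy jx)).
rewrite -(Rintegral_cell_fst oS bS LL); apply: eq_Rintegral => z _.
by case: (Estrain_entries a z sK) => _ -> ->; ring.
Qed.

(** Here [m] is the mass of the bump, [n] the squared norm of the relaxed strain, [Ge], [G0], [G1]
    the squared norms of the bump and of its derivatives, and [X1], [X2] the first moments of the
    bump. The derivatives control k1 m and k2 m; then a m is what remains after subtracting k1 X1 +
    k2 X2, with a factor 3 for the square of three terms; k3 m is a difference of two integrals,
    with a factor 2. Doubling the k-part gives 2 + 4 = 6, and the summand 1 keeps the constant
    positive. *)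
Lemma coercive_algebra (a k1 k2 k3 m n Ge G0 G1 X1 X2 I1 I2 : R) :
  0 < m -> 0 <= Ge -> 0 <= G0 -> 0 <= G1 -> 0 <= n ->
  (k1 * - m + k2 * 0 + a * 0) ^+ 2 <= n * G0 ->
  (k1 * 0 + k2 * - m + a * 0) ^+ 2 <= n * G1 ->
  (k1 * X1 + k2 * X2 + a * m) ^+ 2 <= n * Ge ->
  I1 ^+ 2 <= n * G1 -> I2 ^+ 2 <= n * G0 -> I1 - I2 = - (k3 * m) ->
  m ^+ 2 * (a ^+ 2 + 2 * (k1 ^+ 2 + k2 ^+ 2 + k3 ^+ 2)) <=
  n * (1 + 3 * Ge + 3 * ((G0 * X1 ^+ 2 + G1 * X2 ^+ 2) / m ^+ 2) + 6 * (G0 + G1)).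
Proof.
move=> m0 e0 g0 g1 n0; rewrite !mulr0 !addr0 add0r !mulrN !sqrrN.
move=> h1 h2 he ht1 ht2 e.
have m2 : 0 < m ^+ 2 by rewrite exprn_gt0.
have h3 : (k3 * m) ^+ 2 <= 2 * (n * G0 + n * G1).
  by rewrite -sqrrN -e; have := sqr_ge0 (I1 + I2); nra.
have hX1 : (k1 * X1) ^+ 2 <= n * (G0 * X1 ^+ 2 / m ^+ 2).
  rewrite mulrA ler_pdivlMr // mulrA exprMn mulrAC -exprMn.
  by apply: ler_wpM2r => //; exact: sqr_ge0.
have hX2 : (k2 * X2) ^+ 2 <= n * (G1 * X2 ^+ 2 / m ^+ 2).
  rewrite mulrA ler_pdivlMr // mulrA exprMn mulrAC -exprMn.
  by apply: ler_wpM2r => //; exact: sqr_ge0.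
rewrite [(_ + _) / m ^+ 2]mulrDl.
move: (G0 * _ / _) (G1 * _ / _) hX1 hX2 => q1 q2 hX1 hX2.
have ha : (a * m) ^+ 2 <= 3 * (n * Ge + n * q1 + n * q2).
  move: hX1 hX2 he; move: (k1 * X1) (k2 * X2) (a * m) => x y w hx hy he.
  have -> : w = (x + y + w) - x - y by ring.
  move: (x + y + w) he => u he.
  by have := sqr_ge0 (u + x); have := sqr_ge0 (u + y); have := sqr_ge0 (x - y); nra.
have -> : m ^+ 2 * (a ^+ 2 + 2 * (k1 ^+ 2 + k2 ^+ 2 + k3 ^+ 2)) =
  (a * m) ^+ 2 + 2 * ((k1 * m) ^+ 2 + (k2 * m) ^+ 2 + (k3 * m) ^+ 2) by ring.
by rewrite !mulrDr mulr1; nra.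
Qed.

(** The constant precedes [gamma] because it is computed from a bump in [S] only. *)
Lemma strain_coercive : exists2 c : R, 0 < c &
  forall gamma K a chi, skew_mx K -> Hrel S gamma chi ->
  c * ((coords K a)^T *m coords K a) 0 0 <=
    \int[leb3]_(z in cell S) fnorm (Estrain K a z + chi z) ^+ 2.
Proof.
have [p [r [r0 box]]] := section_box.
pose eta := bump p r.
pose d0 := 'D_(dir2 0) eta; pose d1 := 'D_(dir2 1) eta.
have te : test_section S eta by exact: bump_test.
have t0 : test_section S d0 by exact: derive_test_section.
have t1 : test_section S d1 by exact: derive_test_section.
have ce := test_section_continuous te.
have c0 := test_section_continuous t0; have c1 := test_section_continuous t1.
have Le := L2_cell_fst oS bS ce.
have L0 := L2_cell_fst oS bS c0; have L1 := L2_cell_fst oS bS c1.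
pose m := bump_mass p r; have m0 : 0 < m by exact: bump_mass_gt0.
pose X1 := \int[leb2]_(x in S) (x.1 * eta x).
pose X2 := \int[leb2]_(x in S) (x.2 * eta x).
pose Ge := \int[leb3]_(z in cell S) (eta z.1 ^+ 2).
pose G0 := \int[leb3]_(z in cell S) (d0 z.1 ^+ 2).
pose G1 := \int[leb3]_(z in cell S) (d1 z.1 ^+ 2).
have Ge0 : 0 <= Ge by apply: Rintegral_ge0 => z _; exact: sqr_ge0.
have G00 : 0 <= G0 by apply: Rintegral_ge0 => z _; exact: sqr_ge0.
have G10 : 0 <= G1 by apply: Rintegral_ge0 => z _; exact: sqr_ge0.
have [E01 E02 E03] := Rintegral_dbump1 r0 box.
have [E11 E12 E13] := Rintegral_dbump2 r0 box.
have Eb := Rintegral_bump box.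
pose q := (G0 * X1 ^+ 2 + G1 * X2 ^+ 2) / m ^+ 2.
have q0 : 0 <= q.
  by rewrite divr_ge0 ?sqr_ge0 // addr_ge0 // mulr_ge0 // sqr_ge0.
pose C := 1 + 3 * Ge + 3 * q + 6 * (G0 + G1).
have C0 : 0 < C.
  apply: ltr_wpDr; first by apply: mulr_ge0 => //; exact: addr_ge0.
  apply: ltr_wpDr; first exact: mulr_ge0.
  by apply: ltr_wpDr => //; exact: mulr_ge0.
exists (m ^+ 2 / C); first by rewrite divr_gt0 // exprn_gt0.
move=> gamma K a chi sK Hchi.
have Lchi := Hsym_L2 (Hrel_Hsym Hchi).
have [v [N [vN echi]]] := Hrel_columns oS bS Hchi.
pose F z := Estrain K a z + chi z.
have LE := L2_Estrain K a.
have LF : L2field S F.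
  by move=> i j; have := L2D mC (LE i j) (Lchi i j); apply: L2_ext => z; rewrite [RHS]mxE.
pose n2 := \int[leb3]_(z in cell S) fnorm (F z) ^+ 2.
have jF : leb3.-integrable (cell S) (EFin \o (fun z => fnorm (F z) ^+ 2)).
  apply: (eq_integrable_real mC (f := fun z => \sum_i \sum_j F z i j ^+ 2)).
    by move=> z _; rewrite fnorm_sqr.
  by apply: integrable_sumr => // i; apply: integrable_sumr => // j; case: (LF i j).
have n20 : 0 <= n2 by apply: Rintegral_ge0 => z _; exact: sqr_ge0.
have entry i j : \int[leb3]_(z in cell S) F z i j ^+ 2 <= n2.
  apply: le_Rintegral => //; first by case: (LF i j).
  by move=> z _; exact: entry_le_fnorm.
have CS i j (g : R * R * R -> R) : L2 leb3 (cell S) g ->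
    (\int[leb3]_(z in cell S) (F z i j * g z)) ^+ 2 <=
    n2 * \int[leb3]_(z in cell S) g z ^+ 2.
  move=> Lg; apply: le_trans (L2_Cauchy_Schwarz mC (LF i j) Lg) _.
  by apply: ler_wpM2r; [apply: Rintegral_ge0 => z _; exact: sqr_ge0|exact: entry].
have F00 (h : R * R -> R) : test_section S h ->
    \int[leb3]_(z in cell S) (F z 0 0 * h z.1) =
    \int[leb3]_(z in cell S) (Estrain K a z 0 0 * h z.1).
  move=> th; have Lh := L2_cell_fst oS bS (test_section_continuous th).
  have jE := L2_mul_integrable mC (LE 0 0) Lh.
  have jc := L2_mul_integrable mC (Lchi 0 0) Lh.
  rewrite -[RHS]addr0 -(relaxed_orth Lchi vN echi th) -(RintegralD mC jE jc).
  by apply: eq_Rintegral => z _; rewrite mxE mulrDl.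
have FT : \int[leb3]_(z in cell S) (F z 0 1 * d1 z.1) -
    \int[leb3]_(z in cell S) (F z 0 2 * d0 z.1) = - (K 1 2 * m).
  have jF1 := L2_mul_integrable mC (LF 0 1) L1.
  have jF2 := L2_mul_integrable mC (LF 0 2) L0.
  have jE1 := L2_mul_integrable mC (LE 0 1) L1.
  have jE2 := L2_mul_integrable mC (LE 0 2) L0.
  have jc1 := L2_mul_integrable mC (Lchi 0 1) L1.
  have jc2 := L2_mul_integrable mC (Lchi 0 2) L0.
  have jE := integrableB mC jE1 jE2; have jc := integrableB mC jc1 jc2.
  (* Both first moments equal -m, which compensates the factor 1/2 of the symmetrisation. *)
  have -> : - (K 1 2 * m) =
    \int[leb3]_(z in cell S) (Estrain K a z 0 1 * d1 z.1 - Estrain K a z 0 2 * d0 z.1).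
    rewrite Rintegral_Estrain_torsion //.
    by rewrite [X in _ * (X + _)]E13 [X in _ * (_ + X)]E02 -/m; field.
  rewrite -[RHS]addr0 -(RintegralB mC jF1 jF2).
  rewrite -(relaxed_orth_torsion Lchi vN echi t0 t1 (bump_mixed_derivative p r)).
  rewrite -(RintegralD mC jE jc).
  by apply: eq_Rintegral => z _; rewrite !mxE -/d0 -/d1; ring.
have value (h : R * R -> R) x1 x2 x0 (th : test_section S h) :
    \int[leb2]_(x in S) (x.1 * h x) = x1 -> \int[leb2]_(x in S) (x.2 * h x) = x2 ->
    \int[leb2]_(x in S) h x = x0 ->
    \int[leb3]_(z in cell S) (F z 0 0 * h z.1) = K 0 1 * x1 + K 0 2 * x2 + a * x0.
  move=> <- <- <-.
  exact: etrans (F00 _ th) (Rintegral_Estrain00 a sK (test_section_continuous th)).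
have H0 : (K 0 1 * - m + K 0 2 * 0 + a * 0) ^+ 2 <= n2 * G0.
  by rewrite -(value d0 _ _ _ t0 E02 E03 E01); exact: CS 0 0 _ L0.
have H1 : (K 0 1 * 0 + K 0 2 * - m + a * 0) ^+ 2 <= n2 * G1.
  by rewrite -(value d1 _ _ _ t1 E12 E13 E11); exact: CS 0 0 _ L1.
have He : (K 0 1 * X1 + K 0 2 * X2 + a * m) ^+ 2 <= n2 * Ge.
  by rewrite -(value eta _ _ _ te erefl erefl Eb); exact: CS 0 0 _ Le.
have HT1 := CS 0 1 _ L1; have HT2 := CS 0 2 _ L0.
rewrite coords_sqr // -/n2 mulrAC ler_pdivrMr // mulrC.
have := coercive_algebra m0 Ge0 G00 G10 n20 H0 H1 He HT1 HT2 FT.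
by rewrite mulrC.
Qed.

End Coercivity.

(** * The scalar product of a fixed material *)

Section CompletedMeasure.
Context (R : realType).
Local Notation mR := (measurableTypeR R).
Local Notation T3 := (mR * mR * mR)%type.
Local Notation L3 := (@lpoint R).

Lemma measurable_lpoint (A : set T3) : measurable A -> measurable (A : set L3).
Proof. exact: caratheodory_measurable_mu_ext. Qed.

Lemma cleb3E (A : set T3) : measurable A -> cleb3 (A : set L3) = leb3 A.
Proof. exact: measurable_mu_extE. Qed.

Lemma measurable_fun_lpoint (D : set T3) (f : T3 -> R) :
  measurable_fun D f -> measurable D -> measurable_fun (D : set L3) (f : L3 -> R).
Proof. by move=> mf mD _ A mA; apply: measurable_lpoint; exact: mf. Qed.

Lemma ae_lpoint (P : T3 -> Prop) : {ae leb3, forall z, P z} ->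
  {ae cleb3, forall z : L3, P z}.
Proof.
move=> [A [mA A0 sA]]; exists (A : set L3); split => //.
  exact: measurable_lpoint.
by rewrite cleb3E.
Qed.

Let toT3 : L3 -> T3 := id.

Let mtoT3 : measurable_fun [set: L3] toT3.
Proof. by move=> _ A mA; rewrite setTI; exact: measurable_lpoint. Qed.

(** The identity, as a measurable map from [lpoint] to the Borel space, pushes [cleb3] forward to
    [leb3]; this is its change of variables. *)
Lemma ge0_integral_lpoint (D : set T3) (f : T3 -> \bar R) :
  measurable D -> measurable_fun D f -> (forall z, D z -> (0 <= f z)%E) ->
  (\int[cleb3]_(z in (D : set L3)) f z = \int[leb3]_(z in D) f z)%E.
Proof.
move=> mD mf f0.
have := ge0_integral_pushforward mtoT3 cleb3 mD mf (fun z Dz => f0 z (set_mem Dz)).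
move=> <-; apply: eq_measure_integral => A mA _.
by rewrite /pushforward /= cleb3E.
Qed.

Lemma integrable_lpoint (D : set T3) (f : T3 -> R) : measurable D ->
  leb3.-integrable D (EFin \o f) -> cleb3.-integrable (D : set L3) (EFin \o f).
Proof.
move=> mD /integrableP[mf jf]; apply/integrableP; split.
  by apply/measurable_EFinP/measurable_fun_lpoint => //; exact/measurable_EFinP.
rewrite ge0_integral_lpoint //.
by apply/measurable_EFinP; apply: measurableT_comp => //; exact/measurable_EFinP.
Qed.

Lemma ge0_Rintegral_lpoint (D : set T3) (f : T3 -> R) : measurable D ->
  measurable_fun D f -> (forall z, D z -> 0 <= f z) ->
  \int[cleb3]_(z in (D : set L3)) f z = \int[leb3]_(z in D) f z.
Proof.
move=> mD mf f0; congr fine; apply: ge0_integral_lpoint => //.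
exact/measurable_EFinP.
Qed.

End CompletedMeasure.

(** * Pointwise properties of the quadratic form *)

Section QuadraticForm.
Context (R : realType).
Local Notation M3 := 'M[R]_3.
Variable q : M3 -> R.
Hypothesis qq : quadratic_form q.

Lemma polar_sym F G : polar q F G = polar q G F.
Proof. by rewrite /polar (addrC F) addrAC. Qed.

Lemma polar_linr a b F G H :
  polar q H (a *: F + b *: G) = a * polar q H F + b * polar q H G.
Proof.
have lin := qq.2 H; rewrite lin.
have := lin b G 0; rewrite addr0 => ->.
have h0 : polar q H 0 = 0.
  have := lin 1 0 0; rewrite scaler0 addr0 scale1r => /eqP.
  by rewrite -subr_eq0 opprD addrA subrr add0r oppr_eq0 => /eqP.
by rewrite h0 addr0.
Qed.

Lemma polar_linl a b F G H :
  polar q (a *: F + b *: G) H = a * polar q F H + b * polar q G H.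
Proof. by rewrite polar_sym polar_linr !(polar_sym H). Qed.

Lemma polar_diag F : polar q F F = q F.
Proof.
rewrite /polar; have -> : F + F = 2 *: F by rewrite scaler_nat mulr2n.
by rewrite qq.1; field.
Qed.

Lemma polar0r F : polar q F 0 = 0.
Proof. by have := polar_linr 0 0 0 0 F; rewrite !scale0r addr0 !mul0r addr0. Qed.

Lemma polar_sumr (I : Type) (s : seq I) (h : I -> M3) F :
  polar q F (\sum_(i <- s) h i) = \sum_(i <- s) polar q F (h i).
Proof.
elim: s => [|i s IH]; first by rewrite !big_nil polar0r.
rewrite !big_cons -IH; have := polar_linr 1 1 (h i) (\sum_(j <- s) h j) F.
by rewrite !scale1r !mul1r.
Qed.

(** Measurability of the form is assumed for constant matrices only; this expansion transfers it to
    pairs of measurable fields. *)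
Lemma polarE F G : polar q F G =
  \sum_i \sum_j \sum_k \sum_l
    F i j * G k l * polar q (delta_mx i j) (delta_mx k l).
Proof.
have Z a X Z : polar q X (a *: Z) = a * polar q X Z.
  by have := polar_linr a 0 Z 0 X; rewrite scale0r addr0 mul0r addr0.
have half X H : polar q X H = \sum_k \sum_l H k l * polar q X (delta_mx k l).
  rewrite [in LHS](matrix_sum_delta H) polar_sumr; apply: eq_bigr => k _.
  by rewrite polar_sumr; apply: eq_bigr => l _; rewrite Z.
rewrite polar_sym half; apply: eq_bigr => i _; apply: eq_bigr => j _.
rewrite polar_sym half mulr_sumr; apply: eq_bigr => k _.
by rewrite mulr_sumr; apply: eq_bigr => l _; rewrite mulrA.
Qed.

Variables (alpha beta : R).
Hypothesis alpha0 : 0 < alpha.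
Hypothesis bounds : forall G,
  alpha * fnorm (symp G) ^+ 2 <= q G <= beta * fnorm (symp G) ^+ 2.

Lemma form_ge0 G : 0 <= q G.
Proof.
have /andP[h _] := bounds G; apply: le_trans h.
by rewrite mulr_ge0 ?sqr_ge0 // ltW.
Qed.

(** Nonnegativity of [q] at [F + G] and [F - G]. It dominates the integrand of the scalar
    product. *)
Lemma polar_le F G : `|polar q F G| <= 2^-1 * (q F + q G).
Proof.
have h1 := form_ge0 (F + G).
have h2 := form_ge0 (1 *: F + (-1) *: G).
have E1 : q (F + G) = q F + 2 * polar q F G + q G by rewrite /polar; field.
have E2 : q (1 *: F + (-1) *: G) = q F - 2 * polar q F G + q G.
  rewrite -[LHS]polar_diag polar_linl !polar_linr !polar_diag (polar_sym G F).
  by ring.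
by rewrite ler_norml; apply/andP; split; lra.
Qed.

(** The upper bound makes [q] vanish at [W], and by Cauchy-Schwarz a null vector of a nonnegative
    form lies in its radical. *)
Lemma polar_skew W G : symp W = 0 -> polar q W G = 0.
Proof.
move=> sW.
have qW : q W = 0.
  have := bounds W; rewrite sW /fnorm /frob mulmx0 mxtrace0 sqrtr0 expr0n /= !mulr0.
  by move=> h; apply/eqP; rewrite eq_le andbC.
apply/eqP; rewrite -sqrf_eq0 eq_le sqr_ge0 andbT.
have CS := @form_Cauchy_Schwarz _ _ setT (polar q) (fun _ _ _ _ _ _ => I)
  polar_sym (fun a c u v w _ _ _ => polar_linl a c u v w).
have /(_ _ W G I I) := CS _.
rewrite !polar_diag qW mul0r; apply => u _.
by rewrite polar_diag form_ge0.
Qed.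

End QuadraticForm.

Section ScalarProduct.
Context (R : realType) (S : set (R * R)).
Hypothesis oS : open S.
Local Notation mR := (measurableTypeR R).
Local Notation T3 := (mR * mR * mR)%type.
Local Notation L3 := (@lpoint R).
Local Notation M3 := 'M[R]_3.
Local Notation field := (R * R * R -> M3).

Let mC := measurable_cell oS.
Let mCL : measurable (cell S : set L3) := measurable_lpoint mC.

Definition norm2 (F : field) : R := \int[leb3]_(z in cell S) fnorm (F z) ^+ 2.

Lemma fnorm_symp (F : M3) : fnorm (symp F) ^+ 2 <= fnorm F ^+ 2.
Proof.
(* After symmetrising the double sum the comparison holds entry by entry, by convexity of the
   square. *)
have E : fnorm F ^+ 2 = \sum_i \sum_j 2^-1 * (F i j ^+ 2 + F j i ^+ 2).
  rewrite fnorm_sqr.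
  under [RHS]eq_bigr do under eq_bigr do rewrite mulrDr.
  under [RHS]eq_bigr do rewrite big_split /=.
  rewrite big_split /= [X in _ + X]exchange_big /= -big_split /=.
  apply: eq_bigr => i _; rewrite -big_split /=; apply: eq_bigr => j _.
  by field.
rewrite E fnorm_sqr; apply: ler_sum => i _; apply: ler_sum => j _.
by rewrite sympE; have := sqr_ge0 (F i j - F j i); nra.
Qed.

Lemma integrable_fnorm (F : field) : L2field S F ->
  leb3.-integrable (cell S) (EFin \o (fun z => fnorm (F z) ^+ 2)).
Proof.
move=> LF; apply: (eq_integrable_real mC (f := fun z => \sum_i \sum_j F z i j ^+ 2)).
  by move=> z _; rewrite fnorm_sqr.
by apply: integrable_sumr => // i; apply: integrable_sumr => // j; case: (LF i j).
Qed.

Lemma L2field_symp (F : field) : L2field S F -> L2field S (fun z => symp (F z)).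
Proof.
move=> LF i j; have := L2Z mC 2^-1 (L2D mC (LF i j) (LF j i)).
by apply: L2_ext => z; rewrite sympE.
Qed.

Lemma norm2_ge0 F : 0 <= norm2 F.
Proof. by apply: Rintegral_ge0 => z _; exact: sqr_ge0. Qed.

Lemma norm2_symp F : L2field S F -> norm2 (fun z => symp (F z)) <= norm2 F.
Proof.
move=> LF; apply: le_Rintegral => //.
- exact: integrable_fnorm (L2field_symp LF).
- exact: integrable_fnorm.
- by move=> z _; exact: fnorm_symp.
Qed.

Lemma norm2_entry F i j : L2field S F ->
  \int[leb3]_(z in cell S) F z i j ^+ 2 <= norm2 F.
Proof.
move=> LF; apply: le_Rintegral => //; first by case: (LF i j).
  exact: integrable_fnorm.
by move=> z _; exact: entry_le_fnorm.
Qed.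

Lemma norm2_eq_symp F : Hsym S F -> norm2 (fun z => symp (F z)) = norm2 F.
Proof.
move=> [LF sF]; apply/eq_ae_Rintegral => //.
- exact: integrable_fnorm (L2field_symp LF).
- by have /integrableP[/measurable_EFinP] := integrable_fnorm LF.
- apply: ae_imp sF => z sF Cz; congr (fnorm _ ^+ 2).
  apply/matrixP => i j; rewrite sympE.
  by have /matrixP /(_ i j) := sF Cz; rewrite mxE => ->; field.
Qed.

Lemma norm2_eq0 F : L2field S F -> norm2 F = 0 -> eqf S F 0.
Proof.
move=> LF n0.
have := ae_eq0_Rintegral mC (integrable_fnorm LF) (fun z _ => sqr_ge0 _) n0.
apply: ae_imp => z h Cz; have /eqP := h Cz; rewrite sqrf_eq0 => /eqP f0.
apply/matrixP => i j; rewrite [RHS]mxE.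
apply/eqP; rewrite -sqrf_eq0 eq_le sqr_ge0 andbT.
by apply: le_trans (entry_le_fnorm (F z) i j) _; rewrite f0 expr0n.
Qed.

Variable q : R * R * R -> M3 -> R.
Hypothesis Hq : forall z, S z.1 -> quadratic_form (q z).
Hypothesis mq : forall G,
  measurable_fun ([set z | S z.1] : set L3) (fun z : L3 => q z G).
Variables alpha beta : R.
Hypothesis alpha0 : 0 < alpha.
Hypothesis bq : {ae leb3, forall z, S z.1 -> forall G,
  alpha * fnorm (symp G) ^+ 2 <= q z G <= beta * fnorm (symp G) ^+ 2}.

Let measurable_fun_sum (I : Type) (s : seq I) (h : I -> L3 -> R) :
  (forall i, measurable_fun (cell S : set L3) (h i)) ->
  measurable_fun (cell S : set L3) (fun z => \sum_(i <- s) h i z).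
Proof.
move=> mh; elim: s => [|i s IH].
  by under eq_fun do rewrite big_nil; exact: measurable_cst.
by under eq_fun do rewrite big_cons; exact: measurable_funD.
Qed.

Lemma measurable_cylinder : measurable ([set z | S z.1] : set L3).
Proof.
apply: measurable_lpoint.
rewrite (_ : [set z | S z.1] = S `*` setT :> set T3); last first.
  by apply/seteqP; split => z //= -[].
by apply: measurableX => //; exact: measurable_section.
Qed.

Lemma measurable_polar_cst F G :
  measurable_fun (cell S : set L3) (fun z : L3 => polar (q z) F G).
Proof.
apply: (measurable_funS measurable_cylinder).
- by move=> z [].
- rewrite /polar; apply: measurable_funM; first exact: measurable_cst.
  exact: (measurable_funB (measurable_funB (mq _) (mq _)) (mq _)).
Qed.

Lemma measurable_polar (F G : field) : L2field S F -> L2field S G ->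
  measurable_fun (cell S : set L3) (fun z : L3 => polar (q z) (F z) (G z)).
Proof.
move=> LF LG.
apply: (@eq_measurable_fun _ _ _ _ _ (fun z : L3 => \sum_i \sum_j \sum_k \sum_l
    F z i j * G z k l * polar (q z) (delta_mx i j) (delta_mx k l))).
  by move=> z /set_mem [Sz _]; rewrite [RHS](polarE (Hq Sz)).
apply: measurable_fun_sum => i; apply: measurable_fun_sum => j.
apply: measurable_fun_sum => k; apply: measurable_fun_sum => l.
have mF := measurable_fun_lpoint (LF i j).1 mC.
have mG := measurable_fun_lpoint (LG k l).1 mC.
exact: (measurable_funM (measurable_funM mF mG) (measurable_polar_cst _ _)).
Qed.

Let bqL : {ae cleb3, forall z : L3, S z.1 -> forall G,
  alpha * fnorm (symp G) ^+ 2 <= q z G <= beta * fnorm (symp G) ^+ 2}.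
Proof. exact: ae_lpoint bq. Qed.

Lemma integrable_polar (F G : field) : L2field S F -> L2field S G ->
  cleb3.-integrable (cell S : set L3) (EFin \o (fun z => polar (q z) (F z) (G z))).
Proof.
move=> LF LG.
have jF := integrable_lpoint mC (integrable_fnorm (L2field_symp LF)).
have jG := integrable_lpoint mC (integrable_fnorm (L2field_symp LG)).
apply: (integrable_ae_dominated mCL (measurable_polar LF LG)
  (integrable_scaler mCL (2^-1 * beta) (integrable_addr mCL jF jG))).
apply: ae_imp bqL => z b [Sz _].
apply: le_trans (polar_le (Hq Sz) alpha0 (b Sz) (F z) (G z)) _.
have /andP[_ hF] := b Sz (F z); have /andP[_ hG] := b Sz (G z).
by rewrite -mulrA ler_pM2l ?invr_gt0 // mulrDr lerD.
Qed.

Lemma ip_sym F G : ip S q F G = ip S q G F.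
Proof. by apply: eq_Rintegral => z _; exact: polar_sym. Qed.

Lemma ip_lin a b F G H : L2field S F -> L2field S G -> L2field S H ->
  ip S q (a *: F + b *: G) H = a * ip S q F H + b * ip S q G H.
Proof.
move=> LF LG LH.
apply: etrans (Rintegral_lin mCL a b (integrable_polar LF LH) (integrable_polar LG LH)).
by apply: eq_Rintegral => z /set_mem [Sz _]; exact: (polar_linl (Hq Sz) a b (F z) (G z) (H z)).
Qed.

Lemma ip_bounds F : L2field S F ->
  alpha * norm2 (fun z => symp (F z)) <= ip S q F F <=
  beta * norm2 (fun z => symp (F z)).
Proof.
move=> LF; have j := integrable_fnorm (L2field_symp LF).
have jL := integrable_lpoint mC j.
have <- : \int[cleb3]_(z in (cell S : set L3)) fnorm (symp (F z)) ^+ 2 =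
    norm2 (fun z => symp (F z)).
  apply: ge0_Rintegral_lpoint => //; last by move=> z _; exact: sqr_ge0.
  by have /integrableP[/measurable_EFinP] := j.
rewrite -(RintegralZl alpha mCL jL) -(RintegralZl beta mCL jL).
have jq := integrable_polar LF LF.
apply/andP; split; apply: (le_ae_Rintegral mCL) => //; try exact: integrable_scaler.
- apply: ae_imp bqL => z b [Sz _]; rewrite polar_diag; last exact: Hq.
  by have /andP[] := b Sz (F z).
- apply: ae_imp bqL => z b [Sz _]; rewrite polar_diag; last exact: Hq.
  by have /andP[] := b Sz (F z).
Qed.

Lemma ip_ge0 F : L2field S F -> 0 <= ip S q F F.
Proof.
move=> LF; have /andP[h _] := ip_bounds LF; apply: le_trans h.
by rewrite mulr_ge0 ?norm2_ge0 // ltW.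
Qed.

Lemma ip_coercive F : Hsym S F -> alpha * norm2 F <= ip S q F F.
Proof.
move=> HF; have /andP[h _] := ip_bounds (Hsym_L2 HF).
by rewrite norm2_eq_symp in h.
Qed.

(** Reconciles the vector [bvec], built from the prestrain, with the projection, taken of its
    symmetric part. *)
Lemma ip_symp B G : L2field S B -> L2field S G ->
  ip S q (fun z => symp (B z)) G = ip S q B G.
Proof.
move=> LB LG.
apply: (eq_ae_Rintegral mCL (integrable_polar (L2field_symp LB) LG)
  (measurable_polar LB LG)).
apply: ae_imp bqL => z b [Sz _].
have : polar (q z) (1 *: B z + (-1) *: symp (B z)) (G z) = 0.
  apply: (polar_skew (Hq Sz) alpha0 (b Sz)).
  by apply/matrixP => i j; rewrite /symp !mxE; field.
by rewrite (polar_linl (Hq Sz)) mul1r mulN1r => /eqP; rewrite subr_eq0 => /eqP.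
Qed.

Lemma ip_quadratic F : \int[cleb3]_(z in (cell S : set L3)) q z (F z) = ip S q F F.
Proof.
by apply: eq_Rintegral => z /set_mem [Sz _]; rewrite polar_diag //; exact: Hq.
Qed.

End ScalarProduct.

(** * Correctors and the averaging matrix *)

Section StrainBasis.
Context (R : realType).
Local Notation M3 := 'M[R]_3.
Local Notation field := (R * R * R -> M3).

Lemma ord3_cases (P : 'I_3 -> Prop) : P 0 -> P 1 -> P 2 -> forall i, P i.
Proof.
move=> p0 p1 p2 i; have [->|->|->] : [\/ i = 0, i = 1 | i = 2] by
  case: i => [[|[|[|//]]] h]; [apply: Or31|apply: Or32|apply: Or33]; apply/val_inj.
all: by [].
Qed.

Lemma ord4_cases (P : 'I_4 -> Prop) :
  P 0 -> P 1 -> P 2 -> P 3 -> forall i, P i.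
Proof.
move=> p0 p1 p2 p3 i.
have [->|->|->|->] : [\/ i = 0, i = 1, i = 2 | i = 3] by
  case: i => [[|[|[|[|//]]]] h]; [apply: Or41|apply: Or42|apply: Or43|apply: Or44];
  apply/val_inj.
all: by [].
Qed.

Lemma sum_ord4 (V : zmodType) (f : 'I_4 -> V) :
  \sum_i f i = f 0 + f 1 + f 2 + f 3.
Proof.
rewrite !big_ord_recl big_ord0 addr0 !addrA.
rewrite (_ : lift ord0 ord0 = 1 :> 'I_4); last exact/val_inj.
rewrite (_ : lift ord0 (lift ord0 ord0) = 2 :> 'I_4); last exact/val_inj.
by rewrite (_ : lift ord0 (lift ord0 (lift ord0 ord0)) = 3 :> 'I_4); last exact/val_inj.
Qed.

(** Together with [k 0 0] for the stretch, this inverts [coords]; it turns statements about pairs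
    (K, a) into statements about all of R^4. *)
Definition skew_of (k : 'cV[R]_4) : M3 := k 1 0 *: K2 + k 2 0 *: K3 + k 3 0 *: K4.

Lemma skew_ofE (k : 'cV[R]_4) i j : skew_of k i j = (Num.sqrt 2)^-1 *
  (k 1 0 * (((i == 1) && (j == 0))%:R - ((i == 0) && (j == 1))%:R) +
   k 2 0 * (((i == 2) && (j == 0))%:R - ((i == 0) && (j == 2))%:R) +
   k 3 0 * (((i == 2) && (j == 1))%:R - ((i == 1) && (j == 2))%:R)).
Proof.
have T (p r : 'I_3) : tensor (delta_mx p 0) (delta_mx r 0) i j =
    ((i == p) && (j == r))%:R :> R.
  by rewrite /tensor trmx_delta mul_delta_mx mxE.
have D (A B : M3) : (A + B) i j = A i j + B i j by rewrite mxE.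
have Z (c : R) (A : M3) : (c *: A) i j = c * A i j by rewrite mxE.
have N (A B : M3) : (A - B) i j = A i j - B i j by rewrite !mxE.
rewrite /skew_of /K2 /K3 /K4 /e1 /e2 /e3 !D !Z !N !T.
by ring.
Qed.

Lemma skew_of_skew (k : 'cV[R]_4) : skew_mx (skew_of k).
Proof.
apply/matrixP => i j; rewrite mxE [RHS]mxE !skew_ofE.
by move: j; apply: ord3_cases; move: i; apply: ord3_cases => /=; ring.
Qed.

Lemma skew_of_coords (K : M3) (a : R) : skew_mx K -> K = skew_of (coords K a).
Proof.
move=> sK; have [_ h1 h2 h3] := coordsE a sK; have s2 := sqrt2_neq0 R.
have K0 i j := skew_entry i j sK.
have Kd i : K i i = 0 by have := K0 i i; move: (K i i) => k; lra.
apply/matrixP => i j; rewrite skew_ofE h1 h2 h3.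
move: j; apply: ord3_cases; move: i; apply: ord3_cases => /=;
  rewrite ?Kd ?(K0 0 1) ?(K0 0 2) ?(K0 1 2); by field.
Qed.

Lemma coords_skew_of (k : 'cV[R]_4) : coords (skew_of k) (k 0 0) = k.
Proof.
have [h0 h1 h2 h3] := coordsE (k 0 0) (skew_of_skew k); have s2 := sqrt2_neq0 R.
apply/matrixP => i j; rewrite ord1; move: i; apply: ord4_cases.
- by rewrite h0.
- by rewrite h1 skew_ofE /=; field.
- by rewrite h2 skew_ofE /=; field.
- by rewrite h3 skew_ofE /=; field.
Qed.

Lemma Estrain_lin (b c : R) (K K' : M3) (a a' : R) :
  Estrain (b *: K + c *: K') (b * a + c * a') =
  b *: Estrain K a + c *: Estrain K' a' :> field.
Proof.
apply/funext => z; rewrite -[RHS]/(b *: Estrain K a z + c *: Estrain K' a' z).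
rewrite /Estrain -sympD; congr symp; rewrite /tensor !scalemxAl -mulmxDl.
by congr (_ *m _); rewrite mulmxDl -!scalemxAl scalerDl !scalerDr !scalerA addrACA.
Qed.

Lemma EbE i : Eb i = Estrain (Kb i) (i == 0)%:R :> field.
Proof.
rewrite /Eb; case: eqP => [->|//].
by rewrite /Kb.
Qed.

Lemma Kb_skew i : skew_mx (Kb i : M3).
Proof.
have h k : skew_mx (skew_of (delta_mx k 0)) by exact: skew_of_skew.
have E (k : 'I_4) : skew_of (delta_mx k 0) = (k == 1)%:R *: K2 + (k == 2)%:R *: K3 + (k == 3)%:R *: K4 :> M3.
  by rewrite /skew_of !mxE /= !andbT ![_ == k]eq_sym.
move: i; apply: ord4_cases.
- by rewrite /skew_mx /Kb /= trmx0 oppr0.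
- by have := h 1; rewrite E /= !scale0r !addr0 scale1r.
- by have := h 2; rewrite E /= !scale0r add0r addr0 scale1r.
- by have := h 3; rewrite E /= !scale0r !add0r scale1r.
Qed.

Lemma Estrain_coords (K : M3) (a : R) : skew_mx K ->
  Estrain K a = \sum_i coords K a i 0 *: Eb i :> field.
Proof.
move=> sK; have EK := skew_of_coords a sK; have [h0 _ _ _] := coordsE a sK.
rewrite sum_ord4 !EbE /= h0.
have add K1 K2' a1 a2 : Estrain K1 a1 + Estrain K2' a2 = Estrain (K1 + K2') (a1 + a2) :> field.
  by have := Estrain_lin 1 1 K1 K2' a1 a2; rewrite !scale1r !mul1r => ->.
have scale c K1 a1 : c *: Estrain K1 a1 = Estrain (c *: K1) (c * a1) :> field.
  by have := Estrain_lin c 0 K1 0 a1 0; rewrite !scale0r !mul0r !addr0 => ->.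
rewrite !scale !add !mulr0 !addr0 mulr1; congr Estrain.
by rewrite {1}EK /skew_of /Kb /= scaler0 add0r.
Qed.

End StrainBasis.

Section FixedMaterial.
Context (R : realType) (S : set (R * R)).
Hypothesis oS : open S.
Hypothesis bS : bounded_set S.
Local Notation L3 := (@lpoint R).
Local Notation M3 := 'M[R]_3.
Local Notation field := (R * R * R -> M3).
Variable q : R * R * R -> M3 -> R.
Hypothesis Hq : forall z, S z.1 -> quadratic_form (q z).
Hypothesis mq : forall G,
  measurable_fun ([set z | S z.1] : set L3) (fun z : L3 => q z G).
Variables alpha beta : R.
Hypothesis alpha0 : 0 < alpha.
Hypothesis alpha_beta : alpha <= beta.
Hypothesis bq : {ae leb3, forall z, S z.1 -> forall G,
  alpha * fnorm (symp G) ^+ 2 <= q z G <= beta * fnorm (symp G) ^+ 2}.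
Variable gamma : \bar R.
Hypothesis gamma0 : (0 <= gamma)%E.

Let mC := measurable_cell oS.
Let fC := leb3_cell_fin oS bS.
Let L := L2field S.
Let H := Hrel S gamma.
Let HL : H `<=` L := fun F h => Hsym_L2 (Hrel_Hsym h).
Let L_lin a c F G : L F -> L G -> L (a *: F + c *: G) :=
  @L2field_lin R S oS a c F G.
Let H_lin a c F G : H F -> H G -> H (a *: F + c *: G) :=
  @Hrel_lin R S oS bS gamma a c F G.
Let ipl a c F G K : L F -> L G -> L K ->
  ip S q (a *: F + c *: G) K = a * ip S q F K + c * ip S q G K :=
  @ip_lin R S oS q Hq mq alpha beta alpha0 bq a c F G K.
Let ips := @ip_sym R S q.
Let ip0 F : L F -> 0 <= ip S q F F := @ip_ge0 R S oS q Hq mq alpha beta alpha0 bq F.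

Let LD F G : L F -> L G -> L (F + G).
Proof. by move=> LF LG; have := L_lin 1 1 LF LG; rewrite !scale1r. Qed.

Let LB F G : L F -> L G -> L (F - G).
Proof. by move=> LF LG; have := L_lin 1 (-1) LF LG; rewrite scale1r scaleN1r. Qed.

Let HB F G : H F -> H G -> H (F - G).
Proof. by move=> HF HG; have := H_lin 1 (-1) HF HG; rewrite scale1r scaleN1r. Qed.

Lemma ipDl F G K : L F -> L G -> L K -> ip S q (F + G) K = ip S q F K + ip S q G K.
Proof.
by move=> LF LG LK; have := ipl 1 1 LF LG LK; rewrite !scale1r !mul1r.
Qed.

Lemma ipBl F G K : L F -> L G -> L K -> ip S q (F - G) K = ip S q F K - ip S q G K.
Proof.
move=> LF LG LK; have := ipl 1 (-1) LF LG LK.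
by rewrite scale1r scaleN1r mul1r mulN1r.
Qed.

Lemma L2field0 : L 0.
Proof. exact/HL/Hrel_0. Qed.

Lemma L2field_sum (I : Type) (s : seq I) (h : I -> field) (k : I -> R) :
  (forall i, L (h i)) -> L (\sum_(i <- s) k i *: h i).
Proof.
move=> Lh; elim: s => [|i s IH]; first by rewrite big_nil; exact: L2field0.
by rewrite big_cons; have := L_lin (k i) 1 (Lh i) IH; rewrite scale1r.
Qed.

Lemma Hrel_sum (I : Type) (s : seq I) (h : I -> field) (k : I -> R) :
  (forall i, H (h i)) -> H (\sum_(i <- s) k i *: h i).
Proof.
move=> Hh; elim: s => [|i s IH]; first by rewrite big_nil; exact: Hrel_0.
by rewrite big_cons; have := H_lin (k i) 1 (Hh i) IH; rewrite scale1r.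
Qed.

Lemma ip0l F : L F -> ip S q 0 F = 0.
Proof.
move=> LF; have := ipl 0 0 L2field0 L2field0 LF.
by rewrite !scale0r addr0 !mul0r addr0.
Qed.

Lemma ip_suml (I : Type) (s : seq I) (h : I -> field) (k : I -> R) F :
  (forall i, L (h i)) -> L F ->
  ip S q (\sum_(i <- s) k i *: h i) F = \sum_(i <- s) k i * ip S q (h i) F.
Proof.
move=> Lh LF; elim: s => [|i s IH]; first by rewrite !big_nil ip0l.
rewrite !big_cons -IH; have := ipl (k i) 1 (Lh i) (L2field_sum s k Lh) LF.
by rewrite scale1r mul1r.
Qed.

Lemma Hsym_Estrain (K : M3) (a : R) : Hsym S (Estrain K a).
Proof.
split; first exact: L2_Estrain.
by apply: ae_all => z _; apply/matrixP => i j; rewrite mxE !sympE addrC.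
Qed.

Lemma L2_Eb i : L (Eb i).
Proof. by rewrite EbE; exact: L2_Estrain. Qed.

Lemma ip_upper F : L F -> ip S q F F <= beta * norm2 S F.
Proof.
move=> LF; have /andP[_ h] := ip_bounds oS Hq mq alpha0 bq LF.
apply: le_trans h _; apply: ler_wpM2l; last exact: norm2_symp.
exact: le_trans (ltW alpha0) alpha_beta.
Qed.

(** The difference of two correctors is a relaxation field orthogonal to all of them, itself
    included, so coercivity makes its norm zero. *)
Lemma corrector_unique i chi chi' : is_corrector S q gamma i chi ->
  is_corrector S q gamma i chi' -> eqf S chi chi'.
Proof.
move=> [Hc oc] [Hc' oc'].
have Hd := HB Hc Hc'.
have e1 : ip S q (Eb i + chi) (chi - chi') = 0 by exact: oc.
have e2 : ip S q (Eb i + chi') (chi - chi') = 0 by exact: oc'.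
have Ld := HL Hd.
have d0 : ip S q (chi - chi') (chi - chi') = 0.
  have E : chi - chi' = (Eb i + chi) - (Eb i + chi').
    by rewrite opprD addrACA subrr add0r.
  rewrite {1}E ipBl //; last 2 first.
  - exact: LD (L2_Eb i) (HL Hc).
  - exact: LD (L2_Eb i) (HL Hc').
  by rewrite e1 e2 subrr.
have n0 : norm2 S (chi - chi') = 0.
  have := ip_coercive oS Hq mq alpha0 bq (Hrel_Hsym Hd).
  rewrite d0 pmulr_rle0 // => h; apply/eqP.
  by rewrite eq_le h norm2_ge0.
apply: ae_imp (norm2_eq0 oS Ld n0) => z h Cz; have := h Cz.
by rewrite -[(chi - chi') z]/(chi z - chi' z) -[(0 : field) z]/(0 : M3) => /eqP;
  rewrite subr_eq0 => /eqP.
Qed.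

Lemma norm2_sum F : L F ->
  norm2 S F = \sum_i \sum_j \int[leb3]_(z in cell S) F z i j ^+ 2.
Proof.
move=> LF; transitivity (\int[leb3]_(z in cell S) (\sum_i \sum_j F z i j ^+ 2)).
  by apply: eq_Rintegral => z _; rewrite fnorm_sqr.
apply: etrans (Rintegral_sum mC _ _) _.
  by move=> i; apply: integrable_sumr => // j; case: (LF i j).
apply: eq_bigr => i _; apply: Rintegral_sum => // j; by case: (LF i j).
Qed.

(** The factor 9 counts the entries, whose limits are found separately. *)
Lemma L2field_complete (u : nat -> field) : (forall n, Hsym S (u n)) ->
  (forall n m, (n <= m)%N -> norm2 S (u m - u n) <= 4^-1 ^+ n) ->
  exists2 w, Hsym S w & forall n, norm2 S (u n - w) <= 9 * 4^-1 ^+ n.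
Proof.
move=> Hu cauchy; have Lu n := Hsym_L2 (Hu n).
have entry i j : exists g, L2 leb3 (cell S) g /\
    forall n, \int[leb3]_(z in cell S) (u n z i j - g z) ^+ 2 <= 4^-1 ^+ n.
  have [|g Lg hg] := @L2_complete _ _ _ _ _ mC fC (fun n z => u n z i j) (fun n => Lu n i j).
    move=> n m nm; apply: le_trans (cauchy n m nm).
    have LUB := LB (Lu m) (Lu n).
    apply: le_trans (norm2_entry oS i j LUB).
    rewrite le_eqVlt; apply/orP; left; apply/eqP.
    by apply: eq_Rintegral => z _; rewrite !mxE.
  by exists g.
have /choice [g hg] : forall ij : 'I_3 * 'I_3, exists g, L2 leb3 (cell S) g /\
    forall n, \int[leb3]_(z in cell S) (u n z ij.1 ij.2 - g z) ^+ 2 <= 4^-1 ^+ n.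
  by move=> [i j]; exact: entry.
pose G : field := fun z => \matrix_(i, j) g (i, j) z.
have LG : L G.
  by move=> i j; have := (hg (i, j)).1; apply: L2_ext => z; rewrite mxE.
(* The entrywise limit need not be symmetric as constructed. Symmetrising it puts it in [Hsym] and
   does not increase its distance to the almost everywhere symmetric [u n]. *)
pose w : field := fun z => symp (G z).
have Lw : L w by exact: L2field_symp.
exists w.
  split => //; apply: ae_all => z _.
  by apply/matrixP => i j; rewrite mxE !sympE addrC.
move=> n; have Hd : Hsym S (u n - w).
  have Hw : Hsym S w.
    split => //; apply: ae_all => z _.
    by apply/matrixP => i j; rewrite mxE !sympE addrC.
  by have := Hsym_lin oS 1 (-1) (Hu n) Hw; rewrite scale1r scaleN1r.
have LuG := LB (Lu n) LG.
apply: le_trans (_ : norm2 S (u n - G) <= _).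
  rewrite -(norm2_eq_symp oS Hd).
  apply: le_trans (norm2_symp oS LuG).
  rewrite le_eqVlt; apply/orP; left; apply/eqP.
  apply: eq_Rintegral => z _; congr (fnorm _ ^+ 2).
  apply/matrixP => i j; rewrite !sympE.
  have D (A B : field) k l : (A - B) z k l = A z k l - B z k l by rewrite !mxE.
  by rewrite !D /w !sympE; field.
rewrite norm2_sum //.
apply: (@le_trans _ _ (\sum_(i < 3) \sum_(j < 3) (4^-1 : R) ^+ n)).
  apply: ler_sum => i _; apply: ler_sum => j _.
  apply: le_trans ((hg (i, j)).2 n); rewrite le_eqVlt; apply/orP; left; apply/eqP.
  by apply: eq_Rintegral => z _; rewrite !mxE.
by rewrite !sumr_const !card_ord -mulrnA mulr_natl.
Qed.

Lemma corrector_exists i : closed_in_H S (Hrel S gamma) ->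
  exists chi, is_corrector S q gamma i chi.
Proof.
move=> closedH.
(* With tolerance [alpha], coercivity turns the energy bound on the increments into exactly the rate
   4^-n that completeness requires. *)
have [|w Hw ow] := @projection_exists R _ L H (ip S q) L_lin H_lin HL ips ipl ip0
  (Hrel_0 oS gamma0) alpha (Eb i) alpha0 (L2_Eb i); last by exists w.
move=> u Hu cauchy.
have Hsu n := Hrel_Hsym (Hu n).
have [|w Hsw hw] := L2field_complete Hsu.
  move=> n m nm; have Hd := HB (Hu m) (Hu n).
  have h1 := ip_coercive oS Hq mq alpha0 bq (Hrel_Hsym Hd).
  by have := le_trans h1 (cauchy n m nm); rewrite ler_pM2l.
exists w, (beta * 9); split.
  apply: (closedH u) => //.
  apply: (@squeeze_cvgr _ _ _ _ (fun=> 0) (fun n => 9 * 4^-1 ^+ n)).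
  - apply: nearW => n; apply/andP; split; first exact: norm2_ge0.
    exact: hw.
  - exact: cvg_cst.
  - by apply: cvg_geometric; rewrite ger0_norm // invf_lt1 // ltr1n.
move=> n; have Luw := LB (HL (Hu n)) (Hsym_L2 Hsw).
apply: le_trans (ip_upper Luw) _; rewrite -mulrA; apply: ler_wpM2l; last exact: hw.
exact: le_trans (ltW alpha0) alpha_beta.
Qed.

Variable chi : 'I_4 -> field.
Hypothesis chiP : forall i, is_corrector S q gamma i (chi i).

Let Hchi i : H (chi i) := (chiP i).1.

Lemma L2_corrected i : L (Eb i + chi i).
Proof. exact: LD (L2_Eb i) (HL (Hchi i)). Qed.

Lemma corrected_orth i psi : H psi -> ip S q (Eb i + chi i) psi = 0.
Proof. exact: (chiP i).2. Qed.

Definition corrected (k : 'cV[R]_4) : field := \sum_i k i 0 *: (Eb i + chi i).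

Definition correction (k : 'cV[R]_4) : field := \sum_i k i 0 *: chi i.

Lemma L2_sum_corrected k : L (corrected k).
Proof. by apply: L2field_sum => i; exact: L2_corrected. Qed.

Lemma Hrel_correction k : H (correction k).
Proof. exact: Hrel_sum. Qed.

Lemma corrected_coords K a : skew_mx K ->
  corrected (coords K a) = Estrain K a + correction (coords K a).
Proof.
move=> sK; rewrite Estrain_coords // /corrected /correction -big_split /=.
by apply: eq_bigr => i _; rewrite scalerDr.
Qed.

Lemma sum_corrected_orth k psi : H psi -> ip S q (corrected k) psi = 0.
Proof.
move=> Hpsi; rewrite ip_suml; last 2 first.
- by move=> i; exact: L2_corrected.
- exact: HL.
by rewrite big1 // => i _; rewrite corrected_orth ?mulr0.
Qed.

Lemma avgE i j : avg S q chi i j = ip S q (Eb i + chi i) (Eb j + chi j).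
Proof. by rewrite mxE. Qed.

Lemma avg_sym : (avg S q chi)^T = avg S q chi.
Proof. by apply/matrixP => i j; rewrite mxE !avgE ips. Qed.

Lemma avg_mul (k : 'cV[R]_4) i :
  (avg S q chi *m k) i 0 = ip S q (corrected k) (Eb i + chi i).
Proof.
rewrite mxE ip_suml; last 2 first.
- by move=> j; exact: L2_corrected.
- exact: L2_corrected.
by apply: eq_bigr => j _; rewrite avgE mulrC ips.
Qed.

Lemma qf_avg (k : 'cV[R]_4) : qf (avg S q chi) k = ip S q (corrected k) (corrected k).
Proof.
rewrite /qf mxE {1}/corrected ip_suml; last 2 first.
- by move=> j; exact: L2_corrected.
- exact: L2_sum_corrected.
by apply: eq_bigr => i _; rewrite avg_mul ips mxE.
Qed.

Lemma ip_Pythagoras k psi : H psi ->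
  ip S q (corrected k + psi) (corrected k + psi) =
  ip S q (corrected k) (corrected k) + ip S q psi psi.
Proof.
move=> Hpsi; have Lp := HL Hpsi; have Lk := L2_sum_corrected k.
have h := sum_corrected_orth k Hpsi.
rewrite (ipDl Lk Lp (LD Lk Lp)) (ips _ (corrected k + psi)).
rewrite (ips psi (corrected k + psi)) (ipDl Lk Lp Lk) (ipDl Lk Lp Lp).
by rewrite (ips psi (corrected k)) h addr0 add0r.
Qed.

Lemma Qhom_avg K a : skew_mx K ->
  Qhom S q gamma K a = qf (avg S q chi) (coords K a).
Proof.
move=> sK; rewrite qf_avg /Qhom.
set k := coords K a; set E := [set _ | _ in _].
have inE' psi : H psi -> E (ip S q (Estrain K a + psi) (Estrain K a + psi)).
  by move=> Hpsi; exists psi => //; rewrite -(ip_quadratic Hq).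
have memE : E (ip S q (corrected k) (corrected k)).
  by rewrite corrected_coords //; apply: inE'; exact: Hrel_correction.
have lbE : lbound E (ip S q (corrected k) (corrected k)).
  move=> _ [psi Hpsi <-].
  have -> : \int[cleb3]_(z in (cell S : set L3)) q z (Estrain K a z + psi z) =
      ip S q (Estrain K a + psi) (Estrain K a + psi).
    exact: (ip_quadratic Hq (Estrain K a + psi)).
  have -> : Estrain K a + psi = corrected k + (psi - correction k).
    by rewrite corrected_coords // addrACA subrr addr0.
  have Hd := HB Hpsi (Hrel_correction k).
  by rewrite ip_Pythagoras // lerDl; apply: ip0; exact: HL.
apply/eqP; rewrite eq_le; apply/andP; split.
  by apply: ge_inf => //; exists (ip S q (corrected k) (corrected k)).
apply: lb_le_inf => //; by exists (ip S q (corrected k) (corrected k)).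
Qed.

Lemma Hsym_corrected k : Hsym S (corrected k).
Proof.
rewrite -(coords_skew_of k) corrected_coords; last exact: skew_of_skew.
have := Hsym_lin oS 1 1 (Hsym_Estrain (skew_of k) (k 0 0))
  (Hrel_Hsym (Hrel_correction (coords (skew_of k) (k 0 0)))).
by rewrite !scale1r.
Qed.

Lemma qf_avg_ge c (k : 'cV[R]_4) :
  (forall K a psi, skew_mx K -> H psi ->
     c * ((coords K a)^T *m coords K a) 0 0 <= norm2 S (Estrain K a + psi)) ->
  alpha * c * (k^T *m k) 0 0 <= qf (avg S q chi) k.
Proof.
move=> coercive; rewrite qf_avg.
apply: le_trans (ip_coercive oS Hq mq alpha0 bq (Hsym_corrected k)).
rewrite -mulrA ler_pM2l //.
have := coercive (skew_of k) (k 0 0) (correction k) (skew_of_skew k) (Hrel_correction k).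
by rewrite coords_skew_of -{1}[k in correction k]coords_skew_of
  -corrected_coords ?coords_skew_of //; exact: skew_of_skew.
Qed.

Lemma qf_avg_le (k : 'cV[R]_4) : qf (avg S q chi) k <=
  beta * norm2 S (Estrain (skew_of k) (k 0 0)).
Proof.
rewrite qf_avg; apply: le_trans (ip_upper (L2_Estrain oS bS (skew_of k) (k 0 0))).
have -> : Estrain (skew_of k) (k 0 0) = corrected k + (0 - correction k).
  have := corrected_coords (k 0 0) (skew_of_skew k); rewrite coords_skew_of => ->.
  by rewrite sub0r addrK.
rewrite ip_Pythagoras; last exact: HB (Hrel_0 oS gamma0) (Hrel_correction k).
by rewrite lerDl; apply: ip0; apply: HL; exact: HB (Hrel_0 oS gamma0) (Hrel_correction k).
Qed.

Lemma orthoc_corrected i : orthoc S q gamma (Eb i + chi i).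
Proof.
split; last by move=> psi; exact: corrected_orth.
exists (Kb i), (i == 0)%:R, (chi i); split; [exact: Kb_skew|exact: Hchi|].
by rewrite [in LHS]EbE.
Qed.

Lemma effective_coords (B : field) K a P : skew_mx K -> L B ->
  is_Prel S q gamma (Estrain K a) P -> is_Prel S q gamma (fun z => symp (B z)) P ->
  avg S q chi *m coords K a = bvec S q B chi.
Proof.
move=> sK LB' [[[K' [a' [psi [_ Hpsi EP]]]] _] oE] [_ oB].
have LE := L2_Estrain oS bS K a.
have LP : L P.
  by rewrite EP; exact: LD (L2_Estrain oS bS K' a') (HL Hpsi).
have LsB := L2field_symp oS LB'.
(* The i-th entry of M k pairs the corrected strain of (K, a) with [Eb i + chi i]; the correction
   part drops out by orthogonality, leaving [Estrain K a] itself. *)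
apply/matrixP => i j; rewrite ord1 avg_mul corrected_coords // mxE.
have Lu := L2_corrected i.
rewrite ipDl //; last exact/HL/Hrel_correction.
rewrite (ips (correction _)) corrected_orth ?addr0; last exact: Hrel_correction.
have e1 : ip S q (Estrain K a - P) (Eb i + chi i) = 0 by apply: oE; exact: orthoc_corrected.
have e2 : ip S q ((fun z => symp (B z)) - P) (Eb i + chi i) = 0.
  by apply: oB; exact: orthoc_corrected.
rewrite ipBl // in e1; rewrite ipBl // in e2.
rewrite -(ip_symp oS Hq mq alpha0 bq LB' Lu).
by move/eqP: e1; rewrite subr_eq0 => /eqP ->; move/eqP: e2; rewrite subr_eq0 => /eqP ->.
Qed.

(** Correction lowers the energy, so corrected strains are bounded uniformly over all materials with
    the same [alpha] and [beta]; [avg_close] rests on this. *)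
Lemma norm2_corrected_le i : alpha * norm2 S (Eb i + chi i) <= beta * norm2 S (Eb i).
Proof.
have Hs : Hsym S (Eb i + chi i).
  have := Hsym_lin oS 1 1 (Hsym_Estrain (Kb i) (i == 0)%:R) (Hrel_Hsym (Hchi i)).
  by rewrite !scale1r -EbE.
apply: le_trans (ip_coercive oS Hq mq alpha0 bq Hs) _.
apply: le_trans (ip_upper (L2_Eb i)).
have Lu := L2_corrected i; have Lc := HL (Hchi i).
have -> : ip S q (Eb i) (Eb i) =
    ip S q (Eb i + chi i) (Eb i + chi i) + ip S q (chi i) (chi i).
  have E : Eb i = (Eb i + chi i) - chi i by rewrite addrK.
  have h := corrected_orth i (Hchi i).
  rewrite {1 2}E (ipBl Lu Lc (LB Lu Lc)) (ips _ (Eb i + chi i - chi i)).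
  rewrite (ips (chi i) (Eb i + chi i - chi i)) (ipBl Lu Lc Lu) (ipBl Lu Lc Lc).
  by rewrite (ips (chi i) (Eb i + chi i)) h; ring.
by rewrite lerDl; exact: ip0.
Qed.

End FixedMaterial.

(** * Dependence on the axial variable *)

Section Extension.
Context (R : realType).

Lemma interval_dense (a b c d : R) : a < b -> a <= c <= b -> 0 < d ->
  exists2 x, a < x < b & `|x - c| < d.
Proof.
move=> ab /andP[ac cb] d0.
(* Moving [c] slightly towards the midpoint lands strictly inside, even when [c] is an end point. *)
pose m := (a + b) / 2; pose t := Num.min (1 / 2) (d / (2 * (b - a))).
have ba : 0 < b - a by rewrite subr_gt0.
have t0 : 0 < t by rewrite lt_min !divr_gt0 ?mulr_gt0.
have t1 : t <= 1 / 2 by rewrite ge_min lexx.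
have td : t * (b - a) <= d / 2.
  rewrite -ler_pdivlMr //; apply: (@le_trans _ _ (d / (2 * (b - a)))).
    by rewrite ge_min lexx orbT.
  by rewrite invfM mulrA.
exists (c + t * (m - c)).
  have am : a < m < b by rewrite /m; apply/andP; split; lra.
  by case/andP: am => am mb; apply/andP; split; nra.
rewrite addrAC subrr add0r normrM (gtr0_norm t0).
have mc : `|m - c| <= b - a by rewrite /m ler_norml; apply/andP; split; lra.
apply: (@le_lt_trans _ _ (t * (b - a))); first by rewrite ler_pM2l.
by apply: le_lt_trans td _; lra.
Qed.

(** [piecewise_continuous] demands a function continuous up to the end points, whereas the averaging
    matrix is controlled only inside each interval. *)
Lemma Cauchy_extension (f : R -> R) (a b : R) : a < b ->
  (forall c, a <= c <= b -> forall e, 0 < e -> exists2 d, 0 < d &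
     forall x x', a < x < b -> a < x' < b -> `|x - c| < d -> `|x' - c| < d ->
       `|f x - f x'| <= e) ->
  exists g : R -> R, (forall x, a < x < b -> g x = f x) /\
    forall x, a <= x <= b -> forall e, 0 < e -> exists2 d, 0 < d &
      forall x', a <= x' <= b -> `|x' - x| < d -> `|g x - g x'| <= e.
Proof.
move=> ab cauchy.
have limit c : a <= c <= b -> exists l, forall e, 0 < e -> exists2 d, 0 < d &
    forall x, a < x < b -> `|x - c| < d -> `|l - f x| <= e.
  move=> cab.
  (* The supremum of the numbers that bound [f] from below near [c] is its lower limit there; the
     Cauchy condition shows that it is a limit. *)
  pose E := [set y : R | exists2 d, 0 < d &
    forall x, a < x < b -> `|x - c| < d -> y <= f x].
  have key e d x0 : 0 < e -> 0 < d -> a < x0 < b -> `|x0 - c| < d ->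
      (forall x x', a < x < b -> a < x' < b -> `|x - c| < d -> `|x' - c| < d ->
       `|f x - f x'| <= e) -> E (f x0 - e) /\ ubound E (f x0 + e).
    move=> e0 d0 x0ab x0c hd; split.
      exists d => // x xab xc; have := hd x0 x x0ab xab x0c xc.
      by rewrite ler_norml => /andP[_]; lra.
    move=> y [d' d'0 hy].
    have dd : 0 < Num.min d d' by rewrite lt_min d0.
    have [x xab] := interval_dense ab cab dd; rewrite lt_min => /andP[xd xd'].
    apply: le_trans (hy x xab xd') _.
    have := hd x x0 xab x0ab xd x0c.
    by rewrite ler_norml => /andP[_]; lra.
  exists (sup E) => e e0; have [d d0 hd] := cauchy c cab e e0.
  exists d => // x xab xc; have [Ex uE] := key e d x e0 d0 xab xc hd.
  have h1 : f x - e <= sup E by apply: ub_le_sup => //; exists (f x + e).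
  have h2 : sup E <= f x + e by apply: ge_sup => //; exists (f x - e).
  by rewrite ler_norml; apply/andP; split; lra.
have interior c : a < c < b -> forall e, 0 < e -> exists2 d, 0 < d &
    forall x, a < x < b -> `|x - c| < d -> `|f c - f x| <= e.
  move=> cab e e0; have cab' : a <= c <= b by case/andP: cab => ? ?; rewrite !ltW.
  have [d d0 hd] := cauchy c cab' e e0; exists d => // x xab xc.
  by apply: hd => //; rewrite subrr normr0.
have /choice [g hg] : forall c, exists l, a <= c <= b ->
    (a < c < b -> l = f c) /\ forall e, 0 < e -> exists2 d, 0 < d &
    forall x, a < x < b -> `|x - c| < d -> `|l - f x| <= e.
  move=> c; have [cab|ncab] := pselect (a <= c <= b); last by exists 0.
  (* Inside the interval the value of [f] is kept, so that [g] is an extension and not only a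
     limit. *)
  have [cab'|ncab'] := pselect (a < c < b).
    by exists (f c) => _; split => // e e0; exact: interior.
  by have [l hl] := limit c cab; exists l => _; split.
exists g; split.
  by move=> x xab; apply: (hg x _).1 => //; case/andP: xab => ? ?; rewrite !ltW.
move=> x xab e e0; have e2 : 0 < e / 2 by rewrite divr_gt0.
have [d d0 hd] := (hg x xab).2 _ e2.
exists d => // x' x'ab x'x.
have [d' d'0 hd'] := (hg x' x'ab).2 _ e2.
(* An interior point [y] this close to [x'] is also within [d] of [x], so [f y] approximates both
   values of [g]. *)
have dm : 0 < Num.min d' (d - `|x' - x|) by rewrite lt_min d'0 subr_gt0.
have [y yab] := interval_dense ab x'ab dm; rewrite lt_min => /andP[yd' yd].
have yx : `|y - x| < d.
  have -> : y - x = (y - x') + (x' - x) by ring.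
  by apply: le_lt_trans (ler_normD _ _) _; lra.
have -> : g x - g x' = (g x - f y) - (g x' - f y) by ring.
apply: le_trans (ler_normB _ _) _.
by have := hd y yab yx; have := hd' y yab yd'; lra.
Qed.

Lemma common_radius (I : finType) (P : I -> R -> Prop) :
  (forall i d d', 0 < d' -> d' <= d -> P i d -> P i d') ->
  (forall i, exists2 d, 0 < d & P i d) -> exists2 d, 0 < d & forall i, P i d.
Proof.
move=> mono ex.
suff : exists2 d, 0 < d & forall i, i \in enum I -> P i d.
  by case=> d d0 hd; exists d => // i; apply: hd; rewrite mem_enum.
elim: (enum I) => [|i s [d d0 hd]]; first by exists 1.
have [d' d'0 hd'] := ex i.
have m0 : 0 < Num.min d d' by rewrite lt_min d0.
exists (Num.min d d') => // j; rewrite inE => /orP[/eqP ->|js].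
  by apply: mono hd' => //; rewrite ge_min lexx orbT.
by apply: mono (hd j js) => //; rewrite ge_min lexx.
Qed.

End Extension.

Lemma sum_Cauchy_Schwarz (R : realFieldType) (I : finType) (k a : I -> R) :
  (\sum_i k i * a i) ^+ 2 <= (\sum_i k i ^+ 2) * \sum_i a i ^+ 2.
Proof.
apply: discriminant_le => [|t]; first by apply: sumr_ge0 => i _; exact: sqr_ge0.
have -> : (\sum_i k i ^+ 2) * t ^+ 2 + 2 * (\sum_i k i * a i) * t + \sum_i a i ^+ 2 =
    \sum_i (k i * t + a i) ^+ 2.
  rewrite mulr_suml mulr_sumr mulr_suml -!big_split /=.
  by apply: eq_bigr => i _; ring.
by apply: sumr_ge0 => i _; exact: sqr_ge0.
Qed.

(** * Comparison of two materials *)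

Section Dependence.
Context (R : realType) (S : set (R * R)).
Hypothesis oS : open S.
Hypothesis bS : bounded_set S.
Local Notation L3 := (@lpoint R).
Local Notation M3 := 'M[R]_3.
Local Notation field := (R * R * R -> M3).

Let mC := measurable_cell oS.
Let mCL : measurable (cell S : set L3) := measurable_lpoint mC.

(** Pointwise Cauchy-Schwarz in the expansion of the strain over the basis; it supplies a constant
    for the upper bound that involves only [S]. *)
Lemma norm2_Estrain_le (k : 'cV[R]_4) :
  norm2 S (Estrain (skew_of k) (k 0 0)) <= (\sum_i norm2 S (Eb i)) * (k^T *m k) 0 0.
Proof.
have jE i := integrable_fnorm oS (L2_Eb oS bS i).
have kk : (k^T *m k) 0 0 = \sum_i k i 0 ^+ 2.
  by rewrite mxE; apply: eq_bigr => i _; rewrite mxE expr2.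
have -> : (\sum_i norm2 S (Eb i)) * (k^T *m k) 0 0 =
    \int[leb3]_(z in cell S) ((\sum_i k i 0 ^+ 2) * \sum_i fnorm (Eb i z) ^+ 2).
  rewrite kk mulrC; apply/esym.
  apply: etrans (RintegralZl _ mC (integrable_sumr mC _ jE)) _.
  by congr (_ * _); exact: Rintegral_sum.
apply: le_Rintegral => //.
- exact: integrable_fnorm (L2_Estrain oS bS _ _).
- by apply: integrable_scaler => //; exact: integrable_sumr.
move=> z _; rewrite (Estrain_coords _ (skew_of_skew k)) coords_skew_of.
have E (i j : 'I_3) : (\sum_l k l 0 *: Eb l : field) z i j = \sum_l k l 0 * Eb l z i j.
  rewrite fct_sumE summxE; apply: eq_bigr => l _.
  by rewrite -[(k l 0 *: Eb l : field) z]/(k l 0 *: Eb l z) mxE.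
rewrite fnorm_sqr.
have -> : \sum_l fnorm (Eb l z) ^+ 2 = \sum_i \sum_j \sum_l Eb l z i j ^+ 2.
  under eq_bigr do rewrite fnorm_sqr.
  by rewrite exchange_big /=; apply: eq_bigr => i _; rewrite exchange_big.
rewrite mulr_sumr; apply: ler_sum => i _; rewrite mulr_sumr; apply: ler_sum => j _.
by rewrite E; exact: sum_Cauchy_Schwarz.
Qed.

Variables q q' : R * R * R -> M3 -> R.
Hypothesis Hq : forall z, S z.1 -> quadratic_form (q z).
Hypothesis mq : forall G,
  measurable_fun ([set z | S z.1] : set L3) (fun z : L3 => q z G).
Hypothesis Hq' : forall z, S z.1 -> quadratic_form (q' z).
Hypothesis mq' : forall G,
  measurable_fun ([set z | S z.1] : set L3) (fun z : L3 => q' z G).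
Variables alpha beta : R.
Hypothesis alpha0 : 0 < alpha.
Hypothesis alpha_beta : alpha <= beta.
Hypothesis bq : {ae leb3, forall z, S z.1 -> forall G,
  alpha * fnorm (symp G) ^+ 2 <= q z G <= beta * fnorm (symp G) ^+ 2}.
Hypothesis bq' : {ae leb3, forall z, S z.1 -> forall G,
  alpha * fnorm (symp G) ^+ 2 <= q' z G <= beta * fnorm (symp G) ^+ 2}.
Variable eps : R.
Hypothesis eps0 : 0 <= eps.
Hypothesis qq' :
  close_tensor S eps (fun z => polar (q z)) (fun z => polar (q' z)).

Lemma ip_close F G : L2field S F -> L2field S G ->
  `|ip S q F G - ip S q' F G| <= eps * (2^-1 * (norm2 S F + norm2 S G)).
Proof.
move=> LF LG.
have j1 := integrable_polar oS Hq mq alpha0 bq LF LG.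
have j2 := integrable_polar oS Hq' mq' alpha0 bq' LF LG.
pose d (z : R * R * R) := polar (q z) (F z) (G z) - polar (q' z) (F z) (G z).
have jd : cleb3.-integrable (cell S : set L3) (EFin \o d).
  have := integrable_addr mCL j1 (integrable_scaler mCL (-1) j2).
  by apply: eq_integrable_real => // z _; rewrite /d mulN1r.
have -> : ip S q F G - ip S q' F G = \int[cleb3]_(z in (cell S : set L3)) d z.
  by apply/esym; exact: (RintegralB mCL j1 j2).
apply: le_trans (le_normr_Rintegral mCL jd) _.
have jF := integrable_fnorm oS LF; have jG := integrable_fnorm oS LG.
have js := integrable_addr mC jF jG.
have jh := integrable_scaler mC eps (integrable_scaler mC 2^-1 js).
pose h (z : R * R * R) := eps * (2^-1 * (fnorm (F z) ^+ 2 + fnorm (G z) ^+ 2)).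
have h0 z : 0 <= h z by rewrite mulr_ge0 // mulr_ge0 // addr_ge0 ?sqr_ge0.
have -> : eps * (2^-1 * (norm2 S F + norm2 S G)) =
    \int[cleb3]_(z in (cell S : set L3)) h z.
  apply/esym; apply: etrans (ge0_Rintegral_lpoint mC _ (fun z _ => h0 z)) _.
    by have /integrableP[/measurable_EFinP] := jh.
  apply: etrans (RintegralZl eps mC (integrable_scaler mC 2^-1 js)) _.
  congr (_ * _); apply: etrans (RintegralZl 2^-1 mC js) _.
  by congr (_ * _); exact: (RintegralD mC jF jG).
apply: (le_ae_Rintegral mCL).
- by have := integrable_norm jd.
- exact: (integrable_lpoint mC jh).
apply: ae_imp (ae_lpoint qq') => z hz [Sz _].
apply: le_trans (hz Sz (F z) (G z)) _.
rewrite /h -mulrA ler_wpM2l //.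
by have := sqr_ge0 (fnorm (F z) - fnorm (G z)); nra.
Qed.

Variable gamma : \bar R.
Variables chi chi' : 'I_4 -> field.
Hypothesis chiP : forall i, is_corrector S q gamma i (chi i).
Hypothesis chiP' : forall i, is_corrector S q' gamma i (chi' i).

(* Replacing one corrector by its primed version does not change the matrix
   entries, because the difference lies in [Hrel], so both entries are pairings
   of the same two fields. *)
Lemma avg_close i j : `|avg S q chi i j - avg S q' chi' i j| <=
  eps * (beta / alpha * \sum_l norm2 S (Eb l)).
Proof.
have Lu := L2_corrected oS bS chiP; have Lu' := L2_corrected oS bS chiP'.
have Hd l : Hrel S gamma (chi' l - chi l).
  have := Hrel_lin oS bS 1 (-1) (chiP' l).1 (chiP l).1.
  by rewrite scale1r scaleN1r.
have D l : (Eb l + chi' l) - (Eb l + chi l) = chi' l - chi l.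
  by rewrite opprD addrACA subrr add0r.
have -> : avg S q chi i j = ip S q (Eb i + chi i) (Eb j + chi' j).
  rewrite avgE; apply/eqP; rewrite eq_sym -subr_eq0 ip_sym [X in _ - X]ip_sym.
  rewrite -(ipBl oS Hq mq alpha0 bq (Lu' j) (Lu j) (Lu i)) D ip_sym.
  by rewrite (corrected_orth chiP).
have -> : avg S q' chi' i j = ip S q' (Eb i + chi i) (Eb j + chi' j).
  rewrite avgE; apply/eqP; rewrite -subr_eq0.
  rewrite -(ipBl oS Hq' mq' alpha0 bq' (Lu' i) (Lu i) (Lu' j)) D ip_sym.
  by rewrite (corrected_orth chiP').
apply: le_trans (ip_close (Lu i) (Lu' j)) _; rewrite ler_wpM2l //.
have h1 := norm2_corrected_le oS bS Hq mq alpha0 alpha_beta bq chiP i.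
have h2 := norm2_corrected_le oS bS Hq' mq' alpha0 alpha_beta bq' chiP' j.
have b0 : 0 <= beta by exact: le_trans (ltW alpha0) alpha_beta.
have s l : norm2 S (Eb l) <= \sum_l norm2 S (Eb l).
  rewrite (bigD1 l) //= lerDl; apply: sumr_ge0 => m _; exact: norm2_ge0.
have h1' := le_trans h1 (ler_wpM2l b0 (s i)).
have h2' := le_trans h2 (ler_wpM2l b0 (s j)).
rewrite mulrAC ler_pdivlMr //; move: h1' h2'.
move: (norm2 _ (_ + _)) (norm2 _ (_ + _)) (_ * \sum_l _) => x y w; lra.
Qed.

End Dependence.

(** * Piecewise continuity of the averaging matrix *)

Section MaterialSections.
Context (R : realType) (S : set (R * R)).
Hypothesis oS : open S.
Hypothesis bS : bounded_set S.
Local Notation mR := (measurableTypeR R).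
Local Notation L3 := (@lpoint R).
Local Notation M3 := 'M[R]_3.
Local Notation field := (R * R * R -> M3).
Variables (l alpha beta : R) (Q : R -> R * R * R -> M3 -> R).
Hypothesis alpha0 : 0 < alpha.
Hypothesis alpha_beta : alpha <= beta.
Hypothesis adm : admissible S l alpha beta Q.

Lemma admissible_quadratic x1 : 0 < x1 < l ->
  forall z, S z.1 -> quadratic_form (Q x1 z).
Proof. by case: adm => h _ _ _ _ hx z; exact: h. Qed.

Lemma admissible_measurable x1 : 0 < x1 < l ->
  forall G, measurable_fun ([set z | S z.1] : set L3) (fun z : L3 => Q x1 z G).
Proof.
move=> hx G; case: adm => _ h _ _ _.
apply: (@measurable_comp _ _ _ _ _ _
  ([set p | S p.1.1 /\ 0 < p.2 < l] : set (L3 * mR)%type)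
  (fun p : (L3 * mR)%type => Q p.2 p.1 G) _ (fun z : L3 => (z, x1 : mR))).
- have -> : [set p | S p.1.1 /\ 0 < p.2 < l] =
      ([set z | S z.1] : set L3) `*` (`]0, l[%classic : set mR).
    by apply/seteqP; split => p /= [h1 h2]; split => //; move: h2; rewrite /= in_itv.
  by apply: measurableX => //; exact: measurable_cylinder.
- by move=> _ [z Sz <-].
- exact: h.
- by apply: measurable_funTS; exact: measurable_pair2.
Qed.

Lemma admissible_bounds x1 : 0 < x1 < l -> {ae leb3, forall z, S z.1 -> forall G,
  alpha * fnorm (symp G) ^+ 2 <= Q x1 z G <= beta * fnorm (symp G) ^+ 2}.
Proof. by case: adm => _ _ _ h _ hx; exact: h. Qed.

Lemma close_mx_entries n (A A' : 'M[R]_n) e :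
  (forall i j, `|A i j - A' i j| <= e) -> close_mx (n%:R * e) A A'.
Proof.
move=> h; rewrite /close_mx.
have [n0|n0] := posnP n.
  subst n; rewrite mul0r -(@ler_pXn2r _ 2) ?nnegrE ?fnorm_ge0 //.
  by rewrite fnorm_sqr big_ord0 expr0n.
have e0 : 0 <= e := le_trans (normr_ge0 _) (h (Ordinal n0) (Ordinal n0)).
rewrite -(@ler_pXn2r _ 2) ?nnegrE ?fnorm_ge0 ?mulr_ge0 // fnorm_sqr.
apply: (@le_trans _ _ (\sum_(i < n) \sum_(j < n) e ^+ 2)).
  apply: ler_sum => i _; apply: ler_sum => j _.
  by rewrite !mxE -real_normK ?num_real // ler_pXn2r ?nnegrE ?normr_ge0.
by rewrite !sumr_const !card_ord -mulrnA -[leLHS]mulr_natl natrM exprMn [n%:R ^+ 2]expr2.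
Qed.

(** Compares two tensors through a third one, [L], which need not come from a material. *)
Lemma close_tensor_trans (eps eps' : R) (L L' L'' : R * R * R -> M3 -> M3 -> R) :
  close_tensor S eps L L' -> close_tensor S eps' L L'' ->
  close_tensor S (eps + eps') L' L''.
Proof.
apply: ae_imp2 => z h h' Sz F G.
have -> : L' z F G - L'' z F G = (L z F G - L'' z F G) - (L z F G - L' z F G) by ring.
apply: le_trans (ler_normB _ _) _; rewrite addrC !mulrDl.
by apply: lerD; [exact: h|exact: h'].
Qed.

Variable gamma : \bar R.
Variable chi : R -> 'I_4 -> field.
Hypothesis chiP : forall x1 i, 0 < x1 < l -> is_corrector S (Q x1) gamma i (chi x1 i).

Lemma avg_piecewise_continuous :
  piecewise_continuous (@close_mx R 4) l (fun x1 => avg S (Q x1) (chi x1)).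
Proof.
case: adm => _ _ _ _ [s [srt lst hs]]; exists s; split => // k ks /=.
set a := (0 :: s)`_k; set b := s`_k.
have ab : a < b.
  have /(sorted_ltn_nth lt_trans 0) h := srt.
  by apply: (h k k.+1); rewrite // inE /= ltnS // ltnW.
have a0 : 0 <= a.
  have /(sorted_leq_nth le_trans lexx 0) h : sorted <=%R (0 :: s).
    by apply: sub_sorted srt => x y /ltW.
  by apply: (h 0%N k); rewrite // inE /= ltnS // ltnW.
have bl : b <= l.
  have /(sorted_leq_nth le_trans lexx 0) h : sorted <=%R (0 :: s).
    by apply: sub_sorted srt => x y /ltW.
  rewrite -lst (last_nth 0); apply: (h k.+1 (size s)); rewrite ?inE //=.
have sub x : a < x < b -> 0 < x < l.
  by case/andP=> ax xb; rewrite (le_lt_trans a0 ax) (lt_le_trans xb bl).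
have [w [wE wC]] := hs k ks.
pose D := beta / alpha * \sum_i norm2 S (Eb i).
have D0 : 0 <= D.
  rewrite mulr_ge0 //; last by apply: sumr_ge0 => i _; exact: norm2_ge0.
  by rewrite divr_ge0 ?(ltW alpha0) // (le_trans (ltW alpha0)).
have cauchy (i j : 'I_4) c : a <= c <= b -> forall e, 0 < e -> exists2 d, 0 < d &
    forall x x', a < x < b -> a < x' < b -> `|x - c| < d -> `|x' - c| < d ->
    `|avg S (Q x) (chi x) i j - avg S (Q x') (chi x') i j| <= e.
  (* Each of the two tensors is within [eps] of the one at [c], and the entries of M vary by at most
     [D] times the sum; [D + 1] avoids a division by zero. *)
  move=> cab e e0; pose eps := e / (2 * (D + 1)).
  have D1 : 0 < D + 1 by rewrite ltr_pwDr.
  have eps0 : 0 < eps by rewrite divr_gt0 // mulr_gt0.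
  have cab' : c \in `[a, b] by rewrite in_itv.
  have [d d0 hd] := wC c cab' eps eps0; exists d => // x x' xab x'ab xc x'c.
  have hw y : a < y < b -> `|y - c| < d ->
      close_tensor S eps (w c) (fun z => polar (Q y z)).
    move=> yab yc; rewrite -[X in close_tensor _ _ _ X](wE y); last by rewrite in_itv.
    apply: hd => //; rewrite in_itv /=; by case/andP: yab => ? ?; rewrite !ltW.
  have cl := close_tensor_trans (hw x xab xc) (hw x' x'ab x'c).
  have sx := sub x xab; have sx' := sub x' x'ab.
  have ee : 0 <= eps + eps by rewrite addr_ge0 // ltW.
  apply: le_trans (avg_close oS bS (admissible_quadratic sx)
    (admissible_measurable sx) (admissible_quadratic sx')
    (admissible_measurable sx') alpha0 alpha_beta (admissible_bounds sx)
    (admissible_bounds sx') ee cl (fun i => chiP i sx) (fun i => chiP i sx') i j) _.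
  rewrite -/D.
  have -> : eps + eps = e / (D + 1) by rewrite /eps; field; rewrite gt_eqF.
  by rewrite -mulrA ger_pMr // mulrC ler_pdivrMr // mul1r lerDl.
have ext (ij : 'I_4 * 'I_4) : exists g : R -> R,
    (forall x, a < x < b -> g x = avg S (Q x) (chi x) ij.1 ij.2) /\
    forall x, a <= x <= b -> forall e, 0 < e -> exists2 d, 0 < d &
      forall x', a <= x' <= b -> `|x' - x| < d -> `|g x - g x'| <= e.
  by apply: Cauchy_extension ab _ => c; exact: cauchy.
have {ext} /choice [g hg] := ext.
exists (fun x => \matrix_(i, j) g (i, j) x); split.
  move=> x; rewrite in_itv /= => xab; apply/matrixP => i j.
  by rewrite mxE (hg (i, j)).1.
move=> x; rewrite in_itv /= => xab eps eps0.
(* A 4 x 4 matrix with entries at most e in absolute value has Frobenius norm at most 4 e. *)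
have e4 : 0 < eps / 4 by rewrite divr_gt0.
have [|ij|d d0 hd] := @common_radius R ('I_4 * 'I_4)%type
    (fun ij d => forall x', a <= x' <= b -> `|x' - x| < d ->
       `|g ij x - g ij x'| <= eps / 4).
- by move=> ij d d' d'0 d'd h x' x'ab x'x; apply: h => //; exact: lt_le_trans d'd.
- exact: (hg ij).2.
exists d => // x'; rewrite in_itv /= => x'ab x'x.
have -> : eps = 4%:R * (eps / 4) by field.
by apply: close_mx_entries => i j; rewrite !mxE; exact: hd.
Qed.

End MaterialSections.

(** * Slices of the prestrain at a fixed axial position *)

Section Slices.
Context d1 d2 (T1 : measurableType d1) (T2 : measurableType d2) (R : realType).

Lemma ae_forall_fin d (T : measurableType d) (mu : measure T R) (I : finType)
    (P : I -> T -> Prop) :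
  (forall i, {ae mu, forall x, P i x}) -> {ae mu, forall x, forall i, P i x}.
Proof.
move=> h; have : {ae mu, forall x, forall i, i \in enum I -> P i x}.
  elim: (enum I) => [|i s IH]; first exact: ae_all.
  apply: ae_imp2 (h i) IH => x Pi Ps j; rewrite inE => /orP[/eqP ->//|]; exact: Ps.
by apply: ae_imp => x hx i; apply: hx; rewrite mem_enum.
Qed.

Variables (m1 : {sigma_finite_measure set T1 -> \bar R})
  (m2 : {sigma_finite_measure set T2 -> \bar R}).
Variables (D1 : set T1) (D2 : set T2).
Hypotheses (mD1 : measurable D1) (mD2 : measurable D2).

Lemma L2_slice (f : T1 * T2 -> R) : L2 (m1 \x m2)%E (D1 `*` D2) f ->
  {ae m2, forall y, D2 y -> L2 m1 D1 (fun x => f (x, y))}.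
Proof.
move=> [mf /(integrable_mkcond _ (measurableX mD1 mD2))]; rewrite restrict_EFin => jf.
apply: ae_imp (ae_integrable2 jf) => y jy Dy; split.
  apply: (@measurable_comp _ _ _ _ _ _ (D1 `*` D2) f _ (fun x => (x, y))) => //.
  - exact: measurableX.
  - by move=> _ [x Dx <-].
  - by apply: measurable_funTS; exact: measurable_pair2.
apply/(integrable_mkcond _ mD1); rewrite restrict_EFin.
apply: eq_integrable jy => // x _ /=; congr EFin; rewrite !patchE.
by congr (if _ then _ else _); apply/idP/idP; rewrite !inE => //= -[].
Qed.

End Slices.

Lemma definite_unitmx (R : realFieldType) n (A : 'M[R]_n) :
  (forall k : 'cV_n, k != 0 -> 0 < (k^T *m (A *m k)) 0 0) -> A \in unitmx.
Proof.
move=> pos; rewrite unitmxE unitfE; apply/det0P => -[v v0 vA].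
have := pos v^T; rewrite trmxK mulmxA vA mul0mx mxE ltxx.
suff -> : v^T != 0 by move/(_ isT).
by rewrite -(inj_eq (@trmx_inj _ _ _)) trmxK trmx0.
Qed.

Lemma L2field_slices (R : realType) (S : set (R * R)) (l : R)
    (B : R -> R * R * R -> 'M[R]_3) : open S ->
  (forall i j, L2 leb4 [set p : R * R * R * R | cell S p.1 /\ 0 < p.2 < l]
                 (fun p => B p.2 p.1 i j)) ->
  {ae leb1, forall x1 : R, 0 < x1 < l -> L2field S (B x1)}.
Proof.
move=> oS LB.
have key (ij : 'I_3 * 'I_3) : {ae leb1, forall x1 : R, 0 < x1 < l ->
    L2 leb3 (cell S) (fun z => B x1 z ij.1 ij.2)}.
  pose mu := @lebesgue_measure R.
  have mI : measurable (`]0, l[%classic : set (measurableTypeR R)) by [].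
  have LBij : L2 leb4 (cell S `*` `]0, l[%classic) (fun p => B p.2 p.1 ij.1 ij.2).
    have := LB ij.1 ij.2; suff -> : [set p : R * R * R * R | cell S p.1 /\ 0 < p.2 < l] =
      cell S `*` `]0, l[%classic by [].
    by apply/seteqP; split => p /= [h1 h2]; split => //; move: h2; rewrite /= in_itv.
  apply: ae_imp (@L2_slice _ _ _ _ R (product_sf (product_sf mu mu) mu) mu _ _
    (measurable_cell oS) mI _ LBij) => x1 h x0.
  by apply: h; rewrite /= in_itv.
apply: ae_imp (ae_forall_fin key) => x1 h x0 i j; exact: (h (i, j)).
Qed.

(** Correctors are fixed only up to null sets, so the four claims are made for an arbitrary choice
    of them; closedness of [Hrel] is assumed just where existence is asserted. [C] is chosen before
    [l] and [Q], which expresses that it depends on [alpha], [beta], [gamma] and [S] alone. *)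
Theorem proposition3p1 (R : realType) (S : set (R * R)) (gamma : \bar R)
    (alpha beta : R) (hS : cross_section S) (hgamma : (0 <= gamma)%E)
    (halpha : 0 < alpha) (hbeta : alpha <= beta) :
  exists C : R, 0 < C /\
  forall (l : R) (Q : R -> R * R * R -> 'M[R]_3 -> R),
  0 < l -> admissible S l alpha beta Q ->
  (closed_in_H S (Hrel S gamma) ->
   forall (x1 : R) (i : 'I_4), 0 < x1 < l ->
     exists chi, is_corrector S (Q x1) gamma i chi) /\
  (forall (x1 : R) (i : 'I_4) chi chi', 0 < x1 < l ->
     is_corrector S (Q x1) gamma i chi ->
     is_corrector S (Q x1) gamma i chi' -> eqf S chi chi') /\
  forall chi : R -> 'I_4 -> R * R * R -> 'M[R]_3,
  (forall (x1 : R) (i : 'I_4), 0 < x1 < l -> is_corrector S (Q x1) gamma i (chi x1 i)) ->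
  let M x1 := avg S (Q x1) (chi x1) in
  [/\ (forall x1 : R, 0 < x1 < l ->
         [/\ (M x1)^T = M x1,
             forall k : 'cV[R]_4, k != 0 -> 0 < qf (M x1) k &
             forall k : 'cV[R]_4,
               C^-1 * (k^T *m k) 0 0 <= qf (M x1) k <= C * (k^T *m k) 0 0]),
      piecewise_continuous (@close_mx R 4) l M,
      (forall (x1 : R) (K : 'M[R]_3) (a : R), 0 < x1 < l -> skew_mx K ->
         Qhom S (Q x1) gamma K a = qf (M x1) (coords K a)) &
      forall (B : R -> R * R * R -> 'M[R]_3) (Keff : R -> 'M[R]_3)
             (aeff : R -> R),
      (forall i j, L2 leb4 [set p : R * R * R * R | cell S p.1 /\ 0 < p.2 < l]
                     (fun p => B p.2 p.1 i j)) ->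
      (forall i j, L2 leb1 `]0, l[ (fun x1 => Keff x1 i j)) ->
      L2 leb1 `]0, l[ aeff ->
      {ae leb1, forall x1 : R, 0 < x1 < l -> skew_mx (Keff x1)} ->
      {ae leb1, forall x1 : R, 0 < x1 < l -> exists P,
         is_Prel S (Q x1) gamma (Estrain (Keff x1) (aeff x1)) P /\
         is_Prel S (Q x1) gamma (fun z => symp (B x1 z)) P} ->
      {ae leb1, forall x1 : R, 0 < x1 < l ->
         let k := invmx (M x1) *m bvec S (Q x1) (B x1) (chi x1) in
         Keff x1 = k 1 0 *: K2 + k 2 0 *: K3 + k 3 0 *: K4 /\
         aeff x1 = k 0 0}].
Proof.
have [[oS _ S0 bS _] _] := hS.
have [c c0 coercive] := strain_coercive oS bS S0.
pose D := \sum_i norm2 S (Eb i).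
have beta0 : 0 <= beta := le_trans (ltW halpha) hbeta.
have D0 : 0 <= D by apply: sumr_ge0 => i _; exact: norm2_ge0.
have ac0 : 0 < alpha * c by rewrite mulr_gt0.
(* The second term gives 1/C <= [alpha * c], the lower bound; the third dominates the upper bound
   obtained from the uncorrected strains. *)
pose C := 1 + (alpha * c)^-1 + beta * D.
have bD0 : 0 <= beta * D by rewrite mulr_ge0.
have aci : 0 < (alpha * c)^-1 by rewrite invr_gt0.
have C0 : 0 < C by rewrite /C; lra.
exists C; split => // l Q l0 adm.
have Hq x1 := @admissible_quadratic _ _ _ _ _ _ adm x1.
have mq x1 := @admissible_measurable _ _ oS _ _ _ _ adm x1.
have bq x1 := @admissible_bounds _ _ _ _ _ _ adm x1.
split.
  move=> closedH x1 i hx.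
  exact: (corrector_exists oS bS (Hq x1 hx) (mq x1 hx) halpha hbeta (bq x1 hx) hgamma).
split.
  move=> x1 i chi chi' hx.
  exact: (corrector_unique oS bS (Hq x1 hx) (mq x1 hx) halpha (bq x1 hx)).
move=> chi chiP M.
have chiP1 x1 (hx : 0 < x1 < l) i := chiP x1 i hx.
have lower x1 (k : 'cV[R]_4) : 0 < x1 < l -> alpha * c * (k^T *m k) 0 0 <= qf (M x1) k.
  move=> hx; apply: (qf_avg_ge oS bS (Hq x1 hx) (mq x1 hx) halpha (bq x1 hx) hgamma
    (chiP1 x1 hx)) => K a psi; exact: coercive.
have kkE (k : 'cV[R]_4) : (k^T *m k) 0 0 = \sum_i k i 0 ^+ 2.
  by rewrite mxE; apply: eq_bigr => i _; rewrite mxE expr2.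
have kk0 (k : 'cV[R]_4) : 0 <= (k^T *m k) 0 0.
  by rewrite kkE; apply: sumr_ge0 => i _; exact: sqr_ge0.
have definite x1 (k : 'cV[R]_4) : 0 < x1 < l -> k != 0 -> 0 < qf (M x1) k.
  move=> hx k0; apply: lt_le_trans (lower x1 k hx); rewrite mulr_gt0 //.
  rewrite lt_neqAle kk0 andbT eq_sym; apply: contra k0 => /eqP; rewrite kkE.
  move/psumr_eq0P => h; apply/eqP/matrixP => i j; rewrite ord1 mxE.
  by apply/eqP; rewrite -sqrf_eq0 h // => l' _; exact: sqr_ge0.
split.
- move=> x1 hx; split; [exact: avg_sym|by move=> k; exact: definite|move=> k].
  apply/andP; split.
    apply: le_trans (lower x1 k hx); apply: ler_wpM2r => //.
    by rewrite invf_ple ?posrE // /C; lra.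
  apply: le_trans (qf_avg_le oS bS (Hq x1 hx) (mq x1 hx) halpha hbeta (bq x1 hx) hgamma
    (chiP1 x1 hx) k) _.
  apply: le_trans (ler_wpM2l beta0 (norm2_Estrain_le oS bS k)) _.
  by rewrite mulrA; apply: ler_wpM2r => //; rewrite /C -/D; lra.
- exact: (avg_piecewise_continuous oS bS halpha hbeta adm chiP).
- move=> x1 K a hx sK.
  exact: (Qhom_avg oS bS (Hq x1 hx) (mq x1 hx) halpha (bq x1 hx) hgamma (chiP1 x1 hx)).
move=> B Keff aeff LB _ _ sK hP.
have both := ae_imp2 (fun _ => @conj _ _) sK hP.
apply: ae_imp2 both (L2field_slices oS LB) => x1 [h1 h2] LBx hx.
have [P [PE PB]] := h2 hx.
have E := effective_coords oS bS (Hq x1 hx) (mq x1 hx) halpha (bq x1 hx) hgamma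
  (chiP1 x1 hx) (h1 hx) (LBx hx) PE PB.
have uM : M x1 \in unitmx by apply: definite_unitmx => k' k'0; exact: definite.
(* By [E] the vector b is M applied to the coordinates of the effective pair, so inverting M returns
   these coordinates. *)
rewrite -E mulKmx //.
split; first exact: skew_of_coords (h1 hx).
by have [-> _ _ _] := coordsE (aeff x1) (h1 hx).
Qed.
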